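(* Let $N\ge 1$ be an integer, $1<p<\infty$ and $0<r_0<r_1$. Let $B_1=B(0,r_1)\subset\mathbb{R}^N$, let $\mathcal{F}$ be the family of all domains of the form $\Omega=B_1\setminus\overline{B_0}$, where $B_0$ is an open ball of radius $r_0$ with $\overline{B_0}\subset B_1$, and put $\Omega_0=B(0,r_1)\setminus\overline{B(0,r_0)}$. Then the first Dirichlet eigenvalue $\lambda_1(\Omega)$ of the $p$-Laplacian is maximal on $\mathcal{F}$ at $\Omega=\Omega_0$ and only there (i.e. only when the balls are concentric): $\lambda_1(\Omega)\le\lambda_1(\Omega_0)$ for all $\Omega\in\mathcal{F}$, with equality only if $\Omega=\Omega_0$.
   Context: $B(a,r)$ denotes the open Euclidean ball of centre $a$ and radius $r$ in $\mathbb{R}^N$. The $p$-Laplacian is $\Delta_p f=\mathrm{div}(|\nabla f|^{p-2}\nabla f)$. For a bounded open set $\Omega\subset\mathbb{R}^N$, the first Dirichlet eigenvalue of the $p$-Laplacian (the principal eigenvalue of $-\Delta_p u=\lambda|u|^{p-2}u$ in $\Omega$, $u=0$ on $\partial\Omega$) is $$\lambda_1(\Omega):=\inf\left\{\frac{\|\nabla\varphi\|^p_{L^p(\Omega)}}{\|\varphi\|^p_{L^p(\Omega)}}\;:\;\varphi\in W^{1,p}_0(\Omega),\ \varphi\neq 0\right\}.$$ *)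

(* Defs.v *)
From HB Require Import structures.
From mathcomp Require Import all_boot all_order all_algebra.
From mathcomp Require Import all_classical all_reals all_analysis.
Import Order.TTheory GRing.Theory Num.Theory.
Import numFieldNormedType.Exports.

Set Implicit Arguments.
Unset Strict Implicit.
Unset Printing Implicit Defensive.

Local Open Scope classical_set_scope.
Local Open Scope ring_scope.

(* The product sigma-algebra on R^n, which is its Borel sigma-algebra. *)
Section measurable_rV.
Context {R : realType} {n : nat}.

Definition rV_coord (i : 'I_n) (x : 'rV[R]_n) : measurableTypeR R := x 0 i.

Definition measurable_rV : set (set 'rV[R]_n) := g_sigma_preimage rV_coord.

Fact rV_display : measure_display. Proof. exact: default_measure_display. Qed.

Let measurable_rV0 : measurable_rV set0.
Proof. exact: sigma_algebra0. Qed.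

Let measurable_rVC A : measurable_rV A -> measurable_rV (~` A).
Proof. exact: sigma_algebraC. Qed.

Let measurable_rV_bigcup (F : _^nat) : (forall i, measurable_rV (F i)) ->
  measurable_rV (\bigcup_i (F i)).
Proof. exact: sigma_algebra_bigcup. Qed.

HB.instance Definition _ := @isMeasurable.Build rV_display
  'rV[R]_n measurable_rV measurable_rV0 measurable_rVC measurable_rV_bigcup.

Lemma measurable_rV_coord (i : 'I_n) : measurable_fun [set: 'rV[R]_n] (rV_coord i).
Proof.
move=> _ Y mY; rewrite setTI; apply: sub_sigma_algebra => /=.
rewrite -bigcup_seq/=; exists i => /=; first by rewrite mem_index_enum.
by exists Y => //; rewrite setTI.
Qed.

Lemma measurable_fun_rV d (T : measurableType d) (f : T -> 'rV[R]_n) :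
  (forall i, measurable_fun [set: T] (rV_coord i \o f)) ->
  measurable_fun [set: T] f.
Proof.
move=> mf.
have sub : g_sigma_preimage (fun i => rV_coord i \o f) `<=` measurable.
  apply: smallest_sub; first exact: sigma_algebra_measurable.
  rewrite -bigcup_seq /=; apply: bigcup_sub => i _ A [B mB <-].
  exact: mf.
move=> _ A mA; apply: sub.
by rewrite g_sigma_preimage_comp; exists A.
Qed.

End measurable_rV.

(* Lebesgue measure on R^n, by induction on n: the product of the measure on R
   with the one on R^n, carried to R^(n+1) by (t, y) |-> (t, y_1, ..., y_n). *)
Section lebesgue_rV.
Context {R : realType}.

Section step.
Variable n : nat.
Implicit Types z : measurableTypeR R * 'rV[R]_n.

Definition rV_cons z : 'rV[R]_n.+1 :=
  \row_i (if unlift 0 i is Some j then z.2 0 j else z.1).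

Lemma rV_cons0 z : rV_cons z 0 0 = z.1.
Proof. by rewrite mxE unlift_none. Qed.

Lemma rV_consS z (i : 'I_n) : rV_cons z 0 (lift 0 i) = z.2 0 i.
Proof. by rewrite mxE liftK. Qed.

Lemma measurable_rV_cons : measurable_fun setT rV_cons.
Proof.
apply: measurable_fun_rV => i; case: (unliftP 0 i) => [j ->|->].
  rewrite (_ : _ \o _ = rV_coord j \o snd); last first.
    by apply/funext => z; exact: rV_consS.
  by apply: measurableT_comp; [exact: measurable_rV_coord|].
rewrite (_ : _ \o _ = fst)//.
by apply/funext => z; exact: rV_cons0.
Qed.

HB.instance Definition _ :=
  isMeasurableFun.Build _ _ _ _ rV_cons measurable_rV_cons.

Definition rV_uncons (x : 'rV[R]_n.+1) : measurableTypeR R * 'rV[R]_n :=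
  (x 0 0, \row_i x 0 (lift 0 i)).

Lemma rV_consK : cancel rV_cons rV_uncons.
Proof.
move=> [t y]; congr pair; first exact: rV_cons0.
by apply/rowP => i; rewrite mxE rV_consS.
Qed.

Lemma measurable_rV_uncons : measurable_fun setT rV_uncons.
Proof.
apply/measurable_fun_pairP; split => /=; first exact: (measurable_rV_coord 0).
apply: measurable_fun_rV => i.
rewrite (_ : _ \o _ = rV_coord (lift 0 i)); first exact: measurable_rV_coord.
by apply/funext => x; rewrite /rV_coord /= mxE.
Qed.

Variable mu : {sigma_finite_measure set 'rV[R]_n -> \bar R}.

Definition lebesgue_rVS : set 'rV[R]_n.+1 -> \bar R :=
  pushforward (lebesgue_measure \x mu)%E rV_cons.

Let lebesgue_rVS0 : lebesgue_rVS set0 = 0%E.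
Proof. by rewrite /lebesgue_rVS /pushforward preimage_set0 measure0. Qed.

Let lebesgue_rVS_ge0 A : (0 <= lebesgue_rVS A)%E.
Proof. exact: (@measure_ge0 _ _ _ (pushforward (lebesgue_measure \x mu)%E rV_cons)).
Qed.

Let lebesgue_rVS_sigma_additive : semi_sigma_additive lebesgue_rVS.
Proof.
exact: (@measure_semi_sigma_additive _ _ _
  (pushforward (lebesgue_measure \x mu)%E rV_cons)).
Qed.

HB.instance Definition _ := isMeasure.Build _ _ _ lebesgue_rVS
  lebesgue_rVS0 lebesgue_rVS_ge0 lebesgue_rVS_sigma_additive.

Let lebesgue_rVS_sigma_finite : sigma_finite setT lebesgue_rVS.
Proof.
have /sigma_finiteP[F [FT ndF Foo]] := sigma_finiteT (@lebesgue_measure R).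
have /sigma_finiteP[G [GT ndG Goo]] := sigma_finiteT mu.
exists (fun k => rV_uncons @^-1` (F k `*` G k)).
  apply/esym; rewrite -subTset => x _.
  have [k _ Fk] : (\bigcup_k F k) (rV_uncons x).1 by rewrite -FT.
  have [l _ Gl] : (\bigcup_k G k) (rV_uncons x).2 by rewrite -GT.
  exists (maxn k l) => //; split.
    by move: Fk; exact/subsetPset/ndF/leq_maxl.
  by move: Gl; exact/subsetPset/ndG/leq_maxr.
move=> k; have [mF Fk] := Foo k; have [mG Gk] := Goo k; split.
  rewrite -[X in measurable X]setTI; apply: measurable_rV_uncons => //.
  exact: measurableX.
rewrite /lebesgue_rVS /pushforward -comp_preimage.
have -> : rV_uncons \o rV_cons = id by apply/funext => z; exact: rV_consK.
by rewrite preimage_id product_measure1E// lte_mul_pinfty// ge0_fin_numE.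
Qed.

HB.instance Definition _ := Measure_isSigmaFinite.Build _ _ _ lebesgue_rVS
  lebesgue_rVS_sigma_finite.

End step.

Fixpoint lebesgue_rV (n : nat) : {sigma_finite_measure set 'rV[R]_n -> \bar R} :=
  if n is n'.+1 then lebesgue_rVS (lebesgue_rV n') else \d_(0 : 'rV[R]_0).

Lemma lebesgue_rV_prod n (A : 'I_n -> set (measurableTypeR R)) :
  (forall i, measurable (A i)) ->
  lebesgue_rV n [set x | forall i, A i (x 0 i)] =
  (\prod_(i < n) lebesgue_measure (A i))%E.
Proof.
elim: n A => [|n IHn] A mA.
  rewrite big_ord0 -(diracT R (0 : 'rV[R]_0)); congr (lebesgue_rV 0 _).
  by rewrite -subTset => x _ [].
have mB : measurable [set y : 'rV[R]_n | forall i, A (lift 0 i) (y 0 i)].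
  rewrite (_ : [set _ | _] =
      \big[setI/setT]_(i < n) (rV_coord i @^-1` A (lift 0 i))); last first.
    rewrite -bigcap_seq; apply/seteqP; split => y Ay; first by move=> i _; exact: Ay.
    by move=> i; apply: (Ay i); rewrite /= mem_index_enum.
  apply: bigsetI_measurable => i _; rewrite -[X in measurable X]setTI.
  exact: measurable_rV_coord.
rewrite big_ord_recl -IHn// -product_measure1E// /lebesgue_rVS /pushforward.
congr product_measure1; apply/seteqP; split => -[t y] /= Ay.
  split=> [|i]; first by have := Ay 0; rewrite rV_cons0.
  by have := Ay (lift 0 i); rewrite rV_consS.
move=> i; case: (unliftP 0 i) => [j ->|->]; first by rewrite rV_consS; apply: Ay.2.
by rewrite rV_cons0; exact: Ay.1.
Qed.

End lebesgue_rV.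

Section first_eigenvalue.
Context {R : realType} {N : nat}.
Local Notation V := 'rV[R]_N.
Local Notation mu := (lebesgue_rV N).
Implicit Types (Omega : set V) (p : R) (u phi : V -> R) (g : V -> V).

(* The library's norm and balls on 'rV are those of the sup norm. *)
Definition enorm (x : V) : R := Num.sqrt (\sum_i x 0 i ^+ 2).

Definition eball (a : V) (r : R) : set V := [set x | enorm (x - a) < r].

Definition partial (i : 'I_N) (f : V -> R) : V -> R := 'D_(delta_mx 0 i) f.

Definition gradient (f : V -> R) (x : V) : V := \row_i partial i f x.

Definition iter_partial (s : seq 'I_N) (f : V -> R) : V -> R :=
  foldr partial f s.

(* C^oo: every iterated partial derivative exists and is continuous. *)
Definition smooth (f : V -> R) : Prop :=
  forall s : seq 'I_N, continuous (iter_partial s f) /\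
    forall i x, derivable (iter_partial s f) x (delta_mx 0 i).

(* C_c^oo(Omega), functions being extended by 0 outside Omega. *)
Definition test_function Omega phi : Prop :=
  let supp := closure [set x | phi x != 0] in
  [/\ smooth phi, compact supp & supp `<=` Omega].

Definition Lp Omega p u : Prop :=
  measurable_fun Omega u /\ (\int[mu]_(x in Omega) (`|u x| `^ p)%:E < +oo)%E.

Definition Lp_vec Omega p g : Prop :=
  measurable_fun Omega g /\
  (\int[mu]_(x in Omega) (enorm (g x) `^ p)%:E < +oo)%E.

Definition weak_gradient Omega u g : Prop :=
  forall phi, test_function Omega phi -> forall i : 'I_N,
    \int[mu]_(x in Omega) (u x * partial i phi x) =
    - \int[mu]_(x in Omega) (g x 0 i * phi x).

(* u belongs to W^{1,p}(Omega), with weak gradient g. *)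
Definition W1p Omega p u g : Prop :=
  [/\ Lp Omega p u, Lp_vec Omega p g & weak_gradient Omega u g].

(* u belongs to W^{1,p}_0(Omega), the closure of C_c^oo(Omega) in W^{1,p}(Omega),
   with weak gradient g. *)
Definition W1p0 Omega p u g : Prop :=
  W1p Omega p u g /\
  forall e : R, 0 < e -> exists2 phi, test_function Omega phi &
    (\int[mu]_(x in Omega) (`|u x - phi x| `^ p)%:E +
     \int[mu]_(x in Omega) (enorm (g x - gradient phi x) `^ p)%:E < e%:E)%E.

(* The infimum is taken in \bar R: it is +oo if there is no competitor. *)
Definition lambda1 p Omega : \bar R :=
  ereal_inf [set q | exists u g,
    [/\ W1p0 Omega p u g,
        ~ {ae mu, forall x, Omega x -> u x = 0} &
        q = ((\int[mu]_(x in Omega) (enorm (g x) `^ p)) /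
             (\int[mu]_(x in Omega) (`|u x| `^ p)))%:E]].

Definition ring_domain (r0 r1 : R) (a : V) : set V :=
  eball 0 r1 `\` closure (eball a r0).

Definition ring_family (r0 r1 : R) : set (set V) :=
  [set Omega | exists2 a : V, closure (eball a r0) `<=` eball 0 r1 &
    Omega = ring_domain r0 r1 a].

End first_eigenvalue.

(* Main.v *)
Require Import Defs.
From HB Require Import structures.
From mathcomp Require Import all_boot all_order all_algebra.
From mathcomp Require Import all_classical all_reals all_analysis.
From mathcomp Require Import measurable_realfun ring lra.
Import Order.TTheory GRing.Theory Num.Theory.
Import numFieldNormedType.Exports.
Set Implicit Arguments.
Unset Strict Implicit.
Unset Printing Implicit Defensive.
Local Open Scope classical_set_scope.
Local Open Scope ring_scope.

(* Let [l] be the eigenvalue of the concentric ring and [u] its positive radial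
   eigenfunction, whose maximum 1 is attained on a sphere S centred at 0.

   In the ring whose hole is centred at [a <> 0], use the test function
   [min (A x) (B (x - a))], where [A] is [u] outside S and 1 inside, and [B] is
   [u] inside S and 1 outside. Its energy is at most the energies of [A] and [B]
   together, that is, the energy of [u]. Since [min^p + max^p = A^p + B^p],
   translation invariance shows that the integral of its p-th power exceeds that
   of [u^p] by the integral of [1 - max^p], which is positive because S and its
   translate differ. Hence the eigenvalue of this ring is smaller than [l].

   Conversely [X = |grad u|^(p-2) grad u / u^(p-1)] satisfies
   [div X = - l - (p - 1) |X|^(p/(p-1))]; integrating [div (|phi|^p X)] and
   applying Young's inequality bounds the Rayleigh quotient of every test
   function [phi] on the concentric ring below by [l].

   The function [u] is found by shooting for the radial form of this Riccati
   equation. *)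

(** * Calculus on the line *)

(** The number [l] is never identified with the eigenvalue of the concentric ring. It only separates
    the two eigenvalues, strictly from the eccentric one, so that neither minimizers nor a
    regularity theory are called on. Radial functions are functions of [sqn x], a polynomial and
    hence smooth at the origin too; accordingly the radii enter through their squares. The
    second-order equation for [u] is degenerate or singular where its gradient vanishes; the flux
    [X] obeys a first-order equation instead, and [u] follows by a quadrature. The main obstacle is
    regularity. Competitors for [lambda1] are limits of smooth compactly supported functions,
    whereas [u] is only C^1 inside the ring and continuous up to its boundary. Hence [u] is
    truncated near its zeros, the two halves are frozen beyond the critical sphere, and a smooth
    minimum replaces the minimum. Each change costs an arbitrarily small amount, which the strict
    gain absorbs. The only integration by parts is that the partial derivatives of a compactly
    supported function have integral 0; it follows from translation invariance. *)

Section is_derive_pointwise.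
Context {R : realType} {V : normedModType R}.
Implicit Types (f g : V -> R) (x v : V).

Lemma is_derive_fcst (c : R) x v : is_derive x v (fun=> c) 0.
Proof. exact: is_derive_cst. Qed.

Lemma is_derive_fD f g x v a b : is_derive x v f a -> is_derive x v g b ->
  is_derive x v (fun y => f y + g y) (a + b).
Proof. by move=> ? ?; exact: is_deriveD. Qed.

Lemma is_derive_fB f g x v a b : is_derive x v f a -> is_derive x v g b ->
  is_derive x v (fun y => f y - g y) (a - b).
Proof. by move=> ? ?; exact: is_deriveB. Qed.

Lemma is_derive_fM f g x v a b : is_derive x v f a -> is_derive x v g b ->
  is_derive x v (fun y => f y * g y) (a * g x + f x * b).
Proof.
move=> fa gb; rewrite addrC [a * _]mulrC.
exact: (is_deriveM (dg := b) (df := a)).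
Qed.

Lemma is_derive_fZ (c : R) f x v a : is_derive x v f a ->
  is_derive x v (fun y => c * f y) (c * a).
Proof. by move=> ?; exact: is_deriveZ. Qed.

Lemma is_derive_fDc (c : R) f x v a : is_derive x v f a ->
  is_derive x v (fun y => f y + c) a.
Proof.
by move=> fa; rewrite -[a]addr0; exact: (is_derive_fD fa (is_derive_fcst c x v)).
Qed.

(** A directional derivative at [x] sees only the line through [x]. Moved to the real line, it falls
    under the one-variable chain rule, so partial derivatives of composites require no total
    differentiability of [f]. *)
Lemma is_derive_line f x v a :
  is_derive x v f a <-> is_derive (0 : R) 1 (fun h : R => f (h *: v + x)) a.
Proof.
have E : (fun h : R => h^-1 *: ((fun k : R => f (k *: v + x)) (h *: 1 + 0)
             - f (0 *: v + x))) =
         (fun h : R => h^-1 *: (f (h *: v + x) - f x)).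
  by apply/funext => h; rewrite addr0 scale0r add0r [h *: 1]mulr1.
split=> -[d <-]; split.
- exact: (derivable1P _ _ _).1.
- by rewrite /derive E.
- exact: (derivable1P _ _ _).2.
- by rewrite /derive E.
Qed.

Lemma is_derive_fcomp (h : R -> R) f x v a b :
  is_derive (f x) 1 h a -> is_derive x v f b ->
  is_derive x v (fun y => h (f y)) (a * b).
Proof.
move=> ha /is_derive_line fb; apply/is_derive_line.
have := @is_derive1_comp _ h (fun h : R => f (h *: v + x)) 0 a b.
by apply => //; rewrite scale0r add0r.
Qed.

End is_derive_pointwise.

Section real_calculus.
Context {R : realType}.
Implicit Types (f g : R -> R) (x : R).

Lemma is_derive_cont f x a : is_derive x 1 f a -> {for x, continuous f}.
Proof. by case=> /derivable1_diffP /differentiable_continuous. Qed.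

Lemma is_derive_fV f x a : f x != 0 -> is_derive x 1 f a ->
  is_derive x 1 (fun y => (f y)^-1) (- a / f x ^+ 2).
Proof.
move=> fx0 fa; apply: DeriveDef; first by apply: derivableV => //; case: fa.
rewrite deriveV; [|by []|by case: fa].
by case: fa => _ ->; rewrite /GRing.scale/= mulNr mulNr mulrC.
Qed.

(** The sign of the derivative at one point already excludes an extremum there, with no information
    on the derivative nearby. The comparison arguments below apply this at a point of maximum or
    minimum. *)
Lemma is_derive_quotient_lt f x a : is_derive x 1 f a -> a < 0 ->
  exists2 e : R, 0 < e & forall y,
   (x - e < y < x -> f x < f y) /\ (x < y < x + e -> f y < f x).
Proof.
move=> [fx <-] a0; move: fx; rewrite /derivable => /cvg_ex[/= l fl].
have la : l = 'D_1 f x by apply/esym/cvg_lim.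
rewrite -la in a0 *; have l0 : 0 < - l by rewrite oppr_gt0.
move/cvgrPdist_lt : fl => /(_ _ l0)[e /= e0 fe].
exists e => // y.
have key : y != x -> `|y - x| < e -> (y - x)^-1 * (f y - f x) < 0.
  move=> yx ye; have := fe (y - x); rewrite /= sub0r normrN => /(_ ye).
  rewrite subr_eq0 => /(_ yx).
  rewrite /= [_ *: 1]mulr1 subrK distrC.
  rewrite /GRing.scale/= ltr_norml => /andP[_]; lra.
split => /andP[y1 y2].
- have := key (negbT (lt_eqF y2)).
  rewrite ltr0_norm ?subr_lt0// opprB => /(_ ltac:(lra)).
  by rewrite nmulr_rlt0 ?invr_lt0 ?subr_lt0// subr_gt0.
- have := key (negbT (gt_eqF y1)).
  rewrite gtr0_norm ?subr_gt0// => /(_ ltac:(lra)).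
  by rewrite pmulr_rlt0 ?invr_gt0 ?subr_gt0// subr_lt0.
Qed.

Lemma within_continuous f (A : set R) : continuous f -> {within A, continuous f}.
Proof. exact: continuous_subspaceT. Qed.

Lemma is_derive_le0_nincr f df a b : a <= b ->
  (forall x, a < x < b -> is_derive x 1 f (df x)) ->
  {within `[a, b], continuous f} ->
  (forall x, a < x < b -> df x <= 0) -> f b <= f a.
Proof.
move=> ab fdf cf df0.
apply: (@ler0_derive1_nincr _ f a b) => // x; rewrite in_itv/= => xab.
  by case: (fdf _ xab).
by rewrite derive1E; case: (fdf _ xab) => _ ->; exact: df0.
Qed.

(* The comparison function is [(f + k / C) exp (- C t)]. *)
Lemma gronwall f df (a b C k : R) : a <= b -> 0 < C -> 0 <= k ->
  {within `[a, b], continuous f} ->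
  (forall t, a < t < b -> is_derive t 1 f (df t)) ->
  (forall t, a < t < b -> df t <= C * f t + k) ->
  f b <= (f a + k / C) * expR (C * (b - a)) - k / C.
Proof.
move=> ab C0 k0 cf fdf df_le.
pose g t := (f t + k / C) * expR (- C * t).
pose dg t := df t * expR (- C * t) +
             (f t + k / C) * (expR (- C * t) * - C).
have gdg t : a < t < b -> is_derive t 1 g (dg t).
  move=> tab; apply: is_derive_fM.
    by apply: is_derive_fDc; exact: fdf.
  apply: (@is_derive_fcomp _ _ expR ( *%R (- C))).
  rewrite -[X in is_derive _ _ _ X]mulr1.
  exact: (@is_derive_fZ _ _ _ id).
have cg : {within `[a, b], continuous g}.
  move=> t; apply: cvgM.
    by apply: cvgD; [exact: cf|exact: cvg_cst].
  apply: within_continuous => {}t.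
  apply: continuous_comp; last exact: continuous_expR.
  by apply: cvgM; [exact: cvg_cst|exact: cvg_id].
have : g b <= g a.
  apply: (is_derive_le0_nincr ab gdg cg) => t tab.
  rewrite /dg; have := df_le t tab; have := expR_gt0 (- C * t).
  set E := expR _; move=> E0 dle.
  have -> : df t * E + (f t + k / C) * (E * - C) = (df t - (C * f t + k)) * E.
    by field; rewrite gt_eqF.
  by rewrite pmulr_lle0// subr_le0.
rewrite /g => gab.
rewrite lerBrDr.
have e0 : 0 < expR (C * b) := expR_gt0 _.
have := ler_wpM2r (ltW e0) gab; rewrite -!mulrA -!expRD.
rewrite (_ : - C * b + C * b = 0); last by ring.
rewrite expR0 mulr1 (_ : - C * a + C * b = C * (b - a)); last by ring.
by [].
Qed.

End real_calculus.

Lemma near_ltr {R : realType} (t z : R) : t < z -> \forall y \near t, y < z.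
Proof. by move=> tz; apply: (@cvgr_lt _ _ (nbhs t) _ id t) => //; exact: cvg_id. Qed.

Lemma near_gtr {R : realType} (t z : R) : z < t -> \forall y \near t, z < y.
Proof. by move=> tz; apply: (@cvgr_gt _ _ (nbhs t) _ id t) => //; exact: cvg_id. Qed.

(** * Powers of absolute values and their odd variants *)

Section powers.
Context {R : realType}.
Implicit Types (p q x y t : R).

(** The odd power [|t|^(q-1) t]. For [q = p - 1] it is the derivative of [|t|^p] up to the factor
    [p]; for [q = 1 / (p - 1)] it inverts [s |-> |s|^(p-2) s] and recovers a gradient from its
    flux. *)
Definition spowR q t : R := Num.sg t * `|t| `^ q.

Lemma powR_norm_cont q : 0 < q -> continuous (fun t : R => `|t| `^ q).
Proof.
move=> q0 t; have [->|t0] := eqVneq t 0.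
  apply/cvgrPdist_lt => /= e e0; near=> y.
  rewrite normr0 powR0 ?gt_eqF// sub0r normrN ger0_norm ?powR_ge0//.
  have : `|y| < e `^ q^-1.
    near: y; have := @cvgr0_norm_lt R R^o R (nbhs (0 : R)) _ id.
    by apply; [exact: cvg_id|rewrite powR_gt0].
  move=> /(gt0_ltr_powR q0); rewrite !nnegrE normr_ge0 powR_ge0 => /(_ isT isT).
  by rewrite -powRrM mulVf ?gt_eqF// powRr1// ltW.
apply: (@continuous_comp _ _ _ (fun y : R => `|y|) (fun u => u `^ q)).
  exact: norm_continuous.
have t0' : 0 < `|t : R| by rewrite normr_gt0.
exact: (is_derive_cont (is_derive1_powR q t0')).
Unshelve. all: by end_near. Qed.

Lemma spowR0 q : spowR q 0 = 0.
Proof. by rewrite /spowR sgr0 mul0r. Qed.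

Lemma spowR_mul q t : 0 < q -> spowR q t * t = `|t| `^ (q + 1).
Proof.
move=> q0; have [->|t0] := eqVneq t 0.
  by rewrite mulr0 normr0 powR0// gt_eqF// addr_gt0.
rewrite powRD ?normr_eq0 ?t0 ?implybT// powRr1// /spowR mulrAC.
by rewrite -normrEsg mulrC.
Qed.

Lemma norm_spowR q t : 0 < q -> `|spowR q t| = `|t| `^ q.
Proof.
move=> q0; have [->|t0] := eqVneq t 0.
  by rewrite spowR0 !normr0 powR0// gt_eqF.
by rewrite normrM normr_sg t0 mul1r ger0_norm// powR_ge0.
Qed.

(** At 0 the difference quotient has absolute value [|h|^(p-1)], which tends to 0 because [p > 1].
    Elsewhere [|t|] is locally [t] or [- t]. *)
Lemma is_derive_norm_powR p t : 1 < p ->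
  is_derive t 1 (fun t : R => `|t| `^ p) (p * spowR (p - 1) t).
Proof.
move=> p1; have [->|t0] := eqVneq t 0.
  rewrite spowR0 mulr0.
  suff H : (fun h : R => h^-1 *: (`|h *: (1 : R) + 0| `^ p - `|0 : R| `^ p)) @ (0 : R)^' --> (0 : R).
    by split; [apply/cvg_ex; exists 0|exact: cvg_lim].
  have p10 : 0 < p - 1 by lra.
  have := @powR_norm_cont (p - 1) p10 0.
  rewrite /continuous_at normr0 powR0 ?gt_eqF// => /cvgrPdist_lt H.
  apply/cvgrPdist_lt => e e0.
  have := H _ e0; move=> H'.
  near=> h.
  have h0 : h != 0 by near: h; exact: nbhs_dnbhs_neq.
  rewrite sub0r normrN powR0 ?gt_eqF//; last lra.
  rewrite subr0 addr0 [h *: 1]mulr1 [_ *: _]/(_ * _) normrM normfV.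
  rewrite (ger0_norm (powR_ge0 _ _)) -[in X in _ * X](subrK 1 p).
  rewrite powRD ?normr_eq0 ?h0 ?implybT// powRr1// [_ * `|h|]mulrC mulKf ?normr_eq0//.
  have : `|0 - `|h| `^ (p - 1)| < e by near: h; exact: nbhs_dnbhs.
  by rewrite sub0r normrN ger0_norm// powR_ge0.
have {t0}[t0|t0] : t < 0 \/ 0 < t by apply/orP; rewrite -neq_lt.
  rewrite /spowR ltr0_sg// mulN1r mulrN -mulrN1.
  apply: (@near_eq_is_derive _ _ _ (fun t => (- t) `^ p)).
    by near=> y; rewrite ltr0_norm//; near: y; exact: near_ltr.
  rewrite ltr0_norm//.
  apply: (@is_derive_fcomp _ _ (fun u => u `^ p) -%R).
  by apply: is_derive1_powR; rewrite oppr_gt0.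
rewrite /spowR gtr0_sg// mul1r gtr0_norm//.
apply: (@near_eq_is_derive _ _ _ (fun t => t `^ p)).
  by near=> y; rewrite gtr0_norm//; near: y; exact: near_gtr.
exact: is_derive1_powR.
Unshelve. all: by end_near. Qed.

Lemma spowR_cont q : 0 < q -> continuous (spowR q).
Proof.
move=> q0 t; have [->|t0] := eqVneq t 0.
  rewrite /continuous_at spowR0; apply/cvgrPdist_lt => e e0.
  have := @powR_norm_cont q q0 0; rewrite /continuous_at.
  rewrite normr0 powR0 ?gt_eqF// => /cvgrPdist_lt/(_ _ e0).
  apply: filterS => y; rewrite !sub0r !normrN norm_spowR//.
  by rewrite ger0_norm// powR_ge0.
apply: cvgM; last exact: powR_norm_cont.
apply: (@near_cst_continuous _ _ (Num.sg t)).
have {t0}[t0|t0] : t < 0 \/ 0 < t by apply/orP; rewrite -neq_lt.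
  by rewrite ltr0_sg//; near=> y; rewrite ltr0_sg//; near: y; exact: near_ltr.
by rewrite gtr0_sg//; near=> y; rewrite gtr0_sg//; near: y; exact: near_gtr.
Unshelve. all: by end_near. Qed.

(* Convexity of the power, at the points [a / (1 - t)] and [b / t]. *)
Lemma powRD_le p a b t : 1 <= p -> 0 <= a -> 0 <= b -> 0 < t < 1 ->
  (a + b) `^ p <= (1 - t) `^ (1 - p) * a `^ p + t `^ (1 - p) * b `^ p.
Proof.
move=> p1 a0 b0 /andP[t0 t1].
have E (u c : R) : 0 < u -> 0 <= c -> u * (c / u) `^ p = u `^ (1 - p) * c `^ p.
  move=> u0 c0; rewrite powRM ?invr_ge0 ?(ltW u0)// -powR_inv1 ?(ltW u0)//.
  rewrite -powRrM mulN1r mulrCA mulrC -{1}(powRr1 (ltW u0)) -powRD//.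
  by rewrite (gt_eqF u0) implybT.
have t1' : 0 < 1 - t by lra.
have := @convex_powR R p p1 (Itv01 (ltW t0) (ltW t1)) (b / t) (a / (1 - t)).
rewrite !inE/= !in_itv/= !andbT !divr_ge0 ?(ltW t0) ?(ltW t1')// => /(_ isT isT).
rewrite !convRE/= /unstable.onem !E// [X in _ <= X -> _]addrC.
have -> : a + b = t * (b / t) + (1 - t) * (a / (1 - t)) by field; rewrite !gt_eqF.
exact.
Qed.

End powers.

(** * Ordinary differential equations *)

Section picard.
Context {R : realType}.
Implicit Types (f g : R -> R) (s t x : R).

(** The intervals [[x n - e n, x n + e n]] meet pairwise, so the supremum of their left ends lies in
    all of them. The limit thus comes together with its error bound. *)
Lemma squeezed_limit (x e : nat -> R) :
  (forall n m, (n <= m)%N -> `|x m - x n| <= e n) ->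
  exists l, forall n, `|l - x n| <= e n.
Proof.
move=> xe.
have low n m : x n - e n <= x m + e m.
  by have [nm|/ltnW nm] := leqP n m; have := xe _ _ nm;
     rewrite ler_norml => /andP[]; have := xe m m (leqnn _);
     rewrite subrr normr0; have := xe n n (leqnn _); rewrite subrr normr0; lra.
pose E := [set x n - e n | n in [set: nat]].
have E0 : E !=set0 by exists (x 0 - e 0); exists 0.
have ubE n : ubound E (x n + e n) by move=> _ [k _ <-].
exists (sup E) => n; rewrite ler_norml; apply/andP; split.
  by rewrite lerBrDr addrC; apply: ub_le_sup; [exists (x 0 + e 0)|exists n].
by rewrite lerBlDr addrC; apply: ge_sup.
Qed.

(** The mean value inequality in comparison form: both [f - g] and [- f - g] are nonincreasing. *)
Lemma norm_le_of_derive f df g dg a b : a <= b ->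
  {within `[a, b], continuous f} -> {within `[a, b], continuous g} ->
  (forall t, a < t < b -> is_derive t 1 f (df t)) ->
  (forall t, a < t < b -> is_derive t 1 g (dg t)) ->
  (forall t, a < t < b -> `|df t| <= dg t) ->
  `|f b - f a| <= g b - g a.
Proof.
move=> ab cf cg fdf gdg dfg.
have H1 : f b - g b <= f a - g a.
  apply: (@is_derive_le0_nincr _ (fun t => f t - g t) (fun t => df t - dg t)) => //.
  - by move=> t tab; apply: is_derive_fB; [exact: fdf|exact: gdg].
  - by move=> t; apply: cvgB; [exact: cf|exact: cg].
  - by move=> t /dfg; rewrite ler_norml => /andP[]; lra.
have H2 : - f b - g b <= - f a - g a.
  apply: (@is_derive_le0_nincr _ (fun t => - f t - g t) (fun t => - df t - dg t)) => //.
  - move=> t tab; apply: is_derive_fB; last exact: gdg.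
    by apply: is_deriveN; exact: fdf.
  - by move=> t; apply: cvgB; [apply: cvgN; exact: cf|exact: cg].
  - by move=> t /dfg; rewrite ler_norml => /andP[]; lra.
by rewrite ler_norml; lra.
Qed.

Local Notation mu := (@lebesgue_measure R).

Lemma continuous_integrable_itv f a b : continuous f ->
  mu.-integrable `[a, b] (EFin \o f).
Proof.
move=> cf; apply: continuous_compact_integrable; first exact: segment_compact.
exact: within_continuous.
Qed.

(** Integrating over [[s0, s]], which is empty for [s < s0], yields the constant 0 on the left. The
    fundamental theorem serves on the right; at [s0] itself a local bound [K] of [|f|] gives
    [|g s| <= K (s - s0)]. *)
Lemma antiderivative f (s0 : R) : continuous f ->
  exists g, [/\ continuous g, forall s, s <= s0 -> g s = 0 &
                forall s, s0 < s -> is_derive s 1 g (f s)].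
Proof.
move=> cf; pose g s := \int[mu]_(t in `[s0, s]) f t.
have g0 s : s <= s0 -> g s = 0.
  rewrite /g le_eqVlt => /predU1P[->|ss0]; first by rewrite set_itv1 Rintegral_set1.
  by rewrite set_itv_ge ?Rintegral_set0// bnd_simp -ltNge.
have gd s : s0 < s -> is_derive s 1 g (f s).
  move=> s0s.
  have ss1 : s < s + 1 by rewrite ltrDl.
  have [H1 H2] := continuous_FTC1_closed ss1
    (continuous_integrable_itv s0 (s + 1) cf) s0s (cf s).
  by apply: DeriveDef; [exact: H1|rewrite -derive1E; exact: H2].
exists g; split=> // s.
have [ss0|s0s|->] := ltgtP s s0; last 1 first.
- rewrite /continuous_at g0//; apply/cvgrPdist_lt => e e0.
  pose K := `|f s0| + 1.
  have K0 : 0 <= K by rewrite addr_ge0.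
  have cn : {for s0, continuous (fun t => `|f t|)}.
    by apply: continuous_comp; [exact: cf|exact: norm_continuous].
  have nK : \forall t \near nbhs s0, `|f t| < K.
    by apply: (@cvgr_lt _ _ (nbhs s0) _ (fun t => `|f t|) `|f s0|); rewrite // ltrDl.
  have [r /= r0 rK] := nK.
  near=> t; rewrite sub0r normrN.
  have [ts0|s0t] := leP t s0; first by rewrite g0// normr0.
  have ts : `|s0 - t| < e / (K + 1).
    near: t; apply: (@cvgr_dist_lt _ _ _ (nbhs s0) _ id); first exact: cvg_id.
    by rewrite divr_gt0// ltr_pwDr.
  have tr : `|s0 - t| < r.
    by near: t; apply: (@cvgr_dist_lt _ _ _ (nbhs s0) _ id); first exact: cvg_id.
  apply: le_lt_trans (_ : K * (t - s0) < _).
    apply: le_trans; first by apply: le_normr_Rintegral => //; exact: continuous_integrable_itv.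
    have -> : K * (t - s0) = \int[mu]_(x in `[s0, t]) K.
      by rewrite Rintegral_cst//= lebesgue_measure_itv/= lte_fin s0t -EFinD.
    apply: le_Rintegral => //.
    - apply: (@continuous_integrable_itv (fun x => `|f x|)) => x.
      by apply: continuous_comp; [exact: cf|exact: norm_continuous].
    - by apply: continuous_integrable_itv => x; exact: cvg_cst.
    - move=> x /=; rewrite in_itv/= => /andP[s0x xt]; apply/ltW/rK => /=.
      by move: tr; rewrite !ler0_norm ?subr_le0 ?(ltW s0t)//; lra.
  rewrite distrC gtr0_norm ?subr_gt0// ltr_pdivlMr ?ltr_pwDr// in ts.
  by apply: le_lt_trans ts; rewrite mulrC ler_wpM2l ?subr_ge0 ?(ltW s0t)// lerDl.
- apply: (@near_cst_continuous _ _ 0); near=> t.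
  by apply: g0; apply/ltW; near: t; exact: near_ltr.
- exact: is_derive_cont (gd _ s0s).
Unshelve. all: by end_near. Qed.

(** Measured against the weight [exp (2 L (s - s0))], the Picard map contracts by 1/2 on the whole
    half-line, so no local solutions have to be continued. The iterates are followed pointwise, with
    explicit errors, instead of in a function space. *)
Lemma picard (F : R -> R -> R) (s0 x0 L K : R) : 0 < L ->
  (forall f, continuous f -> continuous (fun t => F t (f t))) ->
  (forall t x y, `|F t x - F t y| <= L * `|x - y|) ->
  (forall t x, `|F t x| <= K) ->
  exists f, [/\ continuous f, forall s, s <= s0 -> f s = x0 &
     forall s, s0 < s -> is_derive s 1 f (F s (f s))].
Proof.
move=> L0 cF lF bF.
(* The Picard map has to be total: at a discontinuous [u] it returns [u] itself. All iterates are
   continuous, so this value never occurs. *)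
have step (u : R -> R) : {v : R -> R | continuous u -> [/\ continuous v,
    forall s, s <= s0 -> v s = x0 & forall s, s0 < s -> is_derive s 1 v (F s (u s))]}.
  apply: cid; have [cu|ncu] := pselect (continuous u); last by exists u.
  have [g [cg g0 dg]] := antiderivative s0 (cF _ cu).
  exists (fun s => g s + x0) => _; split.
  - by move=> s; apply: cvgD; [exact: cg|exact: cvg_cst].
  - by move=> s ss0; rewrite g0// add0r.
  - by move=> s s0s; apply: is_derive_fDc; exact: dg.
pose T u := sval (step u).
have TP u : continuous u -> [/\ continuous (T u),
    forall s, s <= s0 -> T u s = x0 & forall s, s0 < s -> is_derive s 1 (T u) (F s (u s))].
  by rewrite /T; case: (step u).
pose e s := expR (2 * L * (s - s0)).
have e_gt0 s : 0 < e s by exact: expR_gt0.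
have de s : is_derive s 1 e (e s * (2 * L)).
  apply: (@is_derive_fcomp _ _ expR (fun s => 2 * L * (s - s0))).
  rewrite -[X in is_derive _ _ _ X]mulr1; apply: is_derive_fZ.
  by apply: (@is_derive_fDc _ _ (- s0) id).
have ce : continuous e by move=> s; exact: is_derive_cont (de s).
(* The integral of [L C e] is at most [C e / 2], because the weight [e] grows at the rate [2 L]. *)
have contr u v C : continuous u -> continuous v -> 0 <= C ->
    (forall s, s0 <= s -> `|u s - v s| <= C * e s) ->
    forall s, `|T u s - T v s| <= C / 2 * e s.
  move=> cu cv C0 uv s.
  have [cTu Tu0 dTu] := TP _ cu; have [cTv Tv0 dTv] := TP _ cv.
  have C2 : 0 <= C / 2 by rewrite divr_ge0.
  have [ss0|/ltW s0s] := leP s s0.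
    by rewrite Tu0// Tv0// subrr normr0 mulr_ge0// ltW.
  have := @norm_le_of_derive (fun s => T u s - T v s) (fun s => F s (u s) - F s (v s))
    (fun s => C / 2 * e s) (fun s => C / 2 * (e s * (2 * L))) s0 s s0s.
  have -> : T u s0 = T v s0 by rewrite Tu0// Tv0.
  rewrite subrr subr0 => H; apply: le_trans (H _ _ _ _ _) _.
  - by apply: within_continuous => t; apply: cvgB; [exact: cTu|exact: cTv].
  - by apply: within_continuous => t; apply: cvgM; [exact: cvg_cst|exact: ce].
  - by move=> t /andP[? _]; apply: is_derive_fB; [exact: dTu|exact: dTv].
  - move=> t /andP[s0t _]; apply: le_trans (lF _ _ _) _.
    have := ler_wpM2l (ltW L0) (uv _ (ltW s0t)); lra.
  by rewrite lerBlDr lerDl mulr_ge0// ltW.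
pose th n := iter n T (fun=> x0).
have cth n : continuous (th n).
  elim: n => [|n IHn]; first by move=> s; exact: cvg_cst.
  by have [] := TP _ IHn.
have th0 n s : s <= s0 -> th n s = x0.
  by case: n => [//|n] ss0; have [_ H _] := TP _ (cth n); exact: H.
have K0 : 0 <= K := le_trans (normr_ge0 _) (bF 0 0).
(* With this constant [C e] has derivative [K e >= K], which bounds the first step of the iteration;
   each later step is half as large. *)
pose C := K / (2 * L).
have C0 : 0 <= C by rewrite divr_ge0// mulr_ge0// ltW.
have thS n s : `|th n.+1 s - th n s| <= C / 2 ^+ n * e s.
  elim: n s => [|n IHn] s; last first.
    have := contr _ _ _ (cth n.+1) (cth n) _ (fun s _ => IHn s) s.
    by rewrite exprSr invfM mulrA; apply; rewrite divr_ge0.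
  rewrite expr0 divr1; have [_ H0 d1] := TP _ (cth 0).
  have [ss0|/ltW s0s] := leP s s0; first by rewrite !th0// subrr normr0 mulr_ge0// ltW.
  have -> : th 0%N s = th 1%N s0 by rewrite (th0 1%N s0 (lexx _)).
  apply: le_trans (norm_le_of_derive (f := th 1%N) (df := fun s => F s (th 0%N s))
    (g := fun s => C * e s) (dg := fun s => C * (e s * (2 * L))) s0s _ _ _ _ _) _.
  - exact/within_continuous/cth.
  - by apply: within_continuous => t; apply: cvgM; [exact: cvg_cst|exact: ce].
  - by move=> t /andP[? _]; exact: d1.
  - move=> t /andP[s0t _]; apply: le_trans (bF _ _) _.
    have -> : C * (e t * (2 * L)) = K * e t by rewrite /C; field; rewrite gt_eqF.
    rewrite ler_peMr// -expR0 ler_expR mulr_ge0 ?mulr_ge0 ?ltW// subr_gt0//.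
  by rewrite lerBlDr lerDl mulr_ge0// ltW.
have X_ge0 s : 0 <= 2 * C * e s by apply: mulr_ge0; [exact: mulr_ge0|exact: ltW].
have thD n m s : (n <= m)%N -> `|th m s - th n s| <= 2 * C * e s / 2 ^+ n.
  move=> /subnK <-; move: (m - n)%N => k {m}.
  suff : `|th (k + n)%N s - th n s| <= 2 * C * e s / 2 ^+ n * (1 - 1 / 2 ^+ k).
    move/le_trans; apply; rewrite ler_piMr//.
      by rewrite divr_ge0 ?X_ge0// exprn_ge0.
  elim: k => [|k IHk]; first by rewrite subrr normr0 expr0 divr1 subrr mulr0.
  rewrite addSn; have := ler_normD (th (k + n).+1 s - th (k + n)%N s) (th (k + n)%N s - th n s).
  rewrite addrA subrK => /le_trans; apply.
  apply: le_trans (lerD (thS _ _) IHk) _.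
  rewrite exprD exprS le_eqVlt; apply/orP; left; apply/eqP; field.
  by rewrite !expf_neq0.
have /choice[f fP] : forall s, exists l, forall n, `|l - th n s| <= 2 * C * e s / 2 ^+ n.
  by move=> s; apply: (@squeezed_limit (fun n => th n s)) => n m; exact: thD.
have f0 s : s <= s0 -> f s = x0.
  move=> ss0; apply/eqP; rewrite -subr_eq0 -normr_eq0 eq_le normr_ge0 andbT.
  apply/ler_addgt0Pr => d d0; rewrite add0r.
  have [n _ nP] := near_infty_natSinv_expn_lt (PosNum (divr_gt0 d0 (ltr_pwDr (ltr01) (X_ge0 s)))).
  have := nP n (leqnn _); have := fP s n; rewrite th0//=.
  set X := 2 * C * e s => H1 H2; apply: le_trans H1 _.
  have X0 : 0 <= X := X_ge0 s.
  have Y0 : 0 < X + 1 by lra.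
  rewrite ltr_pdivlMr// in H2; apply: le_trans (ltW H2).
  by rewrite mul1r mulrC ler_wpM2l ?invr_ge0 ?exprn_ge0//; lra.
have small s d : 0 < d -> exists n, 2 * C * e s / 2 ^+ n < d.
  move=> d0; have X0 := X_ge0 s.
  have Y0 : 0 < 2 * C * e s + 1 by lra.
  have [n _ nP] := near_infty_natSinv_expn_lt (PosNum (divr_gt0 d0 Y0)).
  exists n; have /= := nP n (leqnn _); rewrite ltr_pdivlMr//; apply: le_lt_trans.
  by rewrite mul1r mulrC ler_wpM2l ?invr_ge0 ?exprn_ge0//; lra.
(* The error bound grows with the point, so it is frozen at [s + 1]; this makes it uniform on a
   neighbourhood of [s], and a third of [d] goes to each of the three differences. *)
have cf : continuous f.
  move=> s; apply/cvgrPdist_lt => d d0.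
  have d3 : 0 < d / 3 by rewrite divr_gt0.
  have [n nd] := small (s + 1) _ d3.
  have mono t : t < s + 1 -> `|f t - th n t| < d / 3.
    move=> ts; apply: le_lt_trans (fP t n) (le_lt_trans _ nd).
    apply: ler_wpM2r; first by rewrite invr_ge0 exprn_ge0.
    apply: ler_wpM2l; first exact: mulr_ge0.
    rewrite ler_expR; apply: ler_wpM2l; first by apply: mulr_ge0 => //; exact: ltW.
    lra.
  have := @cvgr_dist_lt _ _ _ (nbhs s) _ _ _ (cth n s) _ d3; move=> near_th.
  near=> t.
  have Hs := mono s ltac:(lra).
  have Ht : `|f t - th n t| < d / 3.
    by apply: mono; near: t; apply: near_ltr; lra.
  have Hst : `|th n s - th n t| < d / 3 by near: t; exact: near_th.
  by move: Hs Ht Hst; rewrite !ltr_norml => /andP[? ?] /andP[? ?] /andP[? ?]; lra.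
have [cT T0 dT] := TP _ cf.
(* [T f] and [th n.+1] are the images of [f] and [th n], so the contraction estimate makes [T f] a
   limit of the iterates, as [f] is. *)
suff fT : f = T f by exists f; split => // s s0s; rewrite {1}fT; exact: dT.
apply/funext => s; apply/eqP; rewrite -subr_eq0 -normr_eq0 eq_le normr_ge0 andbT.
apply/ler_addgt0Pr => d d0; rewrite add0r.
have [n nd] := small s _ (divr_gt0 d0 (ltr0n R 2)).
have H1 := fP s n.+1.
have X0 : 0 <= 2 * C / 2 ^+ n by rewrite divr_ge0 ?exprn_ge0// mulr_ge0.
have := contr _ _ (2 * C / 2 ^+ n) (cth n) cf X0.
have H s' : s0 <= s' -> `|th n s' - f s'| <= 2 * C / 2 ^+ n * e s'.
  by move=> _; rewrite distrC mulrAC; exact: fP.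
move=> /(_ H s) H2.
have E1 : 2 * C * e s / 2 ^+ n.+1 = 2 * C * e s / 2 ^+ n / 2.
  by rewrite exprSr invfM mulrA.
rewrite E1 in H1.
have E2 : 2 * C / 2 ^+ n / 2 * e s = 2 * C * e s / 2 ^+ n / 2 by ring.
rewrite E2 in H2.
have := ler_normD (f s - th n.+1 s) (th n.+1 s - T f s).
rewrite addrA subrK; move: H2; rewrite -/(th n.+1 s); lra.
Unshelve. all: by end_near. Qed.

End picard.

(** * The phase equation of the radial problem *)

Section lipschitz.
Context {R : realType}.
Implicit Types (f g : R -> R) (x y : R).

(** Boundedness is included because it makes Lipschitz functions stable under products; one constant
    for both properties keeps the bookkeeping short. *)
Definition lipb f := exists K : R, [/\ 0 <= K, forall x, `|f x| <= K &
  forall x y, `|f x - f y| <= K * `|x - y|].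

Lemma lipbM f g : lipb f -> lipb g -> lipb (fun x => f x * g x).
Proof.
move=> [K [K0 fK lK]] [H [H0 gH lH]]; exists (2 * (K * H) + K * H); split.
- by rewrite addr_ge0// ?mulr_ge0.
- move=> x; rewrite normrM; apply: le_trans (ler_pM _ _ (fK x) (gH x)) _ => //.
  by have := mulr_ge0 K0 H0; lra.
- move=> x y.
  have -> : f x * g x - f y * g y = (f x - f y) * g x + f y * (g x - g y) by ring.
  apply: le_trans (ler_normD _ _) _; rewrite !normrM.
  have h1 : `|f x - f y| * `|g x| <= K * `|x - y| * H by apply: ler_pM.
  have h2 : `|f y| * `|g x - g y| <= K * (H * `|x - y|) by apply: ler_pM.
  have := mulr_ge0 (mulr_ge0 K0 H0) (normr_ge0 (x - y)); lra.
Qed.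

Lemma lipbV f (d : R) : 0 < d -> lipb f -> (forall x, d <= f x) -> lipb (fun x => (f x)^-1).
Proof.
move=> d0 [K [K0 fK lK]] df.
have f0 x : 0 < f x := lt_le_trans d0 (df x).
have iv x : (f x)^-1 <= d^-1 by rewrite lef_pV2// posrE.
exists (d^-1 + K * d^-1 * d^-1); split.
- by rewrite addr_ge0 ?mulr_ge0 ?invr_ge0// ltW.
- move=> x; rewrite ger0_norm ?invr_ge0 ?(ltW (f0 x))//.
  by apply: le_trans (iv x) _; rewrite lerDl !mulr_ge0 ?invr_ge0// ltW.
- move=> x y.
  have -> : (f x)^-1 - (f y)^-1 = - (f x - f y) * ((f x)^-1 * (f y)^-1).
    by field; rewrite !gt_eqF.
  rewrite normrM normrN [`|_ * _|]ger0_norm ?mulr_ge0 ?invr_ge0 ?(ltW (f0 _))//.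
  have h : (f x)^-1 * (f y)^-1 <= d^-1 * d^-1.
    by apply: ler_pM => //; rewrite invr_ge0 ltW.
  have h2 : 0 <= (f x)^-1 * (f y)^-1 by rewrite mulr_ge0 ?invr_ge0 ?(ltW (f0 _)).
  apply: le_trans (ler_pM (normr_ge0 _) h2 (lK x y) h) _.
  have := normr_ge0 (x - y); have : 0 <= d^-1 by rewrite invr_ge0 ltW.
  move=> i0 n0; have := mulr_ge0 i0 n0; lra.
Qed.

Lemma lipbD f g : lipb f -> lipb g -> lipb (fun x => f x + g x).
Proof.
move=> [K [K0 fK lK]] [H [H0 gH lH]]; exists (K + H); split.
- by rewrite addr_ge0.
- by move=> x; apply: le_trans (ler_normD _ _) (lerD (fK x) (gH x)).
- move=> x y; rewrite opprD addrACA mulrDl.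
  exact: le_trans (ler_normD _ _) (lerD (lK x y) (lH x y)).
Qed.

Lemma lipb_cst (c : R) : lipb (fun=> c).
Proof.
by exists `|c|; split=> // x y; rewrite subrr normr0 mulr_ge0.
Qed.

Lemma powR_le1 (x r : R) : 0 <= x <= 1 -> 0 <= r -> x `^ r <= 1.
Proof.
move=> /andP[x0 x1] r0; suff : x `^ r <= 1 `^ r by rewrite powR1.
by apply: ge0_ler_powR; rewrite ?nnegrE.
Qed.

(** On [[0, 1]] the derivative of [t^r] is at most [r], since [r > 1]. *)
Lemma lipb_powR f r : 1 < r -> lipb f -> (forall x, 0 <= f x <= 1) ->
  lipb (fun x => f x `^ r).
Proof.
move=> r1 [K [K0 fK lK]] f01.
have key x y : 0 <= x -> x <= y -> y <= 1 -> `|y `^ r - x `^ r| <= r * (y - x).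
  move=> x0 xy y1.
  have := @norm_le_of_derive _ (fun t => `|t| `^ r) (fun t => r * spowR (r - 1) t)
      ( *%R r) (fun=> r * 1) x y xy.
  rewrite (ger0_norm x0) (ger0_norm (le_trans x0 xy)) -mulrBr; apply.
  - by apply: within_continuous; apply: powR_norm_cont; lra.
  - by apply: within_continuous => t; apply: cvgM; [exact: cvg_cst|exact: cvg_id].
  - by move=> t _; exact: is_derive_norm_powR.
  - move=> t /andP[xt ty]; rewrite normrM (ger0_norm (_ : 0 <= r)); last lra.
    rewrite norm_spowR; last lra.
    apply: ler_wpM2l; first lra.
    by apply: powR_le1; [rewrite ger0_norm; lra|lra].
exists (1 + r * K); split.
- by rewrite addr_ge0// mulr_ge0//; lra.
- move=> x; rewrite ger0_norm ?powR_ge0//.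
  have : f x `^ r <= 1 by apply: powR_le1 => //; lra.
  have : 0 <= r * K by rewrite mulr_ge0//; lra.
  lra.
- move=> x y.
  have h z w : f w <= f z -> `|f z `^ r - f w `^ r| <= r * K * `|z - w|.
    move=> zw; apply: le_trans (key _ _ _ zw _) _.
    - by have /andP[] := f01 w.
    - by have /andP[] := f01 z.
    - rewrite -mulrA; apply: ler_wpM2l; first lra.
      by rewrite -(@ger0_norm _ (f z - f w)) ?subr_ge0.
  have : `|f x `^ r - f y `^ r| <= r * K * `|x - y|.
    have [/h//|/ltW/h] := leP (f y) (f x).
    by rewrite distrC [`|y - x|]distrC.
  by have := normr_ge0 (x - y); lra.
Qed.

Lemma lipb_continuous f : lipb f -> continuous f.
Proof.
move=> [K [K0 _ lK]] x; apply/cvgrPdist_lt => e e0; near=> y.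
apply: le_lt_trans (lK _ _) _.
have : `|x - y| < e / (K + 1).
  near: y; apply: (@cvgr_dist_lt _ _ _ (nbhs x) _ id); first exact: cvg_id.
  by rewrite divr_gt0// ltr_pwDr.
rewrite ltr_pdivlMr ?ltr_pwDr//.
by have := normr_ge0 (x - y); lra.
Unshelve. all: by end_near. Qed.

End lipschitz.

(** * The Riccati equation in a bounded chart *)

Section phase_functions.
Context {R : realType} (p : R) (p1 : 1 < p).
Implicit Types x y : R.
Local Notation q := (p / (p - 1)).

(* The Riccati equation for [g] of [radial_system] below blows up at both ends
   of the interval. The chart [g = x (1 - |x|)^(1 - p)], [|x| < 1], turns it
   into [x' = - (c1 phase_a x + l c2 phase_b x + c3 phase_h x)], which is
   Lipschitz in [x] up to [|x| = 1]; [clip] extends it to all of [R]. *)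
Definition clip x : R := Num.max (- 1) (Num.min x 1).

(** The derivative of the chart is [(1 - |x|)^(-p)] times this factor. The next three functions are
    [g], 1 and [(p - 1) |g|^q], the ingredients of the Riccati equation, divided by that
    derivative. *)
Definition phase_den x : R := 1 + (p - 2) * `|clip x|.
Definition phase_a x : R := clip x * (1 - `|clip x|) / phase_den x.
Definition phase_b x : R := (1 - `|clip x|) `^ p / phase_den x.
Definition phase_h x : R := (p - 1) * `|clip x| `^ q / phase_den x.

Lemma q_gt1 : 1 < q.
Proof. by move: (p1) => p1'; rewrite ltr_pdivlMr; lra. Qed.

Lemma clip_id x : -1 <= x <= 1 -> clip x = x.
Proof. by move=> /andP[h1 h2]; rewrite /clip min_l// max_r. Qed.

Lemma clip_ge x : 1 <= x -> clip x = 1.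
Proof. by move=> h1; rewrite /clip min_r// max_r//; lra. Qed.

Lemma clip_le x : x <= -1 -> clip x = -1.
Proof. by move=> h1; rewrite /clip min_l ?max_l//; lra. Qed.

Lemma clip_itv x : -1 <= clip x <= 1.
Proof.
have [h|h] := leP 1 x; first by rewrite clip_ge// lexx andbT; lra.
have [h'|h'] := leP x (-1); first by rewrite clip_le//; lra.
by rewrite clip_id//; apply/andP; split; apply/ltW.
Qed.

Lemma norm_clip x : 0 <= `|clip x| <= 1.
Proof. by rewrite normr_ge0/= ler_norml clip_itv. Qed.

Lemma lip_clip x y : `|clip x - clip y| <= `|x - y|.
Proof.
wlog xy : x y / x <= y.
  move=> H; have [/H//|/ltW/H] := leP x y.
  by rewrite distrC [`|y - x|]distrC.
rewrite distrC [leRHS]distrC [leRHS]ger0_norm ?subr_ge0//.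
have [h|h] := leP 1 x.
  by rewrite !clip_ge ?(le_trans h)// subrr normr0 subr_ge0.
have [k|k] := leP y (-1).
  by rewrite !clip_le ?(le_trans xy)// subrr normr0 subr_ge0.
have [h'|h'] := leP x (-1).
  rewrite (clip_le h'); have [k'|k'] := leP 1 y.
    by rewrite clip_ge// ger0_norm; lra.
  by rewrite clip_id ?ger0_norm; lra.
rewrite (@clip_id x); last lra.
have [k'|k'] := leP 1 y; first by rewrite clip_ge// ger0_norm; lra.
by rewrite clip_id ?ger0_norm; lra.
Qed.

Lemma lipb_clip : lipb clip.
Proof.
exists 1; split => // [x|x y]; first by rewrite ler_norml clip_itv.
by rewrite mul1r; exact: lip_clip.
Qed.

Lemma lipb_norm_clip : lipb (fun x => `|clip x|).
Proof.
have [K [K0 cK lK]] := lipb_clip; exists K; split => // x; first by rewrite normr_id.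
by move=> y; apply: le_trans (ler_dist_dist _ _) (lK x y).
Qed.

Lemma lipb_onem_clip : lipb (fun x => 1 - `|clip x|).
Proof.
have -> : (fun x => 1 - `|clip x|) = (fun x => 1 + (- 1) * `|clip x|).
  by apply/funext => x; rewrite mulN1r.
by apply: lipbD; [exact: lipb_cst|apply: lipbM; [exact: lipb_cst|exact: lipb_norm_clip]].
Qed.

(** The expression is affine in [|clip x|], with end values 1 and [p - 1]; it therefore stays
    positive also for [p < 2]. *)
Lemma phase_den_ge x : Num.min 1 (p - 1) <= phase_den x.
Proof.
rewrite /phase_den; have /andP[] := norm_clip x; move: `|clip x| => t t0 t1.
by case: (leP 1 (p - 1)) => h; nra.
Qed.

Lemma phase_den_min : 0 < Num.min 1 (p - 1).
Proof. by move: (p1) => p1'; case: (leP 1 (p - 1)) => h; lra. Qed.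

Lemma phase_den_gt0 x : 0 < phase_den x.
Proof. exact: lt_le_trans phase_den_min (phase_den_ge x). Qed.

Lemma phase_den_le x : phase_den x <= p + 1.
Proof.
rewrite /phase_den; have /andP[] := norm_clip x; move: (p1) => p1'.
move: `|clip x| => t t0 t1; nra.
Qed.

Lemma lipb_phase_denV : lipb (fun x => (phase_den x)^-1).
Proof.
apply: (lipbV phase_den_min) phase_den_ge.
apply: lipbD; first exact: lipb_cst.
by apply: lipbM; [exact: lipb_cst|exact: lipb_norm_clip].
Qed.

Lemma lipb_phase_a : lipb phase_a.
Proof.
apply: lipbM lipb_phase_denV; apply: lipbM; first exact: lipb_clip.
exact: lipb_onem_clip.
Qed.

Lemma lipb_phase_b : lipb phase_b.
Proof.
apply: lipbM lipb_phase_denV; apply: lipb_powR => //; first exact: lipb_onem_clip.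
by move=> x; have := norm_clip x; lra.
Qed.

Lemma lipb_phase_h : lipb phase_h.
Proof.
apply: lipbM lipb_phase_denV; apply: lipbM; first exact: lipb_cst.
by apply: lipb_powR; [exact: q_gt1|exact: lipb_norm_clip|exact: norm_clip].
Qed.

Lemma phase_b_ge0 x : 0 <= phase_b x.
Proof. by rewrite divr_ge0 ?powR_ge0// ltW// phase_den_gt0. Qed.

Lemma phase_h_ge0 x : 0 <= phase_h x.
Proof.
by move: (p1) => p1'; rewrite divr_ge0 ?(ltW (phase_den_gt0 _))// mulr_ge0 ?powR_ge0//; lra.
Qed.

Lemma phase_a_ge0 x : 0 <= x -> 0 <= phase_a x.
Proof.
move=> x0; rewrite divr_ge0 ?(ltW (phase_den_gt0 _))// mulr_ge0//.
  by rewrite /clip; case: (leP x 1) => h; rewrite max_r//; lra.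
by have := norm_clip x; lra.
Qed.

(** At and beyond the ends of the chart the field is [- c3], whatever [l] is: it points strictly
    downward, so a solution cannot stay at 1 and cannot climb back to -1 from below. *)
Lemma phase_out x : 1 <= `|x| ->
  [/\ phase_a x = 0, phase_b x = 0 & phase_h x = 1].
Proof.
move=> x1; rewrite /phase_a /phase_b /phase_h /phase_den.
have -> : `|clip x| = 1.
  have [x0|x0] := leP 0 x.
    by rewrite ger0_norm// in x1; rewrite clip_ge ?normr1.
  by rewrite ltr0_norm// in x1; rewrite clip_le ?normrN1//; lra.
move: (p1) => p1'.
rewrite subrr mulr0 !mul0r powR0 ?mul0r ?powR1; last by rewrite gt_eqF//; lra.
by split => //; field; rewrite gt_eqF//; lra.
Qed.

Lemma phase0 : phase_a 0 = 0 /\ phase_h 0 = 0.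
Proof.
rewrite /phase_a /phase_h clip_id; last lra.
rewrite normr0 powR0 ?mul0r ?mulr0 ?mul0r//.
by have := q_gt1; move=> h; rewrite gt_eqF//; lra.
Qed.

Lemma phase_bh_gt0 x (l : R) : 0 < l -> 0 < l * phase_b x + phase_h x.
Proof.
move=> l0; have := phase_b_ge0 x; have := phase_h_ge0 x.
have D0 := phase_den_gt0 x.
have [h|h] := leP 1 `|x|.
  by have [_ -> ->] := phase_out h; rewrite mulr0 add0r.
move=> h0 b0; rewrite ltr_wpDr// mulr_gt0// divr_gt0// powR_gt0//.
move: h; rewrite ltr_norml => /andP[h1 h2]; rewrite clip_id; last by lra.
rewrite subr_gt0 ltr_norml; lra.
Qed.

(** Provides the comparison point at which [phase_out] gives exact values, so that Lipschitz bounds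
    control the field near the ends of the chart. *)
Lemma clip_near_unit x (m : R) : 0 <= m -> 1 - m <= `|x| ->
  exists2 y : R, `|y| = 1 & `|clip x - clip y| <= m.
Proof.
move=> m0 xm; exists (if 0 <= x then 1 else -1); first by case: ifP => _; rewrite ?normrN normr1.
case: ifPn => x0.
  rewrite ger0_norm// in xm; rewrite (@clip_ge 1)//.
  have [h|h] := leP 1 x; first by rewrite clip_ge// subrr normr0.
  by rewrite clip_id ?ler0_norm; lra.
rewrite -ltNge in x0; rewrite ltr0_norm// in xm; rewrite (@clip_le (-1))//.
have [h|h] := leP x (-1); first by rewrite clip_le// subrr normr0.
by rewrite clip_id ?ger0_norm; lra.
Qed.

Lemma clip_clip x : clip (clip x) = clip x.
Proof. by rewrite clip_id// clip_itv. Qed.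

End phase_functions.

Section phase_ode.
Context {R : realType} (p s0 : R) (c1 c2 c3 : R -> R) (m M : R).
Implicit Types (t x y l : R).

(** The terms with [c2] and [c3] drive the solution downward, hence their uniform lower bound [m].
    The contribution of [c1] to the field has the sign of [- x] instead. *)
Definition coefficients_ok :=
  [/\ continuous c1, continuous c2, continuous c3, 0 < m &
      forall t, [/\ 0 <= c1 t <= M, m <= c2 t <= M & m <= c3 t <= M]].

Definition phase_rhs l t x : R :=
  - (c1 t * phase_a p x + l * c2 t * phase_b p x + c3 t * phase_h p x).

Lemma phase_common_bound : 1 < p -> exists K : R, 0 < K /\ forall g : R -> R,
  g = phase_a p \/ g = phase_b p \/ g = phase_h p ->
  (forall x, `|g x| <= K) /\ (forall x y, `|g x - g y| <= K * `|clip x - clip y|).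
Proof.
move=> p1.
have [A [A0 aA lA]] := lipb_phase_a p1.
have [B [B0 bB lB]] := lipb_phase_b p1.
have [H [H0 hH lH]] := lipb_phase_h p1.
exists (1 + A + B + H); split; first lra.
have cl (g : R -> R) x : g = phase_a p \/ g = phase_b p \/ g = phase_h p -> g x = g (clip x).
  by case=> [->|[->|->]]; rewrite /phase_a /phase_b /phase_h /phase_den !clip_clip.
move=> g gE; split => [x|x y]; last rewrite (cl g x gE) (cl g y gE).
  by case: gE => [->|[->|->]]; have := aA x; have := bB x; have := hH x; lra.
have n0 := normr_ge0 (clip x - clip y).
have h1 := lA (clip x) (clip y); have h2 := lB (clip x) (clip y).
have h3 := lH (clip x) (clip y).
have k1 := mulr_ge0 A0 n0; have k2 := mulr_ge0 B0 n0; have k3 := mulr_ge0 H0 n0.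
by case: gE => [->|[->|->]]; lra.
Qed.

Lemma phase_rhs_lip : 1 < p -> coefficients_ok -> exists K : R, 0 < K /\
  forall l l' t x y, 0 <= l ->
  `|phase_rhs l t x - phase_rhs l' t y| <= K * (2 + l) * `|x - y| + K * `|l - l'| /\
  `|phase_rhs l t x| <= K * (2 + l).
Proof.
move=> p1 [_ _ _ m0 cP].
have [K [K0 KP]] := phase_common_bound p1.
have [ba la] := KP _ (or_introl erefl).
have [bb lb] := KP _ (or_intror (or_introl erefl)).
have [bh lh] := KP _ (or_intror (or_intror erefl)).
have M0 : 0 < M by have [_ /andP[]] := cP 0; lra.
exists (M * K); split; first exact: mulr_gt0.
move=> l l' t x y l0; have [/andP[u1 u2] /andP[v1 v2] /andP[w1 w2]] := cP t.
have MK := mulr_gt0 M0 K0.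
have step (c u B : R) : 0 <= c <= M -> `|u| <= B -> `|c * u| <= M * B.
  by move=> /andP[cc0 cM] uB; rewrite normrM; apply: ler_pM => //; rewrite ger0_norm.
have c1P : 0 <= c1 t <= M by rewrite u1.
have c2P : 0 <= c2 t <= M by lra.
have c3P : 0 <= c3 t <= M by lra.
have lk (g : R -> R) : (forall x y, `|g x - g y| <= K * `|clip x - clip y|) ->
    `|g x - g y| <= K * `|x - y|.
  by move=> lg; apply: le_trans (lg _ _) _; apply: ler_wpM2l (ltW K0) _ _ (lip_clip _ _).
split.
  have -> : phase_rhs l t x - phase_rhs l' t y =
    - (c1 t * (phase_a p x - phase_a p y)) -
    l * (c2 t * (phase_b p x - phase_b p y)) -
    (l - l') * (c2 t * phase_b p y) - c3 t * (phase_h p x - phase_h p y).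
    by rewrite /phase_rhs; ring.
  have h1 := step _ _ _ c1P (lk _ la).
  have h2 := step _ _ _ c2P (lk _ lb).
  have h3 := step _ _ _ c3P (lk _ lh).
  have h4 := step _ _ _ c2P (bb y).
  have h5 : `|l * (c2 t * (phase_b p x - phase_b p y))| <= l * (M * (K * `|x - y|)).
    by rewrite normrM (ger0_norm l0) ler_wpM2l.
  have h6 : `|(l - l') * (c2 t * phase_b p y)| <= `|l - l'| * (M * K).
    by rewrite normrM ler_wpM2l.
  move: h1 h5 h6 h3 {h2 h4}.
  move: (c1 t * _) (l * (c2 t * _)) ((l - l') * _) (c3 t * _) => A B C D.
  rewrite !ler_norml => /andP[? ?] /andP[? ?] /andP[? ?] /andP[? ?].
  by apply/andP; split; lra.
have h1 := step _ _ _ c1P (ba x); have h2 := step _ _ _ c2P (bb x).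
have h3 := step _ _ _ c3P (bh x).
have h5 : `|l * (c2 t * phase_b p x)| <= l * (M * K).
  by rewrite normrM (ger0_norm l0) ler_wpM2l.
rewrite /phase_rhs -[l * c2 t * _]mulrA.
move: h1 h5 h3 {h2}.
move: (c1 t * _) (l * (c2 t * _)) (c3 t * _) => A B D.
rewrite !ler_norml => /andP[? ?] /andP[? ?] /andP[? ?].
by apply/andP; split; lra.
Qed.

(** In the chart, 1 stands for [g = +oo], that is, for the zero of the eigenfunction on the inner
    sphere; reaching -1 will be its zero on the outer sphere. *)
Definition phase_solution l (f : R -> R) := [/\ continuous f, forall s, s <= s0 -> f s = 1 &
  forall s, s0 < s -> is_derive s 1 f (phase_rhs l s (f s))].

Lemma phase_solution_exists l : 1 < p -> coefficients_ok -> 0 <= l ->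
  exists f, phase_solution l f.
Proof.
move=> p1 ok l0; have [K [K0 KP]] := phase_rhs_lip p1 ok.
have [cc1 cc2 cc3 _ _] := ok.
have L0 : 0 < K * (2 + l) by apply: mulr_gt0 => //; lra.
apply: (@picard R (phase_rhs l) s0 1 (K * (2 + l)) (K * (2 + l)) L0).
- move=> f cf t; apply: cvgN.
  have ca (g : R -> R) : lipb g -> {for t, continuous (fun t => g (f t))}.
    by move=> /lipb_continuous cg; apply: continuous_comp; [exact: cf|exact: cg].
  apply: cvgD; first apply: cvgD.
  + by apply: cvgM; [exact: cc1|apply: ca; exact: lipb_phase_a].
  + apply: cvgM; last by apply: ca; exact: lipb_phase_b.
    by apply: cvgM; [exact: cvg_cst|exact: cc2].
  + by apply: cvgM; [exact: cc3|apply: ca; exact: lipb_phase_h].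
- move=> t x y; have [h _] := KP l l t x y l0.
  by move: h; rewrite subrr normr0 mulr0 addr0.
- by move=> t x; have [_ h] := KP l l t x x l0.
Qed.

(** Gives the continuous dependence on [l] that shooting rests on. Gronwall is applied to the square
    of the difference, which is differentiable where the absolute value need not be. *)
Lemma phase_solution_lip (s1 L : R) : 1 < p -> coefficients_ok -> s0 <= s1 -> 0 <= L ->
  exists C : R, 0 <= C /\ forall l l' f g, 0 <= l <= L -> 0 <= l' <= L ->
  phase_solution l f -> phase_solution l' g -> `|f s1 - g s1| <= C * `|l - l'|.
Proof.
move=> p1 ok s01 L0; have [K [K0 KP]] := phase_rhs_lip p1 ok.
(* The factor 2 comes from differentiating a square. The extra 1 and the term
   [K ^+ 2 * (l - l') ^+ 2] come from splitting the mixed product [2 K |l - l'| |f - g|] by the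
   arithmetic-geometric inequality. *)
pose A := 2 * (K * (2 + L)) + 1; have A0 : 0 < A.
  by rewrite /A; have : 0 < K * (2 + L) by [apply: mulr_gt0 => //; lra]; lra.
pose B := K ^+ 2 / A * expR (A * (s1 - s0)).
have B0 : 0 <= B by rewrite mulr_ge0 ?divr_ge0 ?sqr_ge0 ?expR_ge0 ?(ltW A0).
exists (Num.sqrt B); split; first exact: sqrtr_ge0.
move=> l l' f g /andP[l0 lL] /andP[l'0 l'L] [cf f0 df] [cg g0 dg].
have := @gronwall R (fun t => (f t - g t) * (f t - g t))
  (fun t => (phase_rhs l t (f t) - phase_rhs l' t (g t)) * (f t - g t) +
            (f t - g t) * (phase_rhs l t (f t) - phase_rhs l' t (g t)))
  s0 s1 A (K ^+ 2 * (l - l') ^+ 2) s01 A0.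
rewrite (f0 s0)// (g0 s0)// subrr mulr0 add0r => H.
have {}H : (f s1 - g s1) ^+ 2 <= B * (l - l') ^+ 2.
  have := H _ _ _ _; rewrite -expr2 => H'; apply: le_trans (H' _ _ _ _) _.
  - by rewrite mulr_ge0 ?sqr_ge0.
  - apply: within_continuous => t.
    by apply: cvgM; apply: cvgB; [exact: cf|exact: cg|exact: cf|exact: cg].
  - move=> t /andP[h _]; apply: is_derive_fM;
      by apply: is_derive_fB; [exact: df|exact: dg].
  - move=> t _; have [h _] := KP l l' t (f t) (g t) l0.
    set w := f t - g t in h *; set F := phase_rhs l t _ - _ in h *.
    have hF : `|F| * `|w| <= (K * (2 + L) * `|w| + K * `|l - l'|) * `|w|.
      apply: ler_wpM2r => //; apply: le_trans h _; rewrite lerD2r.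
      by apply: ler_wpM2r => //; apply: ler_wpM2l; [exact: ltW|lra].
    have Fw : F * w <= `|F| * `|w| by rewrite -normrM ler_norm.
    have AG : 2 * (K * `|l - l'| * `|w|) <= K ^+ 2 * (l - l') ^+ 2 + w * w.
      have -> : K ^+ 2 * (l - l') ^+ 2 = (K * `|l - l'|) ^+ 2.
        by rewrite exprMn real_normK// num_real.
      have -> : w * w = `|w| ^+ 2 by rewrite real_normK ?num_real// expr2.
      by have := sqr_ge0 (K * `|l - l'| - `|w|); rewrite !expr2; lra.
    have ww : `|w| * `|w| = w * w by rewrite -expr2 real_normK ?num_real.
    rewrite /A [w * F]mulrC.
    have : (K * (2 + L) * `|w| + K * `|l - l'|) * `|w| =
      K * (2 + L) * (w * w) + K * `|l - l'| * `|w| by rewrite -ww; ring.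
    lra.
  - rewrite /B; have : 0 <= K ^+ 2 * (l - l') ^+ 2 / A.
      by rewrite divr_ge0 ?(ltW A0)// mulr_ge0 ?sqr_ge0.
    move=> h; apply: (@le_trans _ _ (K ^+ 2 * (l - l') ^+ 2 / A * expR (A * (s1 - s0)))).
      by rewrite gerBl.
    by rewrite le_eqVlt; apply/orP; left; apply/eqP; ring.
rewrite -(@ler_sqr _ `|_|) ?nnegrE ?mulr_ge0 ?sqrtr_ge0//.
by rewrite exprMn sqr_sqrtr// !real_normK ?num_real.
Qed.

End phase_ode.

(** * Shooting in the parameter [l] *)

Section shooting.
Context {R : realType} (p s0 : R) (c1 c2 c3 : R -> R) (m M : R).
Implicit Types (t x y l : R) (f : R -> R).
Local Notation rhs := (phase_rhs p c1 c2 c3).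
Local Notation sol := (phase_solution p s0 c1 c2 c3).
Local Notation ok := (coefficients_ok c1 c2 c3 m M).

Lemma phase_drop l f (a b c : R) : sol l f -> s0 <= a -> a <= b ->
  (forall t, a < t < b -> rhs l t (f t) <= - c) -> f b <= f a - c * (b - a).
Proof.
move=> [cf _ df] s0a ab fc.
have : f b + c * b <= f a + c * a.
  apply: (@is_derive_le0_nincr R (fun t => f t + c * t)
    (fun t => rhs l t (f t) + c * 1)) => //.
  - move=> t /andP[at_ _]; apply: is_derive_fD; first by apply: df; lra.
  - apply: within_continuous => t; apply: cvgD; first exact: cf.
    by apply: cvgM; [exact: cvg_cst|exact: cvg_id].
  - by move=> t /fc; lra.
lra.
Qed.

(** The interval is cut into three equal parts of length [d]. Near the ends of the chart [c3] alone
    gives a descent of rate [m / 2]; in the middle region a large [l] gives a rate above [2 / d]. So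
    the first third takes [f] below [1 - u], the second takes it across a gap shorter than 2 to
    [- (1 - u)], the last one to -1. *)
Lemma shoot_large (s1 : R) : 1 < p -> ok -> s0 < s1 ->
  exists l, 0 < l /\ forall f, sol l f -> f s1 <= -1.
Proof.
move=> p1 [_ _ _ m0 cP] s01.
have [K [K0 KP]] := phase_common_bound p1.
have [ba la] := KP _ (or_introl erefl).
have [bb lb] := KP _ (or_intror (or_introl erefl)).
have [bh lh] := KP _ (or_intror (or_intror erefl)).
have M0 : 0 < M by have [_ /andP[]] := cP 0; lra.
pose d := (s1 - s0) / 3; have d0 : 0 < d by rewrite /d; lra.
(* The width [u] of the end zones: at most [m / 2 * d], so that a third of the interval suffices to
   cross a zone, and so small that the Lipschitz error [(M + m) K u] leaves half of the descent
   [m]. *)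
pose u := Num.min (2^-1) (Num.min (m / 2 * d) (m / 2 / ((M + m) * K))).
have MK : 0 < (M + m) * K by apply: mulr_gt0 => //; lra.
have md0 : 0 < m / 2 * d by apply: mulr_gt0 => //; lra.
have mk0 : 0 < m / 2 / ((M + m) * K) by apply: divr_gt0 => //; lra.
have u0 : 0 < u by rewrite !lt_min md0 mk0 !andbT; lra.
have u12 : u <= 2^-1 by rewrite ge_min lexx.
have ud : u <= m / 2 * d by rewrite !ge_min lexx orbT.
have uK : u * ((M + m) * K) <= m / 2.
  by rewrite -ler_pdivlMr// !ge_min lexx !orbT.
have be0 : 0 < u `^ p / (p + 1) by apply: divr_gt0; [exact: powR_gt0|lra].
pose be := u `^ p / (p + 1).
(* [be] bounds [phase_b] from below in the middle region. There the [l] term is at least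
   [M K + 2 / d + m], where [M K] pays for the [c1] term. *)
pose l := (M * K + 2 / d + m) / (m * be).
have mb0 : 0 < m * be by apply: mulr_gt0.
have l0 : 0 < l.
  apply: divr_gt0 => //; have := mulr_gt0 M0 K0.
  by have : 0 < 2 / d by [rewrite divr_gt0]; lra.
exists l; split => // f fs; have [cf f0 df] := fs.
have far t x : 1 - u <= `|x| -> rhs l t x <= - (m / 2).
  move=> xu; have [y y1 xy] := clip_near_unit (ltW u0) xu.
  have [/andP[q1 q2] /andP[q3 q4] /andP[q5 q6]] := cP t.
  have [ya yb yh] := @phase_out R p p1 y ltac:(by rewrite y1).
  have A := la x y; rewrite ya subr0 in A.
  have H := lh x y; rewrite yh in H.
  have b0 := phase_b_ge0 p1 x.
  have Ku : K * `|clip x - clip y| <= K * u by rewrite ler_wpM2l// ltW.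
  have a1 : - (K * u) <= phase_a p x by move: A; rewrite ler_norml => /andP[]; lra.
  have h1 : 1 - K * u <= phase_h p x by move: H; rewrite ler_norml => /andP[]; lra.
  have ca : - (M * (K * u)) <= c1 t * phase_a p x.
    have : c1 t * - (K * u) <= c1 t * phase_a p x by rewrite ler_wpM2l.
    have : c1 t * (K * u) <= M * (K * u) by rewrite ler_wpM2r// mulr_ge0 ?ltW.
    lra.
  have Ku0 : 0 <= K * u by rewrite mulr_ge0 ?ltW.
  have h0 := phase_h_ge0 p1 x.
  have ch : m * (1 - K * u) <= c3 t * phase_h p x.
    apply: (@le_trans _ _ (m * phase_h p x)); first by rewrite ler_wpM2l// ltW.
    by rewrite ler_wpM2r.
  have cb : 0 <= l * c2 t * phase_b p x.
    by apply: mulr_ge0 => //; apply: mulr_ge0; [exact: ltW|lra].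
  rewrite /phase_rhs; have : u * ((M + m) * K) = M * (K * u) + m * (K * u) by ring.
  lra.
have close t x : `|x| <= 1 - u -> rhs l t x <= - (2 / d + m).
  move=> xu; have [/andP[q1 q2] /andP[q3 q4] /andP[q5 q6]] := cP t.
  have h0 := phase_h_ge0 p1 x.
  have ch : 0 <= c3 t * phase_h p x by apply: mulr_ge0 => //; lra.
  have ca : - (M * K) <= c1 t * phase_a p x.
    have : `|c1 t * phase_a p x| <= M * K.
      by rewrite normrM; apply: ler_pM => //; rewrite ger0_norm.
    by rewrite ler_norml => /andP[].
  have bx : be <= phase_b p x.
    rewrite /be /phase_b; apply: ler_pM; rewrite ?powR_ge0 ?invr_ge0//; first lra.
      have cx : clip x = x by apply: clip_id; move: xu; rewrite ler_norml => /andP[]; lra.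
      have xu' : u <= 1 - `|x| by lra.
      rewrite cx; apply: ge0_ler_powR => //; rewrite ?nnegrE ?(ltW u0)//; first lra.
      exact: le_trans (ltW u0) xu'.
    rewrite lef_pV2 ?posrE ?phase_den_gt0//; last lra.
    exact: phase_den_le.
  have cb : M * K + 2 / d + m <= l * c2 t * phase_b p x.
    have -> : M * K + 2 / d + m = l * (m * be) by rewrite /l divfK// gt_eqF.
    rewrite -mulrA; apply: ler_wpM2l; first exact: ltW.
    by apply: ler_pM => //; apply: ltW.
  rewrite /phase_rhs; lra.
have d2 : 0 < 2 / d by rewrite divr_gt0.
have all t x : rhs l t x <= - (m / 2).
  have [/far//|/ltW/close] := leP (1 - u) `|x|; move=> /(_ t); lra.
have step a b : s0 <= a -> a <= b -> f b <= f a - m / 2 * (b - a).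
  by move=> s0a ab; apply: (phase_drop fs s0a ab) => t _; exact: all.
pose t1 := s0 + d; pose t2 := s0 + d + d.
have t2d : s1 = t2 + d by rewrite /t2 /d; lra.
have e1 : f t1 <= 1 - u.
  have := step s0 t1 (lexx _) ltac:(rewrite /t1; lra).
  by rewrite (f0 s0 (lexx _)) (_ : t1 - s0 = d); [lra|rewrite /t1; lra].
have e3 : f s1 <= f t2 - m / 2 * d.
  have := step t2 s1 ltac:(rewrite /t2; lra) ltac:(lra).
  by rewrite t2d [t2 + d]addrC addrK.
suff : f t2 <= - (1 - u) by lra.
(* Otherwise the decreasing [f] would stay in the middle region during the whole second third and
   lose more than 2 there, which is too much. *)
rewrite leNgt; apply/negP => e2.
have : f t2 <= f t1 - (2 / d + m) * (t2 - t1).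
  apply: (phase_drop fs); rewrite /t1 /t2; [lra|lra|].
  move=> t /andP[h1 h2]; apply: close; rewrite ler_norml.
  have g1 := step t t2 ltac:(lra) ltac:(rewrite /t2; lra).
  have g2 := step t1 t ltac:(rewrite /t1; lra) ltac:(rewrite /t1; lra).
  have k1 : 0 <= m / 2 * (t2 - t) by apply: mulr_ge0; rewrite /t2; lra.
  have k2 : 0 <= m / 2 * (t - t1) by apply: mulr_ge0; rewrite /t1; lra.
  by apply/andP; split; lra.
have -> : t2 - t1 = d by rewrite /t2 /t1; lra.
rewrite mulrDl divfK ?gt_eqF//.
have := mulr_gt0 m0 d0; lra.
Qed.

(** For [l = 0] the point 0 is an equilibrium. Gronwall for [f^2], started at a zero of [f], keeps
    [f] at 0 from there on, so it cannot become negative. *)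
Lemma shoot_zero (s1 : R) f : 1 < p -> ok -> s0 < s1 -> sol 0 f -> 0 <= f s1.
Proof.
move=> p1 [_ _ _ m0 cP] s01 [cf f0 df].
rewrite leNgt; apply/negP => fs1.
have M0 : 0 < M by have [_ /andP[]] := cP 0; lra.
have [z zs fz] : exists2 z, z \in `[s0, s1] & f z = 0.
  apply: IVT; [exact: ltW|exact: within_continuous|].
  rewrite f0//; apply/andP; split; first by rewrite ge_min (ltW fs1) orbT.
  by rewrite le_max ler01.
move: zs; rewrite in_itv/= => /andP[z0 z1].
have [K [K0 KP]] := phase_common_bound p1.
have [ba la] := KP _ (or_introl erefl).
have [bh lh] := KP _ (or_intror (or_intror erefl)).
have bd t x : rhs 0 t x * x <= 2 * (M * K) * (x * x).
  have [pa0 ph0] := phase0 p1.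
  have [/andP[q1 q2] /andP[q3 q4] /andP[q5 q6]] := cP t.
  have cx : `|clip x - clip 0| <= `|x| by rewrite -{2}[x]subr0; exact: lip_clip.
  have A : `|phase_a p x| <= K * `|x|.
    have := la x 0; rewrite pa0 subr0 => /le_trans; apply.
    by apply: ler_wpM2l cx; exact: ltW.
  have H : `|phase_h p x| <= K * `|x|.
    have := lh x 0; rewrite ph0 subr0 => /le_trans; apply.
    by apply: ler_wpM2l cx; exact: ltW.
  have xx : `|x| * `|x| = x * x by rewrite -expr2 real_normK ?num_real.
  apply: le_trans (ler_norm _) _; rewrite /phase_rhs mul0r mul0r addr0 normrM normrN.
  rewrite -xx [leRHS]mulrA; apply: ler_wpM2r => //.
  apply: le_trans (ler_normD _ _) _.
  have -> : 2 * (M * K) * `|x| = M * (K * `|x|) + M * (K * `|x|) by ring.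
  have c3P : 0 <= c3 t by lra.
  rewrite (normrM (c1 t)) (normrM (c3 t)) (ger0_norm q1) (ger0_norm c3P).
  by apply: lerD; apply: ler_pM.
have C0 : 0 < 4 * (M * K) by have := mulr_gt0 M0 K0; lra.
have := @gronwall R (fun t => f t * f t)
  (fun t => rhs 0 t (f t) * f t + f t * rhs 0 t (f t)) z s1 _ 0 z1 C0 (lexx 0).
rewrite fz !(mul0r, add0r, subr0, oppr0) => H.
have : f s1 * f s1 <= 0.
  apply: H.
  - by apply: within_continuous => t; apply: cvgM; exact: cf.
  - by move=> t /andP[h1 _]; apply: is_derive_fM; apply: df; lra.
  - by move=> t _; have := bd t (f t); lra.
by apply/negP; rewrite -ltNge nmulr_rgt0.
Qed.

Lemma clamp_lip (a b x y : R) : a <= b ->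
  `|Num.max a (Num.min x b) - Num.max a (Num.min y b)| <= `|x - y|.
Proof.
move=> ab; wlog xy : x y / x <= y.
  move=> H; have [/H//|/ltW/H] := leP x y.
  by rewrite distrC [`|y - x|]distrC.
rewrite distrC [leRHS]distrC [leRHS]ger0_norm ?subr_ge0//.
have mono : Num.max a (Num.min x b) <= Num.max a (Num.min y b).
  case: (leP x b) => ?; case: (leP y b) => ?; case: (leP a x) => ?;
    case: (leP a y) => ?; rewrite ?(max_r ab); lra.
rewrite ger0_norm ?subr_ge0//.
case: (leP y b) => yb; last first.
  rewrite (max_r ab); case: (leP x b) => xb; last by rewrite (max_r ab); lra.
  by case: (leP a x) => ?; lra.
rewrite (min_l (le_trans xy yb)).
by case: (leP a x) => ?; case: (leP a y) => ?; lra.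
Qed.

(** The intermediate value theorem in [l]: the end value is nonnegative at [l = 0] and at most -1
    for large [l]. The former also shows that the [l] found is not 0. *)
Lemma shooting (s1 : R) : 1 < p -> ok -> s0 < s1 ->
  exists l f, [/\ 0 < l, sol l f & f s1 = -1].
Proof.
move=> p1 okc s01.
have [L [L0 LP]] := shoot_large p1 okc s01.
have [C [C0 CP]] := phase_solution_lip p1 okc (ltW s01) (ltW L0).
have /choice[F FP] : forall l, exists f, 0 <= l -> sol l f.
  move=> l; have [l0|l0] := leP 0 l; last by exists (fun=> 0).
  by have [f fP] := phase_solution_exists s0 p1 okc l0; exists f.
(* The parameter is clamped because solutions, and their Lipschitz dependence on [l], are available
   on [[0, L]] only, while [h] should be continuous everywhere. *)
pose h l := F (Num.max 0 (Num.min l L)) s1.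
have hc : continuous h.
  move=> l; apply/cvgrPdist_lt => e e0; near=> l'.
  have B x : 0 <= Num.max 0 (Num.min x L) <= L.
    by rewrite le_max lexx/= ge_max ge_min lexx orbT (ltW L0).
  have B0 x : 0 <= Num.max 0 (Num.min x L) by have /andP[] := B x.
  apply: le_lt_trans (CP _ _ _ _ (B l) (B l') (FP _ (B0 l)) (FP _ (B0 l'))) _.
  have : `|l - l'| < e / (C + 1).
    near: l'; apply: (@cvgr_dist_lt _ _ _ (nbhs l) _ id); first exact: cvg_id.
    by rewrite divr_gt0// ltr_pwDr.
  rewrite ltr_pdivlMr ?ltr_pwDr//; apply: le_lt_trans.
  have nd : `|Num.max 0 (Num.min l L) - Num.max 0 (Num.min l' L)| <= `|l - l'|.
    exact: clamp_lip (ltW L0).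
  have := ler_wpM2l C0 nd; have := normr_ge0 (l - l'); lra.
have [l lL hl] : exists2 l, l \in `[0, L] & h l = -1.
  apply: IVT; [exact: ltW|exact: within_continuous|].
  have h0 : 0 <= h 0.
    rewrite /h min_l ?(ltW L0)// maxxx; apply: shoot_zero (p1) okc s01 _.
    exact: FP.
  have hL : h L <= -1.
    by rewrite /h minxx max_r ?(ltW L0)//; apply: LP; apply: FP; exact: ltW.
  by rewrite ge_min hL orbT/= le_max; apply/orP; left; lra.
move: lL; rewrite in_itv/= => /andP[l0 lL].
exists l, (F l); split; [|exact: FP|by move: hl; rewrite /h min_l// max_r].
rewrite lt_neqAle l0 andbT; apply/eqP => l00.
have : 0 <= h 0.
  by rewrite /h min_l ?(ltW L0)// maxxx; apply: shoot_zero (p1) okc s01 _; exact: FP.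
by rewrite l00 hl; lra.
Unshelve. all: by end_near. Qed.

(** The field is negative at every [x >= 0], so a maximum over [[s, t]] can be attained at [s] only:
    elsewhere [f] is larger just to the left. For negative [x] the [c1] term may make the field
    positive, whence the sign condition on [f t]. *)
Lemma phase_decreasing l f (s t : R) : 1 < p -> ok -> 0 < l -> sol l f ->
  s0 <= s -> s < t -> 0 <= f t -> f t < f s.
Proof.
move=> p1 [_ _ _ m0 cP] l0 [cf f0 df] s0s st ft0.
have [z zst zmax] := EVT_max (ltW st) (within_continuous (A := `[s, t]) cf).
move: zst; rewrite in_itv/= => /andP[sz zt].
have fz0 : 0 <= f z by apply: le_trans ft0 (zmax t _); rewrite in_itv/= lexx ltW.
have neg r x : 0 <= x -> rhs l r x < 0.
  move=> x0; have [/andP[q1 q2] /andP[q3 q4] /andP[q5 q6]] := cP r.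
  have a0 := phase_a_ge0 p1 x0; have b0 := phase_b_ge0 p1 x; have h0 := phase_h_ge0 p1 x.
  have := phase_bh_gt0 p1 x l0 => bh.
  have k1 : 0 <= c1 r * phase_a p x by apply: mulr_ge0.
  have k2 : m * (l * phase_b p x) <= l * c2 r * phase_b p x.
    by rewrite [l * c2 r]mulrC -mulrA ler_wpM2r// mulr_ge0// ltW.
  have k3 : m * phase_h p x <= c3 r * phase_h p x by rewrite ler_wpM2r.
  have := mulr_gt0 m0 bh; rewrite /phase_rhs; lra.
have [zs|zs] := eqVneq z s.
  rewrite lt_neqAle -{2}zs zmax ?andbT; last by rewrite in_itv/= lexx ltW.
  apply/eqP => fts.
  have [e e0 eP] := is_derive_quotient_lt (df t (le_lt_trans s0s st)) (neg t _ ft0).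
  pose r := Num.max ((s + t) / 2) (t - e / 2).
  have rt : t - e < r < t.
    by rewrite /r lt_max; apply/andP; split; [apply/orP; right; lra|rewrite gt_max; lra].
  have rs : s < r by rewrite lt_max; apply/orP; left; lra.
  have := (eP r).1 rt; rewrite fts -zs ltNge zmax// in_itv/=.
  by rewrite (ltW rs)/= ltW//; case/andP: rt.
have sz' : s < z by rewrite lt_neqAle eq_sym zs.
have [e e0 eP] := is_derive_quotient_lt (df z (le_lt_trans s0s sz')) (neg z _ fz0).
pose r := Num.max ((s + z) / 2) (z - e / 2).
have rt : z - e < r < z.
  by rewrite /r lt_max; apply/andP; split; [apply/orP; right; lra|rewrite gt_max; lra].
have rs : s < r by rewrite lt_max; apply/orP; left; lra.
have := (eP r).1 rt; rewrite ltNge zmax// in_itv/= (ltW rs)/=.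
by case/andP: rt => _ /ltW/le_trans; apply.
Qed.

(** Below -1 the field is negative, so a solution that has reached -1 before [s1] goes on falling
    and cannot have the value -1 at [s1]. The minimum over [[s, s1]] makes this precise. *)
Lemma phase_gtN1 l f (s s1 : R) : 1 < p -> ok -> 0 < l -> sol l f ->
  f s1 = -1 -> s0 < s -> s < s1 -> -1 < f s.
Proof.
move=> p1 [_ _ _ m0 cP] l0 [cf f0 df] fs1 s0s ss1.
rewrite ltNge; apply/negP => fs.
have [z zst zmin] := EVT_min (ltW ss1) (within_continuous (A := `[s, s1]) cf).
move: zst; rewrite in_itv/= => /andP[sz zt].
have fz : f z <= -1 by apply: le_trans (zmin s _) fs; rewrite in_itv/= lexx ltW.
have neg r x : x <= -1 -> rhs l r x < 0.
  move=> x1; have [/andP[q1 q2] /andP[q3 q4] /andP[q5 q6]] := cP r.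
  have [ya yb yh] := @phase_out R p p1 x ltac:(by rewrite ler0_norm; lra).
  by rewrite /phase_rhs ya yb yh !mulr0 !add0r mulr1 oppr_lt0; lra.
have dec y : s0 < y -> f y <= -1 -> y < s1 ->
    exists r, [/\ y < r, r < s1 & f r < f y].
  move=> s0y fy ys1.
  have [e e0 eP] := is_derive_quotient_lt (df y s0y) (neg y _ fy).
  exists (Num.min ((y + s1) / 2) (y + e / 2)).
  set r := Num.min _ _; have h1 : y < r by rewrite lt_min; lra.
  have h2 : r < s1 by rewrite gt_min; apply/orP; left; lra.
  have h3 : r < y + e by rewrite gt_min; apply/orP; right; lra.
  by split => //; apply: (eP r).2; rewrite h1.
have [r [r1 r2 r3]] : exists r, [/\ s < r, r < s1 & f r < f z].
  have [zs1|zs1] := eqVneq z s1.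
    have [r [r1 r2 r3]] := dec s s0s fs ss1; exists r; split => //.
    by rewrite zs1 fs1; apply: lt_le_trans r3 fs.
  have [r [r1 r2 r3]] := dec z (lt_le_trans s0s sz) fz ltac:(by rewrite lt_neqAle zs1).
  by exists r; split => //; exact: le_lt_trans sz r1.
by have := zmin r; rewrite in_itv/= (ltW r1) (ltW r2) => /(_ isT); rewrite leNgt r3.
Qed.

End shooting.

(** * The radial eigenfunction *)

Lemma continuous_fcomp {R : realType} (T : topologicalType) (f : T -> R) (g : R -> R) :
  continuous f -> continuous g -> continuous (fun x => g (f x)).
Proof. by move=> cf cg x; apply: (@continuous_comp _ _ _ f g); [exact: cf|exact: cg]. Qed.

Section profile.
Context {R : realType}.
Implicit Types (t x y l : R) (f : R -> R).

Lemma powR_1B (u p : R) : 0 < u -> u `^ (1 - p) = u * u `^ (- p).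
Proof.
move=> u0; rewrite powRD; last by rewrite (gt_eqF u0) implybT.
by rewrite powRr1// ltW.
Qed.

Definition slope (p x : R) : R := x * (1 - `|x|) `^ (1 - p).

(** The kink of [|x|] at 0 does no harm because of the factor [x]: the difference quotient there is
    [(1 - |h|)^(1-p)], which tends to 1. *)
Lemma is_derive_slope (p x : R) : `|x| < 1 ->
  is_derive x 1 (slope p) ((1 - `|x|) `^ (- p) * (1 + (p - 2) * `|x|)).
Proof.
move=> x1; have U0 : 0 < 1 - `|x| by rewrite subr_gt0.
have side (e : R) : (e = 1 \/ e = -1) -> `|x| = e * x -> (\forall y \near x, `|y| = e * y) ->
    is_derive x 1 (slope p) ((1 - `|x|) `^ (- p) * (1 + (p - 2) * `|x|)).
  move=> e1 xe ne.
  apply: (@near_eq_is_derive _ _ _ (fun y => y * (1 - e * y) `^ (1 - p))).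
    by apply: filterS ne => y ye; rewrite /slope ye.
  rewrite xe in U0 *.
  have d1 : is_derive x 1 (fun y => 1 - e * y) (0 - e * 1).
    exact: is_derive_fB.
  have := is_derive_fM (@is_derive_id _ _ x (1 : R))
    (@is_derive_fcomp _ _ (fun u => u `^ (1 - p)) _ x 1 _ _ (is_derive1_powR (1 - p) U0) d1).
  move=> D; apply: is_derive_eq D _.
  rewrite (_ : 1 - p - 1 = - p); last by ring.
  rewrite powR_1B//=.
  by case: e1 => ->; ring.
have [x0|x0|x0] := ltgtP x 0.
- apply: (side (-1)); [by right|by rewrite ltr0_norm ?mulN1r|].
  by near=> y; rewrite mulN1r ltr0_norm//; near: y; exact: near_ltr.
- apply: (side 1); [by left|by rewrite gtr0_norm ?mul1r|].
  by near=> y; rewrite mul1r gtr0_norm//; near: y; exact: near_gtr.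
rewrite x0 normr0 mulr0 addr0 subr0 powR1 mulr1.
suff H : (fun h : R => h^-1 *: (slope p (h *: (1 : R) + 0) - slope p (0 : R))) @ (0 : R)^' --> (1 : R).
  by split; [apply/cvg_ex; exists 1|exact: cvg_lim].
have ck : {for (0 : R), continuous (fun h : R => (1 - `|h|) `^ (1 - p))}.
  apply: (@continuous_comp _ _ _ (fun h : R => 1 - `|h|) (fun u => u `^ (1 - p))).
    apply: cvgB; first exact: cvg_cst.
    exact: norm_continuous.
  have U1 : 0 < 1 - `|0 : R| by rewrite normr0 subr0.
  exact: is_derive_cont (is_derive1_powR (1 - p) U1).
have {}ck : (fun h : R => (1 - `|h|) `^ (1 - p)) @ (0 : R)^' --> (1 - `|0 : R|) `^ (1 - p).
  exact: cvg_within_filter ck.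
rewrite normr0 subr0 powR1 in ck.
apply: cvg_trans ck; apply: near_eq_cvg; near=> h.
have h0 : h != 0 by near: h; exact: nbhs_dnbhs_neq.
by rewrite /slope mul0r subr0 addr0 [h *: 1]mulr1 [_ *: _]mulKf.
Unshelve. all: by end_near. Qed.

Lemma norm_slope (p q x : R) : `|x| < 1 -> `|slope p x| `^ q =
  `|x| `^ q * (1 - `|x|) `^ ((1 - p) * q).
Proof.
move=> x1; rewrite normrM powRM// (ger0_norm (powR_ge0 _ _)).
by rewrite -powRrM.
Qed.

Lemma spowR_slope (p q x : R) : `|x| < 1 -> spowR q (slope p x) =
  spowR q x * (1 - `|x|) `^ ((1 - p) * q).
Proof.
move=> x1; rewrite /spowR norm_slope// mulrA /slope sgrM.
have U0 : 0 < 1 - `|x| by rewrite subr_gt0.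
by rewrite [Num.sg (_ `^ _)]gtr0_sg ?powR_gt0// mulr1.
Qed.

(** Up to the factor [(1 - |x|)^p], which removes the blow-up at the ends of the chart, this is
    [1 + (p - 1) |g|^q]. The outer absolute value makes it a positive continuous function on the
    whole line. *)
Definition energy (p x : R) : R :=
  `|1 - `|x| | `^ p + (p - 1) * `|x| `^ (p / (p - 1)).

Lemma energy_gt0 (p x : R) : 1 < p -> 0 < energy p x.
Proof.
move=> p1; have [->|x0] := eqVneq x 0.
  rewrite /energy normr0 subr0 normr1 powR1.
  by have := powR_ge0 (0 : R) (p / (p - 1)); nra.
apply: ltr_wpDl; first exact: powR_ge0.
by apply: mulr_gt0; [lra|rewrite powR_gt0// normr_gt0].
Qed.

Lemma energy_slope (p x : R) : 1 < p -> `|x| < 1 ->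
  1 + (p - 1) * `|slope p x| `^ (p / (p - 1)) = energy p x * (1 - `|x|) `^ (- p).
Proof.
move=> p1 x1; have U0 : 0 < 1 - `|x| by rewrite subr_gt0.
rewrite norm_slope// (_ : (1 - p) * (p / (p - 1)) = - p); last first.
  by field; rewrite gt_eqF//; lra.
rewrite /energy (gtr0_norm U0) [RHS]mulrDl -powRD; last by rewrite (gt_eqF U0) implybT.
by rewrite subrr powRr0 mulrA.
Qed.

End profile.

Section profile_ode.
Context {R : realType} (p s0 s1 : R) (c1 c2 c3 : R -> R) (m M : R).
Implicit Types (t x y l : R) (f : R -> R).
Local Notation rhs := (phase_rhs p c1 c2 c3).
Local Notation sol := (phase_solution p s0 c1 c2 c3).
Local Notation ok := (coefficients_ok c1 c2 c3 m M).
Local Notation q := (p / (p - 1)).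

Lemma phase_to_riccati l f : 1 < p -> sol l f ->
  forall t, s0 < t -> `|f t| < 1 -> is_derive t 1 (fun t => slope p (f t))
    (- (c1 t * slope p (f t) + l * c2 t + (p - 1) * c3 t * `|slope p (f t)| `^ q)).
Proof.
move=> p1 [cf _ df] t s0t ft.
have D := @is_derive_fcomp _ _ (slope p) f t 1 _ _ (is_derive_slope p ft) (df t s0t).
apply: is_derive_eq D _.
have U0 : 0 < 1 - `|f t| by rewrite subr_gt0.
have cx : clip (f t) = f t by apply: clip_id; move: ft; rewrite ltr_norml; lra.
rewrite norm_slope// (_ : (1 - p) * q = - p); last by field; rewrite gt_eqF//; lra.
have D0 := phase_den_gt0 p1 (f t); rewrite /phase_den cx in D0.
rewrite /phase_rhs /phase_a /phase_b /phase_h /phase_den cx /slope.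
have -> : (1 - `|f t|) `^ (1 - p) = (1 - `|f t|) * (1 - `|f t|) `^ (- p).
  exact: powR_1B.
have Up : (1 - `|f t|) `^ p * (1 - `|f t|) `^ (- p) = 1.
  by rewrite -powRD ?subrr ?powRr0// (gt_eqF U0) implybT.
move: Up; set v := _ `^ p; set w := _ `^ (- p) => Up.
transitivity (- (c1 t * (f t * ((1 - `|f t|) * w)) + l * c2 t * (v * w) +
  (p - 1) * c3 t * (`|f t| `^ q * w))); first by field; rewrite gt_eqF.
by rewrite Up mulr1.
Qed.

(** The prescribed [P' / P] cannot be integrated up to the ends, where [P] vanishes. With
    [W = 1 + (p - 1) |g|^q], however, the derivative of [ln P + ln W / p] extends continuously. It
    is integrated to [K], and [P] is [W^(-1/p) exp K], normalized at [sg]; in the chart [W^(-1/p)]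
    is [U E^(-1/p)], which vanishes with [U] at both ends. *)
Lemma profile_exists l f (sg : R) : 1 < p -> ok -> s0 < sg -> sg < s1 -> sol l f ->
  f sg = 0 -> f s1 = -1 -> (forall t, s0 < t < s1 -> `|f t| < 1) ->
  exists P : R -> R, [/\ continuous P, P s0 = 0, P s1 = 0, P sg = 1 &
    forall t, s0 < t < s1 -> 0 < P t /\
      is_derive t 1 P (P t * (c3 t * spowR (q - 1) (slope p (f t))))].
Proof.
move=> p1 [cc1 cc2 cc3 m0 cP] s0g gs1 fs fg fs1 f1; have [cf f0 df] := fs.
have q1 := q_gt1 p1.
pose kf t := clip (f t); pose U t := 1 - `|kf t|; pose E t := energy p (kf t).
have ckf : continuous kf.
  by apply: (continuous_fcomp cf); apply: lipb_continuous; exact: lipb_clip.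
have cU : continuous U.
  move=> t; apply: cvgB; first exact: cvg_cst.
  exact: (continuous_fcomp ckf (@norm_continuous _ R^o)).
have cUp r : 0 < r -> continuous (fun t => `|U t| `^ r).
  by move=> r0; exact: (continuous_fcomp cU (powR_norm_cont r0)).
have cE : continuous E.
  move=> t; apply: cvgD; first by apply: cUp; lra.
  apply: cvgM; first exact: cvg_cst.
  by apply: (continuous_fcomp ckf (powR_norm_cont _)); lra.
have E0 t : 0 < E t by exact: energy_gt0.
(* In terms of [g] this is [spowR (q - 1) g * (c3 - l c2 - c1 g) / W]: what remains of [P' / P] once
   the Riccati equation has been inserted into [W']. The chart makes it continuous at the ends. *)
pose k t := spowR (q - 1) (kf t) * ((c3 t - l * c2 t) * `|U t| `^ (p - 1) - c1 t * kf t) / E t.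
have ck : continuous k.
  move=> t; apply: cvgM; last by apply: cvgV; [rewrite gt_eqF|exact: cE].
  apply: cvgM.
    by apply: (continuous_fcomp ckf (spowR_cont _)); lra.
  apply: cvgB; last by apply: cvgM; [exact: cc1|exact: ckf].
  apply: cvgM; last by apply: cUp; lra.
  by apply: cvgB; [exact: cc3|apply: cvgM; [exact: cvg_cst|exact: cc2]].
have [K [cK K0 dK]] := antiderivative s0 ck.
pose P t := `|U t| * (E t) `^ (- p^-1) * expR (K t - K sg).
have cP' : continuous P.
  move=> t; apply: cvgM; last first.
    apply: (@continuous_comp _ _ _ (fun t => K t - K sg)); last exact: continuous_expR.
    by apply: cvgB; [exact: cK|exact: cvg_cst].
  apply: cvgM; first by exact: (continuous_fcomp cU (@norm_continuous _ R^o)).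
  apply: (@continuous_comp _ _ _ E (fun u => u `^ (- p^-1))); first exact: cE.
  exact: is_derive_cont (is_derive1_powR (- p^-1) (E0 t)).
have Pz t : `|clip (f t)| = 1 -> P t = 0.
  by move=> h; rewrite /P /U /kf h subrr normr0 !mul0r.
exists P; split => //.
- by apply: Pz; rewrite f0// clip_ge// normr1.
- by apply: Pz; rewrite fs1 clip_le// normrN1.
- rewrite /P /E /U /energy /kf fg clip_id; last lra.
  rewrite subrr expR0 normr0 subr0 normr1 powR1 powR0 ?mulr0 ?addr0 ?powR1 ?mulr1//.
  by rewrite gt_eqF//; lra.
move=> t /andP[s0t ts1].
have ft := f1 t ltac:(by rewrite s0t).
have cx y : `|y| < 1 -> clip y = y by rewrite ltr_norml => ?; apply: clip_id; lra.
split.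
  rewrite /P /U /kf cx// mulr_gt0 ?expR_gt0// mulr_gt0 ?powR_gt0//.
  by rewrite normr_gt0 gt_eqF// subr_gt0.
pose W t := 1 + (p - 1) * `|slope p (f t)| `^ q.
have PW y : `|f y| < 1 -> P y = (W y) `^ (- p^-1) * expR (K y - K sg).
  move=> fy; have U0 : 0 < 1 - `|f y| by rewrite subr_gt0.
  rewrite /W energy_slope// powRM ?powR_ge0 ?(ltW (energy_gt0 _ _))//.
  rewrite -powRrM mulrNN mulfV ?powRr1 ?(ltW U0)//; last by rewrite gt_eqF//; lra.
  by rewrite /P /U /E /kf cx// gtr0_norm// [X in X * _ = _]mulrC.
have W0 y : 0 < W y.
  rewrite /W ltr_pwDl// mulr_ge0 ?powR_ge0//; lra.
have nf : \forall y \near t, `|f y| < 1.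
  have cn : {for t, continuous (fun y => `|f y|)}.
    by exact: (continuous_fcomp cf (@norm_continuous _ R^o)).
  by apply: (@cvgr_lt _ _ (nbhs t) _ (fun y => `|f y|) `|f t|).
apply: (@near_eq_is_derive _ _ _ (fun y => (W y) `^ (- p^-1) * expR (K y - K sg))).
  by apply: filterS nf => y /PW.
set g := slope p (f t).
have dg := phase_to_riccati p1 fs s0t ft.
have dW : is_derive t 1 W ((p - 1) * (q * spowR (q - 1) g *
    - (c1 t * g + l * c2 t + (p - 1) * c3 t * `|g| `^ q))).
  rewrite -[X in is_derive _ _ _ X]add0r.
  apply: (@is_derive_fD _ _ (fun=> 1) _ t 1 0 _ (is_derive_fcst _ _ _)).
  apply: is_derive_fZ.
  exact: (@is_derive_fcomp _ _ (fun u : R => `|u| `^ q) (fun t => slope p (f t)) t 1 _ _ (is_derive_norm_powR g q1) dg).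
have dWp := @is_derive_fcomp _ _ (fun u => u `^ (- p^-1)) W t 1 _ _
  (is_derive1_powR (- p^-1) (W0 t)) dW.
have dK' : is_derive t 1 (fun y => K y - K sg) (k t) by apply: is_derive_fDc; exact: dK.
have dexp := @is_derive_fcomp _ _ expR (fun y => K y - K sg) t 1 _ _ (is_derive_expR (K t - K sg)) dK'.
apply: is_derive_eq (is_derive_fM dWp dexp) _.
rewrite (PW t ft).
have -> : k t = spowR (q - 1) g * (c3 t - l * c2 t - c1 t * g) / W t.
  have U0 : 0 < 1 - `|f t| by rewrite subr_gt0.
  rewrite /k /W /g /E /U /kf cx// energy_slope// spowR_slope//.
  have pq1 : (1 - p) * (q - 1) = -1 by field; rewrite gt_eqF//; lra.
  rewrite pq1.
  rewrite gtr0_norm// /slope.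
  have N0 : (1 - `|f t|) `^ (- p) != 0 by rewrite gt_eqF// powR_gt0.
  have -> : (1 - `|f t|) `^ (1 - p) = (1 - `|f t|) * (1 - `|f t|) `^ (- p).
    exact: powR_1B.
  have -> : (1 - `|f t|) `^ (p - 1) = ((1 - `|f t|) * (1 - `|f t|) `^ (- p))^-1.
    rewrite invfM -powRN opprK mulrC powRD; last by rewrite (gt_eqF U0) implybT.
    by rewrite powR_inv1// ltW.
  rewrite powR_inv1 ?(ltW U0)//.
  field; rewrite N0 (gt_eqF U0) gt_eqF//; exact: energy_gt0.
have -> : W t `^ (- p^-1 - 1) = W t `^ (- p^-1) / W t.
  by rewrite powRD ?powR_inv1 ?(ltW (W0 t))// (gt_eqF (W0 t)) implybT.
have Wq : W t = 1 + (p - 1) * `|g| `^ q by [].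
have Wn : W t != 0 by rewrite gt_eqF.
move: Wq Wn; move: (W t) => w -> Wn.
move: Wn; move: (`|g| `^ q) (spowR (q - 1) g) => gq sg' Wn.
by field; rewrite Wn !gt_eqF//; lra.
Qed.

End profile_ode.

Section radial_profile.
Context {R : realType}.
Implicit Types (p s n l sg t : R) (g P : R -> R).

(* With [u x = P (|x|^2)] and [X x = g (|x|^2) x], the first equation is
   [div X = - l - (p - 1) |X|^(p/(p-1))] in dimension [n], and the second one is
   [|grad u|^(p-2) grad u = u^(p-1) X]; so [- div (|grad u|^(p-2) grad u) = l u^(p-1)]. *)
Definition radial_system n p (s0 s1 : R) l g P sg : Prop :=
  let q := p / (p - 1) in
  [/\ 0 < l, s0 < sg < s1, P sg = 1,
    forall t, s0 < t < s1 -> is_derive t 1 g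
      (- (n / (2 * t) * g t + l / (2 * t) +
          (p - 1) * (t `^ (q / 2) / (2 * t)) * `|g t| `^ q)) &
    [/\ forall t, s0 < t < s1 -> 0 < P t /\ is_derive t 1 P
          (P t * (t `^ (q / 2) / (2 * t) * spowR (q - 1) (g t))),
        forall t, s0 < t < sg -> 0 < g t,
        forall t, sg < t < s1 -> g t < 0,
        continuous P & P s0 = 0 /\ P s1 = 0]].

(** The zero [sg] of the phase solution is the critical radius. Strict decrease as long as the
    solution is nonnegative gives the sign of [g] on both sides of it. *)
Lemma radial_system_exists n p (s0 s1 : R) : 0 <= n -> 1 < p -> 0 < s0 -> s0 < s1 ->
  exists l g P sg, radial_system n p s0 s1 l g P sg.
Proof.
move=> n0 p1 s00 s01; pose q := p / (p - 1); have q1 : 1 < q := q_gt1 p1.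
(* Picard wants coefficients bounded on the whole line, so [n / (2 t)] and the others are frozen
   outside [[s0, s1]]; the clamp also keeps [t] away from 0. *)
pose c t : R := Num.max s0 (Num.min t s1).
have cc : continuous c.
  move=> t; apply/cvgrPdist_lt => e e0; near=> t'.
  apply: le_lt_trans (clamp_lip t t' (ltW s01)) _; near: t'.
  by apply: (@cvgr_dist_lt _ _ _ (nbhs t) _ id); first exact: cvg_id.
have c0 t : s0 <= c t by rewrite le_max lexx.
have c1 t : c t <= s1 by rewrite ge_max (ltW s01)/= ge_min lexx orbT.
have cpos t : 0 < c t := lt_le_trans s00 (c0 t).
have c2n t : 2 * c t != 0 by rewrite gt_eqF// mulr_gt0.
have cid t : s0 < t < s1 -> c t = t.
  by move=> /andP[h1 h2]; rewrite /c min_l ?(ltW h2)// max_r// ltW.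
pose d t := (2 * c t)^-1.
have cd : continuous d.
  by move=> t; apply: cvgV => //; apply: cvgM; [exact: cvg_cst|exact: cc].
pose k1 t := n * d t; pose k2 t := d t; pose k3 t := `|c t| `^ (q / 2) * d t.
have d1 t : (2 * s1)^-1 <= d t.
  by rewrite lef_pV2 ?posrE ?mulr_gt0// ?(lt_trans s00)// ler_wpM2l.
have d2 t : d t <= (2 * s0)^-1 by rewrite lef_pV2 ?posrE ?mulr_gt0// ler_wpM2l.
have q20 : 0 < q / 2 by lra.
have e1 t : s0 `^ (q / 2) <= `|c t| `^ (q / 2).
  rewrite gtr0_norm//; apply: ge0_ler_powR; rewrite ?nnegrE//; exact: ltW.
have e2 t : `|c t| `^ (q / 2) <= s1 `^ (q / 2).
  rewrite gtr0_norm//.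
  by apply: ge0_ler_powR; rewrite ?nnegrE ?(ltW (cpos t)) ?(ltW q20) ?(ltW (lt_trans s00 s01)).
have i1 : 0 < (2 * s1)^-1 by rewrite invr_gt0 mulr_gt0//; exact: lt_trans s01.
have i0 : 0 < (2 * s0)^-1 by rewrite invr_gt0 mulr_gt0.
have z0 : 0 < s0 `^ (q / 2) by exact: powR_gt0.
have z1 := powR_ge0 s1 (q / 2).
pose m := (2 * s1)^-1 * Num.min 1 (s0 `^ (q / 2)).
pose M := (n + 1 + s1 `^ (q / 2)) * (2 * s0)^-1.
have d0 t : 0 < d t by exact: lt_le_trans i1 (d1 t).
have ok : coefficients_ok k1 k2 k3 m M.
  split => //.
  - by move=> t; apply: cvgM; [exact: cvg_cst|exact: cd].
  - move=> t; apply: cvgM; last exact: cd.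
    exact: (continuous_fcomp cc (powR_norm_cont q20)).
  - by rewrite mulr_gt0// lt_min ltr01.
  move=> t; have dt := d0 t; have h1 := d1 t; have h2 := d2 t; split.
  - rewrite /k1 mulr_ge0 ?(ltW dt)//=.
    apply: le_trans (ler_wpM2l n0 h2) _; rewrite ler_wpM2r ?(ltW i0)//; lra.
  - rewrite /k2; apply/andP; split.
      by apply: le_trans h1; rewrite ler_piMr ?(ltW i1)// ge_min lexx.
    by apply: le_trans h2 _; rewrite ler_peMl ?(ltW i0)//; lra.
  - rewrite /k3; apply/andP; split.
      rewrite /m mulrC; apply: ler_pM => //; [|exact: ltW|].
        by rewrite le_min ler01 ltW.
      by apply: le_trans (e1 t); rewrite ge_min lexx orbT.
    rewrite /M; apply: ler_pM => //; first exact: ltW.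
    by apply: le_trans (e2 t) _; lra.
have [l [f [l0 fs fs1]]] := shooting p1 ok s01.
have [cf f0 df] := fs.
have f1 t : s0 < t < s1 -> `|f t| < 1.
  move=> /andP[h1 h2]; rewrite ltr_norml (phase_gtN1 p1 ok l0 fs fs1 h1 h2)/=.
  have [ft|ft] := leP 0 (f t); last lra.
  by rewrite -(f0 s0 (lexx _)); exact: phase_decreasing p1 ok l0 fs (lexx _) h1 ft.
have [sg sgI fsg] : exists2 sg, sg \in `[s0, s1] & f sg = 0.
  apply: IVT; [exact: ltW|exact: within_continuous|].
  rewrite (f0 s0 (lexx _)) fs1 ge_min le_max ler01/= andbT; apply/orP; right; lra.
move: sgI; rewrite in_itv/= => /andP[g0 g1].
have s0g : s0 < sg.
  rewrite lt_neqAle g0 andbT; apply/eqP => h; move: fsg.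
  by rewrite -h (f0 s0 (lexx _)) => /eqP; rewrite oner_eq0.
have gs1 : sg < s1.
  rewrite lt_neqAle g1 andbT; apply/eqP => h; move: fsg; rewrite h fs1 => /eqP.
  by rewrite oppr_eq0 oner_eq0.
have [P [cP P0 P1' Pg dP]] := profile_exists p1 ok s0g gs1 fs fsg fs1 f1.
have spos t : s0 < t < s1 -> 0 < f t -> 0 < slope p (f t).
  by move=> /f1 h ft; rewrite mulr_gt0// powR_gt0// subr_gt0.
exists l, (fun t => slope p (f t)), P, sg; rewrite /radial_system -/q; split => //.
- by rewrite s0g.
- move=> t ti; have := phase_to_riccati p1 fs (andP ti).1 (f1 t ti).
  by rewrite /k1 /k2 /k3 /d cid// gtr0_norm// (lt_trans s00)//; case/andP: ti.
split => //.
- move=> t ti; have := dP t ti.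
  by rewrite /k3 /d cid// gtr0_norm// (lt_trans s00)//; case/andP: ti.
- move=> t /andP[h1 h2]; apply: spos; first by rewrite h1 (lt_trans h2).
  by rewrite -fsg; apply: phase_decreasing p1 ok l0 fs (ltW h1) h2 _; rewrite fsg.
- move=> t /andP[h1 h2]; have ti : s0 < t < s1 by rewrite (lt_trans s0g h1).
  have ft : f t < 0.
    rewrite ltNge; apply/negP => ft.
    have := phase_decreasing p1 ok l0 fs (ltW s0g) h1 ft; rewrite fsg; lra.
  by rewrite nmulr_rlt0// powR_gt0// subr_gt0; exact: f1.
Unshelve. all: by end_near. Qed.

End radial_profile.

(** * Smooth functions of one variable *)

Section smooth1.
Context {R : realType}.
Implicit Types (f g F : R -> R) (k : nat) (x t : R).

(** Derivatives are exhibited as functions, so that closure properties reduce to rules for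
    [is_derive]; smoothness is [forall k, Ck k f]. *)
Fixpoint Ck k f : Prop :=
  if k is k'.+1 then exists2 f' : R -> R, forall x : R, is_derive x 1 f (f' x) & Ck k' f'
  else True.

Lemma CkW k f : Ck k.+1 f -> Ck k f.
Proof.
elim: k f => [//|k IHk] f [f' ff' Cf']; exists f' => //; exact: IHk.
Qed.

Lemma Ck_cst k (c : R) : Ck k (fun=> c).
Proof.
elim: k c => [//|k IHk] c; exists (fun=> 0) => // x; exact: is_derive_fcst.
Qed.

Lemma Ck_id k : Ck k id.
Proof.
case: k => [//|k]; exists (fun=> 1); last exact: Ck_cst.
by move=> x; exact: is_derive_id.
Qed.

Lemma CkD k f g : Ck k f -> Ck k g -> Ck k (fun x => f x + g x).
Proof.
elim: k f g => [//|k IHk] f g [f' df Cf] [g' dg Cg].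
exists (fun x => f' x + g' x); last exact: IHk.
by move=> x; exact: is_derive_fD.
Qed.

Lemma CkM k f g : Ck k f -> Ck k g -> Ck k (fun x => f x * g x).
Proof.
elim: k f g => [//|k IHk] f g Cf Cg; have Cf0 := CkW Cf; have Cg0 := CkW Cg.
have [f' df Cf'] := Cf; have [g' dg Cg'] := Cg.
exists (fun x => f' x * g x + f x * g' x); first by move=> x; exact: is_derive_fM.
by apply: CkD; apply: IHk.
Qed.

Lemma Ck_comp k f g : Ck k f -> Ck k g -> Ck k (fun x => f (g x)).
Proof.
elim: k f g => [//|k IHk] f g Cf Cg; have Cg0 := CkW Cg.
have [f' df Cf'] := Cf; have [g' dg Cg'] := Cg.
exists (fun x => f' (g x) * g' x); first by move=> x; exact: is_derive_fcomp.
by apply: CkM => //; exact: IHk.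
Qed.

Lemma Ck_affine k (a b : R) : Ck k (fun x => a * x + b).
Proof. by apply: CkD; [apply: CkM; [exact: Ck_cst|exact: Ck_id]|exact: Ck_cst]. Qed.

Lemma Ck_ext k f g : f =1 g -> Ck k f -> Ck k g.
Proof. by move=> /funext ->. Qed.

(** Cauchy's flat function [exp (- 1 / t)] multiplied by powers of [1 / t]: a family that
    differentiation maps into its own span, so all orders are handled by one induction. *)
Definition flat k (t : R) : R := if 0 < t then t^-1 ^+ k * expR (- t^-1) else 0.

Lemma expn_expRN_le k (u : R) : 0 <= u -> u ^+ k * expR (- u) <= k`!%:R.
Proof.
move=> u0; rewrite expRN ler_pdivrMr ?expR_gt0//; case: k => [|k].
  by rewrite expr0 fact0 mul1r -expR0 ler_expR.
have := expR_ge1Dxn k u0 => h.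
have f0 : 0 < (k.+1)`!%:R :> R by rewrite ltr0n fact_gt0.
have : u ^+ k.+1 / (k.+1)`!%:R <= expR u by apply: le_trans h; rewrite lerDr.
by rewrite ler_pdivrMr// mulrC.
Qed.

Lemma flat_bound k (t : R) : `|flat k t| <= k`!%:R.
Proof.
rewrite /flat; case: ifPn => t0; last by rewrite normr0.
have ti : 0 <= t^-1 by rewrite invr_ge0 ltW.
rewrite ger0_norm; first exact: expn_expRN_le.
by rewrite mulr_ge0 ?exprn_ge0 ?expR_ge0.
Qed.

Lemma flat_le k (t : R) : `|flat k t| <= k.+1`!%:R * `|t|.
Proof.
have [t0|t0] := leP t 0.
  by rewrite /flat ltNge t0/= normr0 mulr_ge0.
have -> : flat k t = flat k.+1 t * t.
  by rewrite /flat t0 exprS mulrAC [_ * t]mulrAC mulVf ?mul1r ?gt_eqF.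
by rewrite normrM ler_wpM2r ?flat_bound.
Qed.

(** At 0 the difference quotient of [flat k] is [flat k.+1], which tends to 0 by [flat_le]. *)
Lemma is_derive_flat k (t : R) :
  is_derive t 1 (flat k) (- k%:R * flat k.+1 t + flat k.+2 t).
Proof.
have [t0|t0|->] := ltgtP t 0.
- apply: (@near_eq_is_derive _ _ _ (fun=> 0)).
    near=> y; rewrite /flat ltNge ltW//; near: y; exact: near_ltr.
  rewrite /flat !ltNge (ltW t0)/= mulr0 addr0; exact: is_derive_fcst.
- apply: (@near_eq_is_derive _ _ _ (fun y : R => y^-1 ^+ k * expR (- y^-1))).
    by near=> y; rewrite /flat ifT//; near: y; exact: near_gtr.
  have tn : t != 0 by rewrite gt_eqF.
  have dV : is_derive t 1 (fun y : R => y^-1) (- 1 / t ^+ 2).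
    exact: (@is_derive_fV _ id t 1 tn (is_derive_id _ _)).
  have dX : is_derive t 1 (fun y : R => y^-1 ^+ k) (k%:R * t^-1 ^+ k.-1 * (- 1 / t ^+ 2)).
    apply: (@is_derive_fcomp _ _ (fun u => u ^+ k) (fun y : R => y^-1)).
      apply: DeriveDef; first exact: exprn_derivable.
      by rewrite exp_derive /GRing.scale/= mulr1.
  have dE : is_derive t 1 (fun y : R => expR (- y^-1)) (expR (- t^-1) * - (- 1 / t ^+ 2)).
    apply: (@is_derive_fcomp _ _ expR (fun y : R => - y^-1)); exact: is_deriveN.
  apply: is_derive_eq (is_derive_fM dX dE) _.
  rewrite /flat t0; case: k {dX} => [|k].
    by rewrite !expr0 !mul0r oppr0 mul0r !add0r; field.
  by rewrite /= !exprS; field.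
- rewrite {2 3}/flat ltxx mulr0 addr0.
  suff H : (fun h : R => h^-1 *: (flat k (h *: (1 : R) + 0) - flat k (0 : R))) @ (0 : R)^' --> (0 : R).
    by split; [apply/cvg_ex; exists 0|exact: cvg_lim].
  apply/cvgrPdist_lt => e e0; near=> h.
  have h0 : h != 0 by near: h; exact: nbhs_dnbhs_neq.
  rewrite sub0r normrN addr0 [h *: 1]mulr1 {2}/flat ltxx subr0 normrM normfV.
  have -> : flat k h = flat k.+1 h * h.
    rewrite /flat; case: ifPn => _; last by rewrite mul0r.
    by rewrite exprS mulrAC [_ * h]mulrAC mulVf ?mul1r.
  rewrite normrM mulrCA mulVf ?normr_eq0// mulr1.
  apply: le_lt_trans (flat_le _ _) _.
  have F0 : 0 < k.+2`!%:R :> R by rewrite ltr0n fact_gt0.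
  rewrite mulrC -ltr_pdivlMr//.
  have : `|0 - h| < e / k.+2`!%:R.
    near: h; apply: nbhs_dnbhs.
    by apply: (@cvgr_dist_lt _ _ _ (nbhs (0 : R)) _ id); [exact: cvg_id|exact: divr_gt0].
  by rewrite sub0r normrN.
Unshelve. all: by end_near. Qed.

Lemma Ck_flat k j : Ck k (flat j).
Proof.
elim: k j => [//|k IHk] j; eexists; first by move=> x; exact: is_derive_flat.
apply: CkD; last exact: IHk.
by apply: CkM; [exact: Ck_cst|exact: IHk].
Qed.

Lemma is_derive0_cst F (a b : R) : a <= b -> {within `[a, b], continuous F} ->
  (forall t, a < t < b -> is_derive t 1 F 0) -> F b = F a.
Proof.
move=> ab cF dF; apply/eqP; rewrite -subr_eq0 -normr_eq0 eq_le normr_ge0 andbT.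
have := @norm_le_of_derive R F (fun=> 0) (fun=> 0) (fun=> 0) a b ab cF.
rewrite subrr normr0; apply => //.
by apply: within_continuous => t; exact: cvg_cst.
Qed.

Lemma antiderivative_vanishing f (b : R) : continuous f -> (forall t, t <= b -> f t = 0) ->
  exists F, (forall t : R, is_derive t 1 F (f t)) /\ (forall t, t <= b -> F t = 0).
Proof.
(* The integration starts at [b - 1], not at [b]: the derivative is then known on an open half-line
   containing [b]. *)
move=> cf f0; have [F [cF F0 dF]] := antiderivative (b - 1) cf.
have F0' t : t <= b -> F t = 0.
  move=> tb; have [/F0//|bt] := leP t (b - 1).
  rewrite -(F0 (b - 1) (lexx _)); apply: is_derive0_cst; first exact: ltW.
    exact: within_continuous.
  move=> y /andP[y1 y2]; have := dF y y1; rewrite f0//; lra.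
exists F; split => // t; have [bt|tb] := ltP (b - 1) t; first exact: dF.
rewrite f0; last lra.
apply: (@near_eq_is_derive _ _ _ (fun=> 0)).
by near=> y; rewrite F0'//; apply/ltW; near: y; apply: near_ltr; lra.
Unshelve. all: by end_near. Qed.

Lemma Ck_continuous f : Ck 1 f -> continuous f.
Proof. by move=> [f' df _] x; exact: is_derive_cont (df x). Qed.

Lemma nondecreasing_of_derive F f (a b : R) : a <= b ->
  (forall t : R, is_derive t 1 F (f t)) -> (forall t, 0 <= f t) -> F a <= F b.
Proof.
move=> ab dF f0.
have := @is_derive_le0_nincr R (fun t => - F t) (fun t => - f t) a b ab.
move=> H; rewrite -lerN2; apply: H.
- by apply: within_continuous => t; apply: cvgN; exact: is_derive_cont (dF t).
- by move=> t _; rewrite oppr_le0.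
Qed.

(** The primitive of the bump [flat 0 t * flat 0 (1 - t)], divided by the total mass of the bump. *)
Lemma smooth_step : exists s : R -> R, [/\ forall k, Ck k s,
  forall t, 0 <= s t <= 1, forall t, t <= 0 -> s t = 0 & forall t, 1 <= t -> s t = 1].
Proof.
pose b t := flat 0 t * flat 0 (1 - t).
have Cb k : Ck k b.
  apply: CkM; first exact: Ck_flat.
  apply: (@Ck_comp k (flat 0) (fun t => 1 - t)); first exact: Ck_flat.
  by apply: (@Ck_ext k (fun t => -1 * t + 1)); [move=> t; ring|exact: Ck_affine].
have flat0 t : 0 <= flat 0 t.
  by rewrite /flat; case: ifP => // _; rewrite expr0 mul1r expR_ge0.
have b0 t : 0 <= b t by rewrite mulr_ge0.
have bN t : t <= 0 -> b t = 0 by move=> t0; rewrite /b /flat ltNge t0 mul0r.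
have b1 t : 1 <= t -> b t = 0.
  by move=> t1; rewrite /b mulrC /flat subr_gt0 ltNge t1 mul0r.
have [F [dF F0]] := antiderivative_vanishing (Ck_continuous (Cb 1%N)) bN.
have F1 t : 1 <= t -> F t = F 1.
  move=> t1; apply: is_derive0_cst => //.
    by apply: within_continuous => y; exact: is_derive_cont (dF y).
  by move=> y /andP[y1 _]; rewrite -(b1 y (ltW y1)).
have Fpos : 0 < F 1.
  have mono : F (1/2) <= F 1 by apply: nondecreasing_of_derive dF b0; lra.
  have F00 : 0 <= F (1/2).
    by rewrite -(F0 0 (lexx _)); apply: nondecreasing_of_derive dF b0; lra.
  (* Without mass, the monotone primitive would be constant on [[0, 1]], against the positive value
     of the bump at 1/2. *)
  rewrite lt_neqAle eq_sym (le_trans F00 mono) andbT; apply/eqP => F10.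
  have Fz t : 0 <= t <= 1 -> F t = 0.
    move=> /andP[t0 t1]; apply/eqP; rewrite eq_le -{1}F10 -(F0 0 (lexx _)).
    by rewrite !(nondecreasing_of_derive _ dF b0).
  have half : is_derive (1 / 2 : R) 1 F 0.
    apply: (@near_eq_is_derive _ _ _ (fun=> 0)).
    near=> y; rewrite Fz//; apply/andP; split; apply/ltW; near: y;
      [apply: near_gtr|apply: near_ltr]; lra.
  have [_ E1] := half; have [_ E2] := dF (1 / 2).
  have : 0 < b (1 / 2).
    have h1 : (0 : R) < 1 / 2 by lra.
    have h2 : (0 : R) < 1 - 1 / 2 by lra.
    by rewrite /b /flat h1 h2 !expr0 !mul1r mulr_gt0 ?expR_gt0.
  by rewrite -E2 E1 ltxx.
exists (fun t => (F 1)^-1 * F t); split.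
- move=> k; apply: CkM; first exact: Ck_cst.
  by case: k => [//|k]; exists b.
- move=> t.
  have Ft0 : 0 <= F t.
    have [/F0->//|t0] := leP t 0.
    by rewrite -(F0 0 (lexx _)); apply: nondecreasing_of_derive dF b0; exact: ltW.
  have Ft1 : F t <= F 1.
    have [/F1->//|t0] := leP 1 t.
    by apply: nondecreasing_of_derive dF b0; exact: ltW.
  by rewrite mulr_ge0 ?invr_ge0 ?(ltW Fpos)//= mulrC ler_pdivrMr// mul1r.
- by move=> t /F0 ->; rewrite mulr0.
- by move=> t /F1 ->; rewrite mulVf// gt_eqF.
Unshelve. all: by end_near. Qed.

(** A smooth positive part with error at most [e], the primitive of a step that rises on [[0, e]].
    It serves both to truncate at a level and to smooth a minimum; its slope in [[0, 1]] keeps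
    energies from growing. *)
Lemma smooth_positive_part (e : R) : 0 < e -> exists Y y : R -> R, [/\ forall k, Ck k Y,
  forall t : R, is_derive t 1 Y (y t), forall t, 0 <= y t <= 1,
  forall t, t <= 0 -> Y t = 0 & [/\ forall t, t <= 0 -> y t = 0, forall t, 0 <= Y t,
    forall t, t - e <= Y t & forall t, 0 <= t -> Y t <= t]].
Proof.
move=> e0; have [s [Cs s01 sN s1]] := smooth_step.
pose y t := s (e^-1 * t).
have Cy k : Ck k y.
  apply: (@Ck_comp k s ( *%R e^-1)) => //.
  by apply: CkM; [exact: Ck_cst|exact: Ck_id].
have y0 t : t <= 0 -> y t = 0.
  by move=> t0; apply: sN; rewrite pmulr_rle0// invr_gt0.
have y01 t : 0 <= y t <= 1 by exact: s01.
have yge t : 0 <= y t by have /andP[] := y01 t.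
have [Y [dY Y0]] := antiderivative_vanishing (Ck_continuous (Cy 1%N)) y0.
have Yge t : 0 <= Y t.
  have [/Y0->//|t0] := leP t 0.
  by rewrite -(Y0 0 (lexx _)); apply: nondecreasing_of_derive dY yge; exact: ltW.
exists Y, y; split => //; first by case=> [//|k]; exists y.
split => //.
- move=> t; have [te|te] := leP t e; first by apply: le_trans (Yge t); lra.
  have -> : Y t = Y t - t + t by ring.
  have -> : Y t - t = Y e - e.
    apply: (@is_derive0_cst (fun t => Y t - t)); first exact: ltW.
      apply: within_continuous => x; apply: cvgB; last exact: cvg_id.
      exact: is_derive_cont (dY x).
    move=> x /andP[ex _]; have := is_derive_fB (dY x) (is_derive_id x 1).
    by rewrite /y s1 ?subrr// mulrC ler_pdivlMr// mul1r ltW.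
  have := Yge e; lra.
- move=> t t0.
  have := @is_derive_le0_nincr R (fun t => Y t - t) (fun t => y t - 1) 0 t t0.
  rewrite (Y0 0 (lexx _)) subr0 subr_le0; apply.
  + apply: within_continuous => x; apply: cvgB; last exact: cvg_id.
    exact: is_derive_cont (dY x).
  + by move=> x _; rewrite subr_le0; have /andP[] := y01 x.
Qed.

(** Only [x] is confined to the segment; [y] may leave it, which saves a discussion of the end
    points later. *)
Lemma segment_unif_continuous f (a b e : R) : continuous f -> 0 < e ->
  exists2 d : R, 0 < d & forall x y, a <= x <= b -> `|x - y| < d -> `|f x - f y| <= e.
Proof.
move=> cf e0.
have := @segment_compact R a b; rewrite compact_near_coveringP.
move=> /(_ R (0 : R)^'+ (fun d x => forall y, `|x - y| < d -> `|f x - f y| <= e)) H.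
have [|d /= d0 dP] := H _.
  move=> x _; have e2 : 0 < e / 2 by rewrite divr_gt0.
  have := @cvgr_dist_le _ _ _ (nbhs x) _ _ _ (cf x) _ e2 => -[r /= r0 rP].
  exists (ball x (r / 2), [set d | d < r / 2]) => /=.
    split; first by apply: nbhsx_ballx; rewrite divr_gt0.
    by apply: nbhs_right_lt; rewrite divr_gt0.
  move=> [x' d] [/= xx' dr] y x'y.
  have h1 : `|f x - f x'| <= e / 2.
    by apply: rP => /=; apply: lt_trans xx' _; lra.
  have h2 : `|f x - f y| <= e / 2.
    apply: rP => /=; have := ler_normD (x - x') (x' - y).
    by rewrite addrA subrK; move: xx'; rewrite /ball/=; lra.
  have := ler_normD (f x' - f x) (f x - f y).
  by rewrite addrA subrK [`|f x' - f x|]distrC; lra.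
have d20 : 0 < d / 2 by rewrite divr_gt0.
exists (d / 2) => // x y xab xy.
apply: (dP (d / 2) _ d20 x _ y xy); last by rewrite /= in_itv.
by rewrite /= sub0r normrN gtr0_norm//; lra.
Qed.

(** A sum of smooth steps passing from one sample of [f] to the next on a fine grid. In each cell
    the value is a convex combination of two neighbouring samples, so no convolution is involved. *)
Lemma smooth_interpolation f (S e : R) : continuous f -> 0 < S -> 0 < e ->
  exists G : R -> R, [/\ forall k, Ck k G, forall t, t <= 0 -> G t = f 0 &
    forall t, 0 <= t <= S -> `|G t - f t| <= e].
Proof.
move=> cf S0 e0; have [s [Cs s01 sN s1]] := smooth_step.
have [d d0 dP] := segment_unif_continuous 0 S cf e0.
have [n nP] : exists n : nat, S / d < n%:R.
  by exists (Num.truncn (S / d)).+1; have := truncnS_gt (S / d).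
have n0 : 0 < n%:R :> R by apply: lt_trans nP; rewrite divr_gt0.
pose h := S / n%:R; have h0 : 0 < h by rewrite divr_gt0.
have hd : h < d by rewrite /h ltr_pdivrMr// mulrC -ltr_pdivrMr.
pose x j : R := h * j%:R.
pose G m t := f 0 + \sum_(j < m) (f (x j.+1) - f (x j)) * s (h^-1 * t - j%:R).
have GS m t : G m.+1 t = G m t + (f (x m.+1) - f (x m)) * s (h^-1 * t - m%:R).
  by rewrite /G big_ord_recr/= addrA.
have ht j t : (h^-1 * t - j%:R <= 0) = (t <= x j).
  by rewrite subr_le0 mulrC ler_pdivrMr// mulrC.
have ht1 j t : (1 <= h^-1 * t - j%:R) = (x j.+1 <= t).
  by rewrite lerBrDr [h^-1 * t]mulrC ler_pdivlMr// /x -natr1 addrC mulrC.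
have Glow m t i : t <= x i -> (i <= m)%N -> G m t = G i t.
  move=> ti /subnK <-; elim: (m - i)%N => [//|k IHk].
  rewrite addSn GS IHk sN ?mulr0 ?addr0// ht; apply: le_trans ti _.
  by rewrite ler_wpM2l ?(ltW h0)// ler_nat leq_addl.
have Ghigh m t : x m <= t -> G m t = f (x m).
  elim: m => [|m IHm] mt; first by rewrite /G big_ord0 addr0 /x mulr0.
  rewrite GS s1 ?ht1// mulr1 IHm; first by rewrite addrC subrK.
  by apply: le_trans mt; rewrite ler_wpM2l ?(ltW h0)// ler_nat.
have CG m k : Ck k (G m).
  elim: m => [|m IHm].
    by apply: (@Ck_ext k (fun=> f 0)); [move=> t; rewrite /G big_ord0 addr0|exact: Ck_cst].
  apply: (@Ck_ext k (fun t => G m t + (f (x m.+1) - f (x m)) * s (h^-1 * t - m%:R))).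
    by move=> t; rewrite GS.
  apply: CkD => //; apply: CkM; first exact: Ck_cst.
  by apply: (@Ck_comp k s (fun t => h^-1 * t - m%:R)) => //; exact: Ck_affine.
have x0 : x 0%N = 0 by rewrite /x mulr0.
have xn : x n = S by rewrite /x /h divfK// gt_eqF.
exists (G n); split => //.
  by move=> t t0; rewrite (@Glow n t 0%N) ?x0// /G big_ord0 addr0.
move=> t /andP[t0 tS].
have [St|St] := leP S t.
  have tE : t = S by apply/eqP; rewrite eq_le tS.
  by rewrite Ghigh tE ?xn// subrr normr0 ltW.
pose i := Num.truncn (t / h).
have th0 : 0 <= t / h by rewrite divr_ge0// ltW.
have it : x i <= t by rewrite /x mulrC -ler_pdivlMr// truncn_le.
have ti : t < x i.+1 by rewrite /x mulrC -ltr_pdivrMr// truncnS_gt.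
have iN : (i < n)%N.
  rewrite -(ltr_nat R); apply: (@le_lt_trans _ _ (t / h)); first by rewrite truncn_le.
  by rewrite ltr_pdivrMr// /h mulrC divfK// gt_eqF.
rewrite (Glow n t i.+1 (ltW ti) iN) GS Ghigh//.
have xS : x i.+1 = x i + h by rewrite /x -natr1 mulrDr mulr1.
have /andP[sg0 sg1] := s01 (h^-1 * t - i%:R).
move: (s _) sg0 sg1 => sg sg0 sg1.
have A : `|f t - f (x i)| <= e.
  by apply: dP; [rewrite t0|rewrite ger0_norm ?subr_ge0//; lra].
have B : `|f t - f (x i.+1)| <= e.
  by apply: dP; [rewrite t0|rewrite ler0_norm ?subr_le0 ?(ltW ti)//; lra].
move: A B; rewrite !ler_norml => /andP[A1 A2] /andP[B1 B2].
by apply/andP; split; nra.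
Qed.

(** The derivative is interpolated and then integrated. Subtracting [f' 0] first makes the integrand
    vanish on the negative half-line, and the affine part is put back afterwards. *)
Lemma smooth_C1_approximation f (f' : R -> R) (S e : R) : (forall t : R, is_derive t 1 f (f' t)) ->
  continuous f' -> 0 < S -> 0 < e ->
  exists F F' : R -> R, [/\ forall k, Ck k F, forall t : R, is_derive t 1 F (F' t) &
    forall t, 0 <= t <= S -> `|F t - f t| <= e * t /\ `|F' t - f' t| <= e].
Proof.
move=> df cf' S0 e0; have [G [CG G0 GP]] := smooth_interpolation cf' S0 e0.
have cG0 : continuous (fun t => G t - f' 0).
  by move=> t; apply: cvgB; [exact: (Ck_continuous (CG 1%N))|exact: cvg_cst].
have G0' t : t <= 0 -> G t - f' 0 = 0 by move=> /G0 ->; rewrite subrr.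
have [H [dH H0]] := antiderivative_vanishing cG0 G0'.
pose F t := f 0 + f' 0 * t + H t.
have dF t : is_derive t 1 F (G t).
  have D : is_derive t 1 (fun t => f 0 + f' 0 * t) (0 + f' 0 * 1).
    exact: (is_derive_fD (is_derive_fcst _ _ _) (is_derive_fZ (f' 0) (is_derive_id t 1))).
  by apply: is_derive_eq (is_derive_fD D (dH t)) _; ring.
exists F, G; split => //; first by case=> [//|k]; exists G.
move=> t /andP[t0 tS]; split; last by apply: GP; rewrite t0.
have := @norm_le_of_derive R (fun t => F t - f t) (fun t => G t - f' t) ( *%R e) (fun=> e * 1) 0 t t0.
have -> : F 0 - f 0 = 0 by rewrite /F H0// mulr0 !addr0 subrr.
rewrite mulr0 !subr0; apply.
- apply: within_continuous => x; apply: cvgB; [exact: is_derive_cont (dF x)|].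
  exact: is_derive_cont (df x).
- by apply: within_continuous => x; apply: cvgM; [exact: cvg_cst|exact: cvg_id].
- by move=> x /andP[x0 xt]; rewrite mulr1; apply: GP; lra.
Qed.

End smooth1.

(** * Smooth functions and the Euclidean norm on R^n *)

Section continuous_pointwise.
Context {R : realType} {T : topologicalType}.
Implicit Types f g : T -> R.

Lemma continuous_fD f g : continuous f -> continuous g -> continuous (fun x => f x + g x).
Proof. by move=> cf cg x; apply: cvgD; [exact: cf|exact: cg]. Qed.

Lemma continuous_fB f g : continuous f -> continuous g -> continuous (fun x => f x - g x).
Proof. by move=> cf cg x; apply: cvgB; [exact: cf|exact: cg]. Qed.

Lemma continuous_fM f g : continuous f -> continuous g -> continuous (fun x => f x * g x).
Proof. by move=> cf cg x; apply: cvgM; [exact: cf|exact: cg]. Qed.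

Lemma continuous_fcst (c : R) : continuous (fun _ : T => c).
Proof. by move=> x; exact: cvg_cst. Qed.

End continuous_pointwise.

Section smoothN.
Context {R : realType} {N : nat}.
Local Notation V := 'rV[R]_N.
Implicit Types (f g : V -> R) (x v a : V) (k : nat) (i j : 'I_N).

Lemma is_derive_fsum (f : 'I_N -> V -> R) (d : 'I_N -> R) x v :
  (forall i, is_derive x v (f i) (d i)) ->
  is_derive x v (fun y => \sum_i f i y) (\sum_i d i).
Proof.
move=> fd; have -> : (fun y => \sum_i f i y) = \sum_i f i.
  by apply/funext => y; rewrite fct_sumE.
exact: is_derive_sum.
Qed.

Lemma is_derive_coord x v i : is_derive x v (fun y => y 0 i) (v 0 i).
Proof.
apply/is_derive_line.
have -> : (fun h : R => (h *: v + x) 0 i) = (fun h => v 0 i * h + x 0 i).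
  by apply/funext => h; rewrite !mxE mulrC.
rewrite -[X in is_derive _ _ _ X]mulr1; exact: is_derive_fDc.
Qed.

(** Continuity is demanded at every level, because partial derivatives alone do not imply it. *)
Fixpoint CkN k f : Prop := continuous f /\
  if k is k'.+1 then forall i, exists2 f' : V -> R,
    forall x, is_derive x (delta_mx 0 i) f (f' x) & CkN k' f'
  else True.

Lemma CkN_continuous k f : CkN k f -> continuous f.
Proof. by case: k => [|k] []. Qed.

Lemma CkNW k f : CkN k.+1 f -> CkN k f.
Proof.
elim: k f => [|k IHk] f [cf Cf]; first by split.
split => // i; have [f' df Cf'] := Cf i; exists f' => //; exact: IHk.
Qed.

Lemma CkN_cst k (c : R) : CkN k (fun=> c).
Proof.
elim: k c => [|k IHk] c; split => //; try exact: continuous_fcst.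
move=> i; exists (fun=> 0); last exact: IHk.
by move=> x; exact: is_derive_fcst.
Qed.

Lemma CkN_coord k i : CkN k (fun x => x 0 i).
Proof.
have cc : continuous (fun x : V => x 0 i) by exact: coord_continuous.
case: k => [|k]; split => // j.
exists (fun=> (delta_mx 0 j : V) 0 i); last exact: CkN_cst.
by move=> x; exact: is_derive_coord.
Qed.

Lemma CkND k f g : CkN k f -> CkN k g -> CkN k (fun x => f x + g x).
Proof.
elim: k f g => [|k IHk] f g Cf Cg.
  by split => //; exact: continuous_fD (CkN_continuous Cf) (CkN_continuous Cg).
split; first exact: continuous_fD (CkN_continuous Cf) (CkN_continuous Cg).
move=> i; have [f' df Cf'] := Cf.2 i; have [g' dg Cg'] := Cg.2 i.
exists (fun x => f' x + g' x); last exact: IHk.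
by move=> x; exact: is_derive_fD.
Qed.

Lemma CkNM k f g : CkN k f -> CkN k g -> CkN k (fun x => f x * g x).
Proof.
elim: k f g => [|k IHk] f g Cf Cg.
  by split => //; exact: continuous_fM (CkN_continuous Cf) (CkN_continuous Cg).
split; first exact: continuous_fM (CkN_continuous Cf) (CkN_continuous Cg).
move=> i; have [f' df Cf'] := Cf.2 i; have [g' dg Cg'] := Cg.2 i.
exists (fun x => f' x * g x + f x * g' x); first by move=> x; exact: is_derive_fM.
by apply: CkND; apply: IHk => //; exact: CkNW.
Qed.

Lemma CkN_comp k (h : R -> R) f : (forall m, Ck m h) -> CkN k f -> CkN k (fun x => h (f x)).
Proof.
elim: k h f => [|k IHk] h f Ch Cf.
  split => //; have cf := CkN_continuous Cf; have ch := Ck_continuous (Ch 1%N).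
  exact: (continuous_fcomp cf ch).
split.
  have cf := CkN_continuous Cf; have ch := Ck_continuous (Ch 1%N).
  exact: (continuous_fcomp cf ch).
move=> i; have [f' df Cf'] := Cf.2 i.
have [h' dh _] := Ch 1%N.
(* Each order of [Ck] comes with its own derivative; uniqueness identifies them all with [h']. *)
have Ch' m : Ck m h'.
  have [g' dg Cg] := Ch m.+1; suff -> : h' = g' by [].
  by apply/funext => t; have [_ <-] := dh t; have [_ <-] := dg t.
exists (fun x => h' (f x) * f' x); first by move=> x; exact: is_derive_fcomp.
by apply: CkNM => //; apply: IHk => //; exact: CkNW.
Qed.

Lemma CkN_sum k (f : 'I_N -> V -> R) : (forall i, CkN k (f i)) -> CkN k (fun x => \sum_i f i x).
Proof.
move=> Cf; rewrite (_ : (fun x => _) = (fun x => \sum_(i <- index_enum 'I_N) f i x))//.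
elim: (index_enum _) => [|i s IHs].
  rewrite (_ : (fun x => _) = (fun=> 0)); first exact: CkN_cst.
  by apply/funext => x; rewrite big_nil.
rewrite (_ : (fun x => _) = (fun x => f i x + \sum_(i <- s) f i x)); first exact: CkND.
by apply/funext => x; rewrite big_cons.
Qed.

Lemma partialE i f (f' : V -> R) : (forall x, is_derive x (delta_mx 0 i) f (f' x)) ->
  partial i f = f'.
Proof. by move=> df; apply/funext => x; have [_] := df x. Qed.

Lemma smooth_CkN f : (forall k, CkN k f) -> smooth f.
Proof.
move=> Cf s; suff H k : CkN k (iter_partial s f).
  split; first exact: CkN_continuous (H 0).
  by move=> i x; have [f' df _] := (H 1%N).2 i; case: (df x).
elim: s k => [//|i s IHs] k /=.
have [f' df Cf'] := (IHs k.+1).2 i.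
by rewrite (partialE df).
Qed.

End smoothN.

Section euclidean_norm.
Context {R : realType} {N : nat}.
Local Notation V := 'rV[R]_N.
Implicit Types (x y v a : V) (k : nat) (i j : 'I_N).

Definition sqn x : R := \sum_i x 0 i ^+ 2.

Lemma sqn_ge0 x : 0 <= sqn x.
Proof. by apply: sumr_ge0 => i _; exact: sqr_ge0. Qed.

Lemma enormE x : enorm x = Num.sqrt (sqn x). Proof. by []. Qed.

Lemma enorm_sqr x : enorm x ^+ 2 = sqn x.
Proof. by rewrite enormE sqr_sqrtr// sqn_ge0. Qed.

Lemma enorm_ge0 x : 0 <= enorm x. Proof. exact: sqrtr_ge0. Qed.

Lemma enorm_lt x (r : R) : 0 <= r -> (enorm x < r) = (sqn x < r ^+ 2).
Proof. by move=> r0; rewrite -enorm_sqr ltr_sqr ?nnegrE ?enorm_ge0. Qed.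

Lemma enorm_le x (r : R) : 0 <= r -> (enorm x <= r) = (sqn x <= r ^+ 2).
Proof. by move=> r0; rewrite -enorm_sqr ler_sqr ?nnegrE ?enorm_ge0. Qed.

Lemma coord_le_enorm x i : `|x 0 i| <= enorm x.
Proof.
rewrite -(ler_sqr (normr_ge0 _) (enorm_ge0 _)) enorm_sqr real_normK ?num_real//.
by rewrite /sqn (bigD1 i)//= lerDl sumr_ge0// => j _; exact: sqr_ge0.
Qed.

Lemma norm_le_enorm x : `|x| <= enorm x.
Proof.
rewrite [leLHS]/Num.norm/= mx_normrE; apply/bigmax_leP; split; first exact: enorm_ge0.
by move=> [i j] _ /=; rewrite ord1; exact: coord_le_enorm.
Qed.

Lemma enormZ (c : R) x : enorm (c *: x) = `|c| * enorm x.
Proof.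
rewrite /enorm -sqrtr_sqr -sqrtrM ?sqr_ge0//; congr Num.sqrt.
by rewrite mulr_sumr; apply: eq_bigr => i _; rewrite mxE exprMn.
Qed.

Lemma enormN x : enorm (- x) = enorm x.
Proof. by rewrite -scaleN1r enormZ normrN1 mul1r. Qed.

Lemma enorm0 : enorm (0 : V) = 0.
Proof. by rewrite -(scale0r (0 : V)) enormZ normr0 mul0r. Qed.

Lemma enorm_eq0 x : enorm x = 0 -> x = 0.
Proof.
move=> x0; apply/rowP => i; rewrite mxE; apply/eqP; rewrite -normr_eq0 eq_le normr_ge0.
by rewrite andbT -x0 coord_le_enorm.
Qed.

(** Expanding [sqn (|y| x - |x| y) >= 0] gives [2 |x| |y| (|x| |y| - x . y) >= 0]. *)
Lemma cauchy_schwarz x y : \sum_i x 0 i * y 0 i <= enorm x * enorm y.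
Proof.
have [x0|x0] := eqVneq (enorm x) 0.
  by rewrite x0 mul0r (enorm_eq0 x0) big1// => i _; rewrite mxE mul0r.
have [y0|y0] := eqVneq (enorm y) 0.
  by rewrite y0 mulr0 (enorm_eq0 y0) big1// => i _; rewrite mxE mulr0.
have xp : 0 < enorm x by rewrite lt_neqAle eq_sym x0 enorm_ge0.
have yp : 0 < enorm y by rewrite lt_neqAle eq_sym y0 enorm_ge0.
have : 0 <= sqn (enorm y *: x - enorm x *: y) := sqn_ge0 _.
have -> : sqn (enorm y *: x - enorm x *: y) =
    2 * (enorm x * enorm y) * (enorm x * enorm y - \sum_i x 0 i * y 0 i).
  rewrite /sqn; under eq_bigr => i _.
    rewrite !mxE (_ : _ ^+ 2 = enorm y ^+ 2 * (x 0 i ^+ 2) + enorm x ^+ 2 * (y 0 i ^+ 2)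
      - 2 * (enorm x * enorm y) * (x 0 i * y 0 i)); last by ring.
    over.
  rewrite sumrB big_split/= -!mulr_sumr -/(sqn x) -/(sqn y) -!enorm_sqr.
  by ring.
by rewrite pmulr_rge0 ?subr_ge0// !mulr_gt0.
Qed.

Lemma enormD x y : enorm (x + y) <= enorm x + enorm y.
Proof.
rewrite enorm_le ?addr_ge0 ?enorm_ge0// sqrrD !enorm_sqr.
have -> : sqn (x + y) = sqn x + (\sum_i x 0 i * y 0 i) *+ 2 + sqn y.
  rewrite /sqn -sumrMnl -!big_split/=; apply: eq_bigr => i _.
  by rewrite mxE sqrrD.
by rewrite lerD2r lerD2l lerMn2r cauchy_schwarz.
Qed.

Lemma enormB x y : enorm x - enorm y <= enorm (x - y).
Proof. by rewrite lerBlDr -{1}(subrK y x); exact: enormD. Qed.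

Lemma is_derive_sqn x a i :
  is_derive x (delta_mx 0 i) (fun y => sqn (y - a)) (2 * (x - a) 0 i).
Proof.
have D j : is_derive x (delta_mx 0 i : V) (fun y => (y - a) 0 j ^+ 2)
    (2 * ((x - a) 0 j * (delta_mx 0 i : V) 0 j)).
  have d1 : is_derive x (delta_mx 0 i : V) (fun y => (y - a) 0 j) ((delta_mx 0 i : V) 0 j).
    rewrite (_ : (fun y : V => (y - a) 0 j) = (fun y : V => y 0 j + - a 0 j)).
      by apply: is_derive_fDc; exact: is_derive_coord.
    by apply/funext => y; rewrite !mxE.
  rewrite (_ : (fun y : V => (y - a) 0 j ^+ 2) = (fun y : V => (y - a) 0 j * (y - a) 0 j)).
    by apply: is_derive_eq (is_derive_fM d1 d1) _; ring.
  by apply/funext => y; rewrite expr2.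
apply: is_derive_eq (is_derive_fsum D) _.
rewrite (bigD1 i)//= big1 ?addr0; last first.
  by move=> j ji; rewrite !mxE/= (negbTE ji) !mulr0.
by rewrite [(delta_mx _ _) _ _]mxE !eqxx mulr1.
Qed.

Lemma CkN_sqn k a : CkN k (fun x => sqn (x - a)).
Proof.
apply: CkN_sum => i.
rewrite (_ : (fun x : V => (x - a) 0 i ^+ 2) =
             (fun x : V => (x 0 i + - a 0 i) * (x 0 i + - a 0 i))); last first.
  by apply/funext => x; rewrite !mxE expr2.
by apply: CkNM; (apply: CkND; [exact: CkN_coord|exact: CkN_cst]).
Qed.

Lemma sqn_continuous a : continuous (fun x => sqn (x - a)).
Proof. exact: CkN_continuous (CkN_sqn 0 a). Qed.

Lemma enorm_continuous a : continuous (fun x => enorm (x - a)).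
Proof.
have cs := @sqn_continuous a; exact: (continuous_fcomp cs (@sqrt_continuous R)).
Qed.

Lemma closure_eball_sub a (r : R) : closure (eball a r) `<=` [set x | enorm (x - a) <= r].
Proof.
have cl : closed [set x | enorm (x - a) <= r].
  have := @closed_comp _ _ (fun x => enorm (x - a)) [set t : R | t <= r].
  by apply; [move=> x _; exact: enorm_continuous|exact: closed_le].
rewrite [X in _ `<=` X](closure_id _).1//; apply: closure_subset => x; exact: ltW.
Qed.

Lemma sub_closure_eball a (r : R) : 0 < r -> [set x | enorm (x - a) <= r] `<=` closure (eball a r).
Proof.
move=> r0 x /= xr B.
have cg : continuous (fun t : R => t *: (x - a) + a).
  move=> t; apply: cvgD; last exact: cvg_cst.
  exact: scalel_continuous.
have := cg 1; rewrite /continuous_at scale1r subrK => /[apply] -[e /= e0 eB].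
pose t := 1 - Num.min (e / 2) (1 / 2).
have [t0 t1 te] : [/\ 0 < t, t < 1 & `|1 - t| < e].
  rewrite /t; case: (leP (e / 2) (1 / 2)) => h.
    by rewrite (_ : 1 - (1 - e / 2) = e / 2) ?ger0_norm; [split; lra|lra|ring].
  by rewrite (_ : 1 - (1 - 1 / 2) = 1 / 2 :> R) ?ger0_norm; [split; lra|lra|ring].
exists (t *: (x - a) + a); split; last exact: eB.
rewrite /eball /= addrK enormZ gtr0_norm//.
have := enorm_ge0 (x - a); nra.
Qed.

Lemma compact_enorm (A : set V) (M : R) : closed A -> (forall x, A x -> enorm x <= M) -> compact A.
Proof.
move=> cA AM; apply: bounded_closed_compact => //.
exists M; split; first exact: num_real.
move=> M' MM' x Ax; apply: le_trans (norm_le_enorm x) _.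
by apply: le_trans (AM x Ax) _; exact: ltW.
Qed.

End euclidean_norm.

(** * Integration on R^n *)

Section rV_measure.
Context {R : realType}.

Lemma measurable_box n (A : 'I_n -> set (measurableTypeR R)) :
  (forall i, measurable (A i)) -> measurable [set x : 'rV[R]_n | forall i, A i (x 0 i)].
Proof.
move=> mA; rewrite (_ : [set _ | _] =
    \big[setI/setT]_(i < n) (rV_coord i @^-1` A i)); last first.
  rewrite -bigcap_seq; apply/seteqP; split => y Ay; first by move=> i _; exact: Ay.
  by move=> i; apply: (Ay i); rewrite /= mem_index_enum.
apply: bigsetI_measurable => i _; rewrite -[X in measurable X]setTI.
exact: measurable_rV_coord.
Qed.

(** Balls of the ambient topology are boxes, so an open set is the union of the rational boxes it
    contains. The union runs over all rational boxes, the others being replaced by the empty set. *)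
Lemma open_measurable_rV n (A : set 'rV[R]_n) : open A -> measurable A.
Proof.
move=> oA.
pose box (c : {ffun 'I_n -> rat * rat}) : set 'rV[R]_n :=
  [set x | forall i, `]ratr (c i).1, ratr (c i).2[%classic (x 0 i)].
have -> : A = \bigcup_(c : {ffun 'I_n -> rat * rat}) (if `[< box c `<=` A >] then box c else set0).
  apply/seteqP; split => [x Ax|x [c _]]; last by case: asboolP => // cA; exact: cA.
  have /nbhs_ballP[e /= e0 eA] : nbhs x A by exact: open_nbhs_nbhs.
  have ql i : {q : rat * rat | [/\ x 0 i - e < ratr q.1 :> R, ratr q.1 < x 0 i :> R,
      x 0 i < ratr q.2 & ratr q.2 < x 0 i + e]}.
    apply/cid; have /rat_in_itvoo[q1] : x 0 i - e < x 0 i by rewrite ltrBlDr ltrDl.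
    rewrite in_itv => /andP[? ?].
    have /rat_in_itvoo[q2] : x 0 i < x 0 i + e by rewrite ltrDl.
    by rewrite in_itv => /andP[? ?]; exists (q1, q2).
  pose c := [ffun i => sval (ql i)].
  have cA : box c `<=` A.
    move=> y yc; apply: eA; split => // i j; rewrite ord1.
    have := yc j; rewrite /= in_itv /c ffunE; case: (svalP (ql j)) => h1 h2 h3 h4.
    move=> /andP[h5 h6]; rewrite /ball/= ltr_distlC.
    by rewrite (lt_trans h1 h5) (lt_trans h6 h4).
  exists c => //; case: asboolP => // _ i; rewrite /= in_itv /c ffunE.
  by case: (svalP (ql i)) => _ h1 h2 _; apply/andP; split.
apply: countable_bigcupT_measurable => [//|c].
case: ifP => _; last exact: measurable0.
by apply: (@measurable_box n (fun i => `]ratr (c i).1, ratr (c i).2[%classic)) => i; exact: measurable_itv.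
Qed.

Lemma continuous_measurable_rV n (f : 'rV[R]_n -> R) :
  continuous f -> measurable_fun setT f.
Proof.
move=> /continuousP cf; apply: (measurability _ (RGenOpens.measurableE R)).
move=> _ [_ [a [b ->] <-]]; rewrite setTI; apply: open_measurable_rV.
exact/cf/interval_open.
Qed.

Lemma measurable_shift n (a : 'rV[R]_n) : measurable_fun setT (fun x : 'rV[R]_n => x + a).
Proof.
apply: measurable_fun_rV => i.
rewrite (_ : _ \o _ = fun x : 'rV[R]_n => x 0 i + a 0 i); last first.
  by apply/funext => x; rewrite /rV_coord /= mxE.
apply: measurable_funD => //; exact: measurable_rV_coord.
Qed.

Lemma lebesgue_measure_shift (c : R) (A : set (measurableTypeR R)) : measurable A ->
  lebesgue_measure ((fun t => t + c) @^-1` A) = lebesgue_measure A.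
Proof.
have mc : measurable_fun setT (fun t : measurableTypeR R => t + c : measurableTypeR R).
  exact: measurable_funD.
pose mc' := isMeasurableFun.Build _ _ _ _ _ mc.
pose f : {mfun measurableTypeR R >-> measurableTypeR R} :=
  HB.pack (fun t : measurableTypeR R => t + c : measurableTypeR R) mc'.
move=> mA; apply/esym.
apply: (@lebesgue_measure_unique R (pushforward lebesgue_measure f)) => // Y /ocitvP[->|].
  by rewrite !measure0.
move=> [[x y] /= xy ->].
rewrite /pushforward (_ : _ @^-1` _ = `]x - c, y - c]%classic).
  by rewrite !lebesgue_measure_itv/= !lte_fin ltrD2r xy -!EFinB; congr EFin; ring.
by apply/seteqP; split => t /=; rewrite !in_itv/= ltrBlDr lerBrDr.
Qed.

(** By induction on the dimension: the shifted product measure agrees with the original one on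
    rectangles, hence everywhere by uniqueness of the product. *)
Lemma lebesgue_rV_shift n (a : 'rV[R]_n) (A : set 'rV[R]_n) : measurable A ->
  lebesgue_rV n ((fun x => x + a) @^-1` A) = lebesgue_rV n A.
Proof.
elim: n a A => [|n IHn] a A mA.
  by congr (lebesgue_rV 0 _); apply/seteqP; split => x /=; rewrite (thinmx0 (x + a)) (thinmx0 x).
pose a' : 'rV[R]_n := \row_i a 0 (lift 0 i).
pose sh (z : measurableTypeR R * 'rV[R]_n) : measurableTypeR R * 'rV[R]_n :=
  (z.1 + a 0 0, z.2 + a').
have msh : measurable_fun setT sh.
  apply/measurable_fun_pairP; split.
    by apply: measurable_funD => //; exact: measurable_fst.
  by apply: (measurableT_comp (measurable_shift a')); exact: measurable_snd.
pose msh' := isMeasurableFun.Build _ _ _ _ _ msh.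
pose f : {mfun (measurableTypeR R * 'rV[R]_n)%type >-> (measurableTypeR R * 'rV[R]_n)%type} :=
  HB.pack sh msh'.
have shE z : rV_cons (sh z) = rV_cons z + a.
  apply/rowP => i; rewrite [RHS]mxE; case: (unliftP 0 i) => [j ->|->].
    by rewrite !rV_consS !mxE.
  by rewrite !rV_cons0.
rewrite /= /lebesgue_rVS /pushforward.
have -> : @rV_cons R n @^-1` ((fun x => x + a) @^-1` A) = f @^-1` (@rV_cons R n @^-1` A).
  by apply/seteqP; split => z /=; rewrite shE.
apply/esym.
apply: (@product_measure_unique _ _ _ _ _ _ _ (pushforward (lebesgue_measure \x lebesgue_rV n)%E f)).
  move=> B C mB mC; rewrite /pushforward.
  rewrite [LHS](_ : _ = (lebesgue_measure \x lebesgue_rV n)%E (((fun t : measurableTypeR R => t + a 0 0) @^-1` B) `*` ((fun x => x + a') @^-1` C)))//.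
  rewrite product_measure1E ?IHn//.
  - by congr (_ * _)%E; exact: lebesgue_measure_shift.
  - by rewrite -[X in measurable X]setTI; exact: (measurable_funD).
  - by rewrite -[X in measurable X]setTI; exact: measurable_shift.
by rewrite -[X in measurable X]setTI; exact: measurable_rV_cons.
Qed.

End rV_measure.

(** * Integrals of continuous compactly supported functions *)

Section compactly_supported.
Context {R : realType} {N : nat}.
Local Notation V := 'rV[R]_N.
Local Notation mu := (lebesgue_rV N).
Implicit Types (f g h : V -> R) (x a : V).

Definition Cc f : Prop := continuous f /\ exists M : R, forall x, M < enorm x -> f x = 0.

Lemma Cc_bounded f : Cc f -> exists C : R, forall x, `|f x| <= C.
Proof.
move=> [cf [M fM]].
have cK : compact [set x : V | enorm (x - 0) <= M].
  apply: (@compact_enorm _ _ _ M); last by move=> x /=; rewrite subr0.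
  have := @closed_comp _ _ (fun x : V => enorm (x - 0)) [set t : R | t <= M].
  by apply; [move=> x _; exact: enorm_continuous|exact: closed_le].
have : compact (f @` [set x : V | enorm (x - 0) <= M]).
  by apply: continuous_compact => //; exact: continuous_subspaceT.
move=> /compact_bounded[C [_ /(_ (C + 1))]]; rewrite ltrDl => /(_ ltr01) fC.
exists (Num.max (C + 1) 0) => x; rewrite le_max.
have [xM|xM] := leP (enorm x) M; last by rewrite (fM _ xM) normr0 lexx orbT.
by rewrite fC//; exists x => //=; rewrite subr0.
Qed.

Definition cube (M : R) : set V := [set x | forall i, `[- M, M]%classic (x 0 i)].

Lemma measurable_cube (M : R) : measurable (cube M).
Proof. by apply: (@measurable_box _ _ (fun=> `[- M, M]%classic)) => i; exact: measurable_itv. Qed.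

Lemma cube_lty (M : R) : (mu (cube M) < +oo)%E.
Proof.
rewrite (_ : mu (cube M) = \prod_(i < N) (fine (lebesgue_measure `[- M, M]%classic : \bar R))%:E)%E.
  by rewrite prodEFin ltry.
rewrite (@lebesgue_rV_prod _ _ (fun=> `[- M, M]%classic)); last by move=> i; exact: measurable_itv.
by apply: eq_bigr => i _; rewrite fineK// lebesgue_measure_itv/=; case: ifP.
Qed.

Lemma Cc_integrable f : Cc f -> mu.-integrable setT (EFin \o f).
Proof.
move=> Ccf; have [C fC] := Cc_bounded Ccf; move: Ccf => [cf [M fM]].
pose B := cube M; have mB := measurable_cube M; have muB := cube_lty M.
have -> : EFin \o f = (EFin \o f) \_ B.
  apply/funext => x; rewrite patchE; case: ifPn => //; rewrite notin_setE => xB /=.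
  rewrite fM// ltNge; apply/negP => xM; apply: xB => i /=.
  by rewrite in_itv/= -ler_norml (le_trans (coord_le_enorm x i)).
apply/(integrable_mkcond _ mB); apply: measurable_bounded_integrable => //.
- by apply: measurable_funTS; exact: continuous_measurable_rV.
- by exists C; split; [exact: num_real|move=> D CD x _ /=; rewrite (le_trans (fC x))// ltW].
Qed.

Lemma CcD f g : Cc f -> Cc g -> Cc (fun x => f x + g x).
Proof.
move=> [cf [M fM]] [cg [K gK]]; split; first exact: continuous_fD.
by exists (Num.max M K) => x; rewrite gt_max => /andP[h k]; rewrite fM// gK// addr0.
Qed.

Lemma CcMl f g : continuous f -> Cc g -> Cc (fun x => f x * g x).
Proof.
move=> cf [cg [K gK]]; split; first exact: continuous_fM.
by exists K => x h; rewrite gK// mulr0.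
Qed.

Lemma CcZ (c : R) g : Cc g -> Cc (fun x => c * g x).
Proof. by apply: CcMl; exact: continuous_fcst. Qed.

Lemma CcB f g : Cc f -> Cc g -> Cc (fun x => f x - g x).
Proof.
move=> [cf [M fM]] [cg [K gK]]; split; first exact: continuous_fB.
by exists (Num.max M K) => x; rewrite gt_max => /andP[h k]; rewrite fM// gK// subr0.
Qed.

Lemma Cc_sum (f : 'I_N -> V -> R) : (forall i, Cc (f i)) -> Cc (fun x => \sum_i f i x).
Proof.
move=> Cf; rewrite (_ : (fun x => _) = (fun x => \sum_(i <- index_enum 'I_N) f i x))//.
elim: (index_enum _) => [|i s IHs].
  rewrite (_ : (fun x => _) = (fun=> 0)); first by split; [exact: continuous_fcst|exists 0].
  by apply/funext => x; rewrite big_nil.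
rewrite (_ : (fun x => _) = (fun x => f i x + \sum_(i <- s) f i x)); first exact: CcD.
by apply/funext => x; rewrite big_cons.
Qed.

Lemma Cc_shift f a : Cc f -> Cc (fun x => f (x - a)).
Proof.
move=> [cf [M fM]]; split.
  have cs : continuous (fun x : V => x - a) by move=> x; apply: continuousB; [exact: cvg_id|exact: cst_continuous].
  by move=> x; apply: (@continuous_comp _ _ _ (fun x => x - a) f); [exact: cs|exact: cf].
exists (M + enorm a) => x xM; apply: fM; have := enormB x a.
by have := enormB x (- - a); rewrite opprK => h1 h2; lra.
Qed.

Local Notation "'Int' f" := (\int[mu]_x f x) (at level 10).

Lemma Int_shift f a : Cc f -> Int (fun x => f (x - a)) = Int f.
Proof.
move=> Cf; rewrite /Rintegral; congr fine.
have mf : measurable_fun setT (EFin \o f).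
  by apply/measurable_EFinP; apply: continuous_measurable_rV; exact: Cf.1.
rewrite -(@integral_pushforward _ _ _ _ R _ (measurable_shift (- a)) mu setT (EFin \o f))//.
  apply: eq_measure_integral; first exact: measurable_shift.
  by move=> mT A mA _; exact: (lebesgue_rV_shift (- a) mA).
exact: (Cc_integrable (Cc_shift a Cf)).
Qed.

(** By continuity [f] exceeds half of its value at [x] on a sup-norm ball, and that ball is a box of
    measure [(2 e)^N]. *)
Lemma Int_gt0 f x : Cc f -> (forall y, 0 <= f y) -> 0 < f x -> 0 < Int f.
Proof.
move=> Cf f0 fx.
have /nbhs_ballP[e /= e0 eA] : nbhs x [set y | f x / 2 < f y].
  apply: (@cvgr_gt _ _ (nbhs x) _ f (f x)); first exact: Cf.1.
  by rewrite ltr_pdivrMr//; lra.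
pose B := [set y : V | forall i, `](x 0 i - e), (x 0 i + e)[%classic (y 0 i)].
have mB : measurable B.
  apply: (@measurable_box _ _ (fun i => `](x 0 i - e), (x 0 i + e)[%classic)) => i; exact: measurable_itv.
have muB : mu B = (\prod_(i < N) (2 * e))%:E.
  rewrite (@lebesgue_rV_prod _ _ (fun i => `](x 0 i - e), (x 0 i + e)[%classic)); last by move=> i; exact: measurable_itv.
  rewrite -prodEFin; apply: eq_bigr => i _; rewrite lebesgue_measure_itv/= lte_fin.
  by rewrite ifT -?EFinB; [congr EFin; ring|lra].
have Bf y : B y -> f x / 2 <= f y.
  move=> By; apply: ltW; apply: eA; split => // i j; rewrite ord1.
  by have := By j; rewrite /= in_itv/= /ball/= ltr_distlC.
apply: (@lt_le_trans _ _ (\int[mu]_(y in B) (f x / 2))).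
  rewrite Rintegral_cst// mulr_gt0 ?divr_gt0//.
  rewrite (_ : fine _ = fine (\prod_(i < N) (2 * e))%:E); last by congr fine; exact: muB.
  by apply: prodr_gt0 => i _; rewrite mulr_gt0.
rewrite Rintegral_mkcond; apply: le_Rintegral => //.
- rewrite (_ : _ \o _ = (fun=> (f x / 2)%:E) \_ B).
    apply/(integrable_mkcond _ mB); apply: (@measurable_bounded_integrable _ _ _ _ (fun=> f x / 2)) => //.
      by have := ltry (\prod_(i < N) (2 * e)); rewrite -muB.
    by exists `|f x / 2|; split; [exact: num_real|move=> C h y _; exact: ltW].
  by rewrite restrict_EFin.
- exact: Cc_integrable.
- move=> y _; rewrite patchE; case: ifPn => //; rewrite inE; exact: Bf.
Qed.

Lemma is_derive_along f (f' : V -> R) (v x : V) (t : R) : (forall x, is_derive x v f (f' x)) ->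
  is_derive t 1 (fun h : R => f (h *: v + x)) (f' (t *: v + x)).
Proof.
move=> /(_ (t *: v + x)) /is_derive_line df; apply/is_derive_line.
rewrite (_ : (fun h : R => f ((h%:A + t) *: v + x)) = (fun h : R => f (h *: v + (t *: v + x))))//.
by apply/funext => h; rewrite scalerDl addrA [h%:A]mulr1.
Qed.

Lemma derive_bound f f' (v : V) (C : R) : (forall x, is_derive x v f (f' x)) ->
  (forall x, `|f' x| <= C) -> forall x (t : R), 0 <= t -> `|f (t *: v + x) - f x| <= C * t.
Proof.
move=> df fC x t t0.
have dl s := @is_derive_along f f' v x s df.
have dC (s : R) : is_derive s 1 (fun s : R => C * s) C.
  by rewrite -[X in is_derive _ _ _ X]mulr1; apply: is_derive_fZ; exact: is_derive_id.
have := @norm_le_of_derive R (fun s => f (s *: v + x)) (fun s => f' (s *: v + x)) (fun s => C * s) (fun=> C)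
  0 t t0.
rewrite /= scale0r add0r mulr0 subr0; apply=> //.
- by apply: within_continuous => s; exact: is_derive_cont (dl s).
- by apply: within_continuous => s; exact: is_derive_cont (dC s).
Qed.

(* The integral of the difference quotients of f vanishes by translation
   invariance. *)
Lemma Int_derivative f f' (i : 'I_N) : Cc f -> Cc f' ->
  (forall x, is_derive x (delta_mx 0 i : V) f (f' x)) -> Int f' = 0.
Proof.
move=> Cf Cf' df.
have [C fC] := Cc_bounded Cf'; have [M fM] := Cf.2.
pose e := delta_mx 0 i : V.
have ne : enorm e = 1.
  rewrite enormE /sqn (bigD1 i)//= big1 ?addr0 => [|j ji].
    by rewrite mxE !eqxx expr1n sqrtr1.
  by rewrite mxE/= (negbTE ji) expr0n.
pose h (n : nat) : R := n.+1%:R^-1.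
have h0 n : 0 < h n by rewrite invr_gt0.
have h1 n : h n <= 1 by rewrite invf_le1// ler1n.
pose d n x := (h n)^-1 * (f (h n *: e + x) - f x).
have shE (n : nat) : (fun x => f (h n *: e + x)) = (fun x => f (x - - (h n *: e))).
  by apply/funext => x; rewrite opprK addrC.
have Cs n : Cc (fun x => f (h n *: e + x)) by rewrite shE; exact: Cc_shift.
have Cd n : Cc (d n) by apply: CcZ; exact: CcB.
have d0 n : Int (d n) = 0.
  rewrite RintegralZl//; last by apply: Cc_integrable; exact: CcB.
  rewrite RintegralB//; [|exact: Cc_integrable|exact: Cc_integrable].
  by rewrite shE Int_shift// subrr mulr0.
(* Steps of length at most 1 leave all difference quotients supported in this cube, where a bound of
   [f'] dominates them. *)
pose B := cube (M + 1); have mB := measurable_cube (M + 1); have muB := cube_lty (M + 1).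
pose G : V -> \bar R := (fun=> C%:E) \_ B.
have iG : mu.-integrable setT G.
  apply/(integrable_mkcond _ mB).
  apply: (@measurable_bounded_integrable _ _ _ _ (fun=> C)) => //.
  by exists `|C|; split; [exact: num_real|move=> D h' y _; exact: ltW].
have dG n x : (`|(d n x)%:E| <= G x)%E.
  rewrite /G patchE; case: ifPn => [_|]; last first.
    rewrite notin_setE => xB; have [j xj] : exists j, M + 1 < `|x 0 j|.
      apply: contrapT => /forallNP H; apply: xB => j /=.
      by rewrite in_itv/= -ler_norml leNgt; apply/negP.
    have xM : M + 1 < enorm x by apply: lt_le_trans xj (coord_le_enorm x j).
    rewrite lee_fin /d (fM x) ?(fM (h n *: e + x)) ?subrr ?mulr0 ?normr0//.
      have := enormB x (- (h n *: e)); rewrite enormN opprK enormZ ne mulr1 gtr0_norm// [x + _]addrC.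
      by have := h1 n; lra.
    by lra.
  rewrite lee_fin /d normrM gtr0_norm ?invr_gt0// mulrC ler_pdivrMr//.
  exact: (derive_bound df fC x (ltW (h0 n))).
have dl x : (fun n => (d n x)%:E) @ \oo --> (f' x)%:E.
  apply/cvg_EFin; first exact: nearW.
  have [+ <-] := df x; rewrite /derivable => /cvg_ex[/= l fl].
  have la : l = 'D_(delta_mx 0 i) f x by apply/esym/cvg_lim.
  rewrite -la; apply/cvgrPdist_lt => eps eps0.
  move/cvgrPdist_lt : fl => /(_ _ eps0)[r /= r0 fe].
  have : \forall n \near \oo, `|@harmonic R n| < r.
    exact: (cvgr0_norm_lt _ (@cvg_harmonic R) r r0).
  apply: filterS => n /= nr; rewrite /d; apply: fe.
    by rewrite /= sub0r normrN.
  by rewrite gt_eqF.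
have : (fun n => \int[mu]_(x in setT) (EFin \o d n) x)%E @ \oo --> (\int[mu]_(x in setT) (EFin \o f') x)%E.
  have [] // := @dominated_convergence _ _ R mu setT measurableT (fun n => EFin \o d n) (EFin \o f') G.
  - by move=> n; apply/measurable_EFinP; apply: continuous_measurable_rV; exact: (Cd n).1.
  - by apply/measurable_EFinP; apply: continuous_measurable_rV; exact: Cf'.1.
  - by apply: aeW => x _; exact: dl.
  - by apply: aeW => x n _; exact: dG.
rewrite (_ : (fun n => _) = fun=> 0%E).
  by move=> /cvg_lim; rewrite lim_cst// => /(_ (@ereal_hausdorff R)) E; rewrite /Rintegral -E.
apply/funext => n; rewrite -[LHS]fineK; last exact: integrable_fin_num (Cc_integrable (Cd n)).
by have := d0 n; rewrite /Rintegral => ->.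
Qed.

End compactly_supported.

(** * Lower bound for the concentric ring *)

Section extension.
Context {R : realType}.
Implicit Types (f : R -> R) (a b c d t : R).

Lemma clamp_continuous c d : c <= d -> continuous (fun t => Num.max c (Num.min t d)).
Proof.
move=> cd t; apply/cvgrPdist_lt => e e0; near=> t'.
apply: le_lt_trans (clamp_lip t t' cd) _; near: t'.
by apply: (@cvgr_dist_lt _ _ _ (nbhs t) _ id); first exact: cvg_id.
Unshelve. all: by end_near. Qed.

(** The Riccati solution blows up at the ends of its interval, while the divergence theorem is used
    for fields on the whole space. Freezing [f'] outside [[c, d]] and integrating provides the
    extension. *)
Lemma C1_extension f (f' : R -> R) a b c d : a < c -> c <= d -> d < b ->
  (forall t : R, a < t < b -> is_derive t 1 f (f' t)) ->
  (forall t, a < t < b -> {for t, continuous f'}) ->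
  exists G G' : R -> R, [/\ forall t : R, is_derive t 1 G (G' t), continuous G' &
    forall t, c <= t <= d -> G t = f t /\ G' t = f' t].
Proof.
move=> ac cd db df cf'.
pose k t := Num.max c (Num.min t d).
have k1 t : c <= k t by rewrite le_max lexx.
have k2 t : k t <= d by rewrite ge_max cd/= ge_min lexx orbT.
have kid t : c <= t <= d -> k t = t.
  by move=> /andP[h1 h2]; rewrite /k min_l// max_r.
have kin t : a < k t < b by rewrite (lt_le_trans ac)//= (le_lt_trans (k2 t)).
have ch : continuous (fun t => f' (k t)).
  move=> t; apply: (@continuous_comp _ _ _ k f'); last exact: cf'.
  exact: clamp_continuous.
have [F [dF F0]] : exists F, (forall t : R, is_derive t 1 F (f' (k t) - f' c)) /\
    (forall t, t <= c -> F t = 0).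
  apply: antiderivative_vanishing.
    by apply: continuous_fB => //; exact: continuous_fcst.
  by move=> t tc; rewrite /k min_l ?(le_trans tc)// max_l// subrr.
pose G (t : R) := F t + (f' c * t + (f c - f' c * c)).
have dG (t : R) : is_derive t 1 G (f' (k t)).
  have d1 : is_derive t 1 (fun t : R => f' c * t + (f c - f' c * c)) (f' c).
    apply: is_derive_fDc; rewrite -[X in is_derive _ _ _ X]mulr1.
    exact: is_derive_fZ (is_derive_id _ _).
  by have := is_derive_fD (dF t) d1; rewrite subrK.
exists G, (fun t => f' (k t)).
split => // t /[dup] tcd /andP[h1 h2]; split; last by rewrite kid.
have Gc : G c = f c by rewrite /G (F0 c (lexx c)); ring.
pose H t := G t - f t; suff : H t = H c by rewrite /H Gc subrr => /eqP; rewrite subr_eq0 => /eqP.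
apply: (@is_derive0_cst R H c t h1).
  apply: continuous_in_subspaceT => x; rewrite inE/= in_itv/= => /andP[x1 x2].
  apply: cvgB; first exact: is_derive_cont (dG x).
  by apply: is_derive_cont (df x _); rewrite (lt_le_trans ac)//= (le_lt_trans x2)//; lra.
move=> x /andP[x1 x2]; have xin : a < x < b by rewrite (lt_trans ac)//=; lra.
by have := is_derive_fB (dG x) (df x xin); rewrite kid ?subrr//; lra.
Qed.

End extension.

Section continuous0.
Context {R : realType} {N : nat}.
Local Notation V := 'rV[R]_N.

Lemma sqn_continuous0 : continuous (fun x : V => sqn x).
Proof. by have := @sqn_continuous R N 0; under eq_fun do rewrite subr0. Qed.

Lemma enorm_continuous0 : continuous (fun x : V => enorm x).
Proof. by have := @enorm_continuous R N 0; under eq_fun do rewrite subr0. Qed.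

End continuous0.

Section radial_flux.
Context {R : realType} {N : nat}.
Local Notation V := 'rV[R]_N.
Local Notation mu := (lebesgue_rV N).
Implicit Types (f g h : V -> R) (x a : V).
Local Notation "'Int' f" := (\int[mu]_x f x) (at level 10).

Lemma Cc_norm_powR f (p : R) : 0 < p -> Cc f -> Cc (fun x => `|f x| `^ p).
Proof.
move=> p0 [cf [M fM]]; split; first exact: (continuous_fcomp cf (powR_norm_cont p0)).
by exists M => x /fM ->; rewrite normr0 powR0// gt_eqF.
Qed.

Lemma Cc_enorm_powR (h : V -> V) (p : R) : 0 < p -> (forall i, Cc (fun x => h x 0 i)) ->
  Cc (fun x => enorm (h x) `^ p).
Proof.
move=> p0 Ch; have Cs : Cc (fun x => \sum_i (h x 0 i * h x 0 i)).
  by apply: Cc_sum => i; apply: CcMl => //; exact: (Ch i).1.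
have hE x : enorm (h x) = Num.sqrt (\sum_i (h x 0 i * h x 0 i)).
  by rewrite enormE; congr Num.sqrt; apply: eq_bigr => i _; rewrite expr2.
split.
  have c1 := continuous_fcomp Cs.1 (@sqrt_continuous R).
  have := continuous_fcomp c1 (powR_norm_cont p0).
  by under eq_fun do rewrite -hE ger0_norm ?enorm_ge0//.
have [M hM] := Cs.2; exists M => x /hM h0.
by rewrite hE h0 sqrtr0 powR0// gt_eqF.
Qed.

Lemma Int_sum (f : 'I_N -> V -> R) : (forall i, Cc (f i)) ->
  Int (fun x => \sum_i f i x) = \sum_i Int (f i).
Proof.
move=> Cf; rewrite (_ : (fun x => _) = (fun x => \sum_(i <- index_enum 'I_N) f i x))//.
elim: (index_enum _) => [|i s IHs].
  rewrite big_nil (_ : (fun x => _) = (fun=> 0)) ?Rintegral_cst ?mul0r//.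
  by apply/funext => x; rewrite big_nil.
rewrite big_cons -IHs -RintegralD//; try exact: Cc_integrable.
  by apply: eq_Rintegral => x _; rewrite big_cons.
apply: Cc_integrable; elim: s {IHs} => [|j s IHs].
  rewrite (_ : (fun x => _) = (fun=> 0)); first by split; [exact: continuous_fcst|exists 0].
  by apply/funext => x; rewrite big_nil.
rewrite (_ : (fun x => _) = (fun x => f j x + \sum_(i <- s) f i x)); first exact: CcD.
by apply/funext => x; rewrite big_cons.
Qed.

(** The divergence of [f G(|x|^2) x] has integral 0, and [G(|x|^2) x] has divergence
    [N G + 2 |x|^2 G']. *)
Lemma radial_flux (G G' : R -> R) f (f' : 'I_N -> V -> R) :
  (forall t : R, is_derive t 1 G (G' t)) -> continuous G' -> Cc f -> (forall i, Cc (f' i)) ->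
  (forall i x, is_derive x (delta_mx 0 i : V) f (f' i x)) ->
  Int (fun x => G (sqn x) * \sum_i f' i x * x 0 i) =
  Int (fun x => f x * - (N%:R * G (sqn x) + 2 * sqn x * G' (sqn x))).
Proof.
move=> dG cG' Cf Cf' df.
have cs := @sqn_continuous0 R N.
have cG0 : continuous G by move=> t; exact: is_derive_cont (dG t).
have cG : continuous (fun x : V => G (sqn x)) := continuous_fcomp cs cG0.
have cG1 : continuous (fun x : V => G' (sqn x)) := continuous_fcomp cs cG'.
have cc i : continuous (fun x : V => x 0 i) by exact: coord_continuous.
have ds x i : is_derive x (delta_mx 0 i : V) (fun y => sqn y) (2 * x 0 i).
  by have := is_derive_sqn x 0 i; rewrite subr0; under eq_fun do rewrite subr0.
pose F i x := (f' i x * G (sqn x) + f x * (G' (sqn x) * (2 * x 0 i))) * x 0 i + f x * G (sqn x).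
have dF i x : is_derive x (delta_mx 0 i : V) (fun x => f x * G (sqn x) * x 0 i) (F i x).
  have d1 := is_derive_fM (df i x) (is_derive_fcomp (dG _) (ds x i)).
  have := is_derive_fM d1 (is_derive_coord x (delta_mx 0 i) i).
  by rewrite mxE !eqxx mulr1.
have cM g : continuous g -> Cc (fun x => f x * g x).
  by move=> cg; under eq_fun do rewrite mulrC; exact: CcMl.
have cM' g i : continuous g -> Cc (fun x => f' i x * g x).
  by move=> cg; under eq_fun do rewrite mulrC; exact: CcMl.
have CF i : Cc (F i).
  rewrite (_ : F i = fun x => f' i x * (G (sqn x) * x 0 i) +
     f x * (2 * (G' (sqn x) * (x 0 i * x 0 i)) + G (sqn x))); last first.
    by apply/funext => x; rewrite /F; ring.
  apply: CcD; first by apply: cM'; exact: continuous_fM.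
  apply: cM; apply: continuous_fD => //; apply: continuous_fM; first exact: continuous_fcst.
  by do 2 apply: continuous_fM => //.
have F0 i : Int (F i) = 0.
  apply: (Int_derivative _ (CF i) (dF i)).
  rewrite (_ : (fun x => _) = fun x => f x * (G (sqn x) * x 0 i)).
    by apply: cM; exact: continuous_fM.
  by apply/funext => x; rewrite mulrA.
have C1 : Cc (fun x => G (sqn x) * \sum_i f' i x * x 0 i).
  by apply: CcMl => //; apply: Cc_sum => i; exact: cM'.
have C2 : Cc (fun x => f x * - (N%:R * G (sqn x) + 2 * sqn x * G' (sqn x))).
  apply: cM; under eq_fun do rewrite -mulN1r.
  apply: continuous_fM; first exact: continuous_fcst.
  apply: continuous_fD; first by apply: continuous_fM => //; exact: continuous_fcst.
  by apply: continuous_fM => //; apply: continuous_fM => //; exact: continuous_fcst.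
apply/eqP; rewrite -subr_eq0 -RintegralB//; [|exact: Cc_integrable|exact: Cc_integrable].
apply/eqP; transitivity (Int (fun x => \sum_i F i x)); last by rewrite Int_sum// big1.
apply: eq_Rintegral => x _.
rewrite /F big_split/= sumr_const card_ord -[_ *+ N]mulr_natr.
have -> : \sum_i (f' i x * G (sqn x) + f x * (G' (sqn x) * (2 * x 0 i))) * x 0 i =
    \sum_i (G (sqn x) * (f' i x * x 0 i) + (2 * f x * G' (sqn x)) * (x 0 i ^+ 2)).
  by apply: eq_bigr => i _; ring.
by rewrite big_split/= -!mulr_sumr -/(sqn x); ring.
Qed.

End radial_flux.


(** Replaces Minkowski's inequality without taking roots: [(1 - t)^(1-p)] tends to 1 with [t], so
    the constant in front of the main term is as close to 1 as desired. *)
Lemma le_integral_powRD {R : realType} (d : measure_display) (T : measurableType d) (nu : {measure set T -> \bar R}) (D : set T)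
    (a b c : T -> R) (p t : R) :
  measurable D -> measurable_fun D a -> measurable_fun D b -> measurable_fun D c ->
  1 <= p -> 0 < t < 1 -> (forall x : T, D x -> [/\ 0 <= a x, 0 <= b x, 0 <= c x & a x <= b x + c x]) ->
  (\int[nu]_(x in D) (a x `^ p)%:E <= ((1 - t) `^ (1 - p))%:E * \int[nu]_(x in D) (b x `^ p)%:E
     + (t `^ (1 - p))%:E * \int[nu]_(x in D) (c x `^ p)%:E)%E.
Proof.
move=> mD ma mb mc p1 t01 abc; have p0 : 0 <= p by lra.
have mp (h : T -> R) : measurable_fun D h -> measurable_fun D (fun x => (h x `^ p)%:E).
  by move=> mh; apply/measurable_EFinP; exact: (measurableT_comp (measurable_powR p) mh).
have mZ (k : R) (h : T -> R) : measurable_fun D h -> measurable_fun D (fun x => (k%:E * (h x `^ p)%:E)%E).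
  move=> mh; apply/measurable_EFinP; apply: measurable_funM => //.
  exact: (measurableT_comp (measurable_powR p) mh).
rewrite -!ge0_integralZl_EFin ?powR_ge0//; try exact: mp; try by move=> x _; rewrite lee_fin powR_ge0.
rewrite -ge0_integralD//; try exact: mZ; try by move=> x _; rewrite lee_fin mulr_ge0 ?powR_ge0.
apply: ge0_le_integral => //; first by move=> x _; rewrite lee_fin powR_ge0.
- exact: mp.
- by apply: emeasurable_funD; exact: mZ.
move=> x /abc[a0 b0 c0 abcx]; rewrite -!EFinM -EFinD lee_fin.
apply: le_trans (powRD_le p1 b0 c0 t01).
by rewrite ge0_ler_powR ?nnegrE ?addr_ge0.
Qed.

Lemma le_fineD {R : realType} (a b e k k' : R) (A B C : \bar R) :
  a%:E = A -> b%:E = B -> (C <= e%:E)%E -> 0 < k' ->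
  (A <= k%:E * B + k'%:E * C)%E -> a <= k * b + k' * e.
Proof.
move=> <- <- Ce k0 /le_trans H; rewrite -lee_fin EFinD !EFinM; apply: H.
by rewrite leeD2l// lee_pmul2l.
Qed.

Section lower_bound.
Context {R : realType} {N : nat}.
Local Notation V := 'rV[R]_N.
Local Notation mu := (lebesgue_rV N).
Implicit Types (f g h phi : V -> R) (x a : V) (p r t : R) (Omega : set V).
Local Notation "'Int' f" := (\int[mu]_x f x) (at level 10).

Lemma compact_ubound (K : set V) f : compact K -> continuous f ->
  exists M, forall x, K x -> f x <= M.
Proof.
move=> cK cf; have [->|/set0P K0] := eqVneq K set0; first by exists 0.
have [c _ cM] := compact_EVT_max K0 cK (continuous_subspaceT cf).
by exists (f c) => x Kx; apply: cM; rewrite inE.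
Qed.

Lemma partial_eq0 phi i x : ~ closure [set x | phi x != 0] x -> partial i phi x = 0.
Proof.
move=> xK; have : nbhs x (~` closure [set x | phi x != 0]).
  by apply: open_nbhs_nbhs; split => //; apply: closed_openC; exact: closed_closure.
move=> x0; have x0' : \forall y \near x, (fun=> 0) y = phi y.
  apply: filterS x0 => y yK; apply/esym/eqP; apply: contrapT => /negP y0.
  by apply: yK; exact: subset_closure.
rewrite /partial -(near_eq_derive (delta_mx 0 i : V) x0').
by have [_ ->] := is_derive_fcst 0 x (delta_mx 0 i : V).
Qed.

Lemma test_function_derive Omega phi : test_function Omega phi ->
  [/\ Cc phi, forall i, Cc (partial i phi) &
      forall i x, is_derive x (delta_mx 0 i : V) phi (partial i phi x)].
Proof.
move=> [sphi cK _]; have cphi : continuous phi := (sphi [::]).1.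
have [M' KM'] := compact_ubound cK (@enorm_continuous R N 0).
have {}KM' x : closure [set x | phi x != 0] x -> enorm x <= M' by move=> /KM'; rewrite subr0.
split.
- split => //; exists M' => x xM; apply/eqP; apply: contrapT => /negP x0.
  have xK : closure [set x | phi x != 0] x by exact: subset_closure.
  by have := KM' x xK; rewrite leNgt xM.
- move=> i; split; first exact: (sphi [:: i]).1.
  exists M' => x xM; apply: partial_eq0 => /KM'; by rewrite leNgt xM.
- by move=> i x; apply: DeriveDef => //; exact: (sphi [::]).2.
Qed.

(** The squared norm attains its extrema on the compact support. The smaller closed shell so
    obtained is where the Riccati solution can be used and extended. *)
Lemma test_function_shell Omega phi (s0 s1 : R) : s0 < s1 -> test_function Omega phi ->
  (forall x, Omega x -> s0 < sqn x < s1) ->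
  exists c d, [/\ s0 < c, c <= d, d < s1 & forall x, phi x != 0 -> c <= sqn x <= d].
Proof.
move=> s01 [_ cK KO] Os; set K := closure _ in cK KO.
have nK x : phi x != 0 -> K x by move=> x0; exact: subset_closure.
have cs := @sqn_continuous0 R N.
have [K0|/set0P K0] := eqVneq K set0.
  exists ((s0 + s1) / 2), ((s0 + s1) / 2); split; [lra|by []|lra|].
  by move=> x /nK; rewrite K0.
have [c cK' cm] := compact_EVT_min K0 cK (continuous_subspaceT cs).
have [d dK dM] := compact_EVT_max K0 cK (continuous_subspaceT cs).
exists (sqn c), (sqn d); split.
- by have := cK'; rewrite inE => /KO/Os/andP[].
- by apply: cm.
- by have := dK; rewrite inE => /KO/Os/andP[].
- by move=> x /nK Kx; rewrite cm ?dM ?inE.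
Qed.

Lemma test_function_notin Omega phi x : test_function Omega phi -> ~ Omega x ->
  phi x = 0 /\ forall i, partial i phi x = 0.
Proof.
move=> [sphi cK KO] Ox; have xK : ~ closure [set x | phi x != 0] x by move=> /KO.
split; first by apply/eqP; apply: contrapT => /negP x0; apply: xK; exact: subset_closure.
by move=> i; exact: partial_eq0.
Qed.

Lemma powR_continuous_gt0 (r t : R) : 0 < t -> {for t, continuous (fun t : R => t `^ r)}.
Proof.
move=> t0; have E : \forall s \near t, s `^ r = expR (r * ln s).
  near=> s; rewrite /powR gt_eqF//; near: s; exact: near_gtr.
apply: (@cvg_trans _ ((fun s => expR (r * ln s)) @ t)).
  by apply: near_eq_cvg; apply: filterS E => s ->.
rewrite (nbhs_singleton E).
apply: (@continuous_comp _ _ _ (fun s => r * ln s) expR); last exact: continuous_expR.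
by apply: cvgM; [exact: cvg_cst|exact: continuous_ln].
Unshelve. all: by end_near. Qed.

Lemma riccati_continuous (n p l q t a : R) (g : R -> R) : 0 < t -> 0 < q -> is_derive t 1 g a ->
  {for t, continuous (fun t => - (n / (2 * t) * g t + l / (2 * t) +
    (p - 1) * (t `^ (q / 2) / (2 * t)) * `|g t| `^ q))}.
Proof.
move=> t0 q0 dg; have cg := is_derive_cont dg.
have cV : {for t, continuous (fun t : R => (2 * t)^-1)}.
  by apply: cvgV; [rewrite gt_eqF// mulr_gt0|apply: cvgM; [exact: cvg_cst|exact: cvg_id]].
have cq : {for t, continuous (fun t => `|g t| `^ q)}.
  exact: (@continuous_comp _ _ _ g (fun u : R => `|u| `^ q) t cg (@powR_norm_cont R q q0 (g t))).
apply: cvgN; apply: cvgD; last first.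
  apply: cvgM => //; apply: cvgM; first exact: cvg_cst.
  apply: cvgM => //; exact: powR_continuous_gt0.
apply: cvgD; last by apply: cvgM => //; exact: cvg_cst.
by apply: cvgM => //; apply: cvgM => //; exact: cvg_cst.
Qed.

Lemma test_function_lower_bound (p s0 s1 l sg : R) (g P : R -> R) Omega phi :
  1 < p -> 0 < s0 -> s0 < s1 -> radial_system N%:R p s0 s1 l g P sg ->
  (forall x, Omega x -> s0 < sqn x < s1) -> test_function Omega phi ->
  l * Int (fun x => `|phi x| `^ p) <= Int (fun x => enorm (gradient phi x) `^ p).
Proof.
move=> p1 s00 s01 [l0 sgi _ dg _] Os tphi.
have p0 : 0 < p by lra.
have pm0 : 0 < p - 1 by lra.
set q := p / (p - 1) in dg; have q0 : 0 < q by rewrite divr_gt0.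
have [c [d [s0c cd ds1 phis]]] := test_function_shell s01 tphi Os.
have [|G [G' [dG cG' GE]]] := C1_extension s0c cd ds1 dg.
  move=> t ti; have t0 : 0 < t by rewrite (lt_trans s00)//; case/andP: ti.
  exact: riccati_continuous (dg t ti).
have [Cphi Cpart dphi] := test_function_derive tphi.
pose f x := `|phi x| `^ p.
pose f' i x := p * spowR (p - 1) (phi x) * partial i phi x.
have Cf : Cc f by exact: Cc_norm_powR.
have Cf' i : Cc (f' i).
  apply: CcMl => //; apply: continuous_fM; first exact: continuous_fcst.
  exact: (continuous_fcomp Cphi.1 (spowR_cont pm0)).
have df i x : is_derive x (delta_mx 0 i : V) f (f' i x).
  exact: is_derive_fcomp (is_derive_norm_powR _ p1) (dphi i x).
have cs := @sqn_continuous0 R N; have ce := @enorm_continuous0 R N.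
have cG0 : continuous G by move=> t; exact: is_derive_cont (dG t).
have cG : continuous (fun x : V => G (sqn x)) := continuous_fcomp cs cG0.
pose X x := enorm x * G (sqn x).
have cX : continuous (fun x => `|X x| `^ q).
  have cX0 : continuous X by exact: continuous_fM.
  exact: (continuous_fcomp cX0 (powR_norm_cont q0)).
have C1 : Cc (fun x => (p - 1) * `|X x| `^ q * f x).
  by apply: CcMl => //; apply: continuous_fM => //; exact: continuous_fcst.
have Cg : Cc (fun x => enorm (gradient phi x) `^ p).
  apply: Cc_enorm_powR => // i.
  by rewrite (_ : (fun x => _) = partial i phi)//; apply/funext => x; rewrite mxE.
have flux := radial_flux dG cG' Cf Cf' df.
(* The Riccati equation, multiplied by [|phi|^p]. Where [phi] vanishes both sides are 0, so the
   values of the extension [G] off the support are of no consequence. *)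
have E x : f x * - (N%:R * G (sqn x) + 2 * sqn x * G' (sqn x)) = l * f x + (p - 1) * `|X x| `^ q * f x.
  have [px|px] := eqVneq (phi x) 0.
    by rewrite /f px normr0 powR0 ?mul0r ?mulr0 ?addr0// gt_eqF.
  have sx := phis x px; have [-> ->] := GE _ sx.
  have x0 : 0 < sqn x by move/andP: sx => [h _]; rewrite (lt_le_trans _ h)// (lt_trans s00).
  have -> : `|X x| `^ q = sqn x `^ (q / 2) * `|g (sqn x)| `^ q.
    rewrite /X (GE _ sx).1 normrM powRM ?normr_ge0//; congr (_ * _).
    rewrite ger0_norm ?enorm_ge0// -enorm_sqr -powR_mulrn ?enorm_ge0// -powRrM.
    by congr (_ `^ _); field.
  by field; rewrite gt_eqF.
(* Young's inequality with exponents [p] and [q], scaled by [p]: since [p / q = p - 1], the last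
   term is exactly the one produced by the Riccati equation, and the two will cancel. *)
have le1 x : G (sqn x) * \sum_i f' i x * x 0 i <=
    enorm (gradient phi x) `^ p + (p - 1) * `|X x| `^ q * f x.
  pose a := p * spowR (p - 1) (phi x) * G (sqn x).
  have -> : G (sqn x) * \sum_i f' i x * x 0 i = \sum_i (gradient phi x) 0 i * (a *: x) 0 i.
    by rewrite mulr_sumr; apply: eq_bigr => i _; rewrite !mxE /f' /a; ring.
  apply: le_trans (cauchy_schwarz _ _) _; rewrite enormZ.
  have -> : enorm (gradient phi x) * (`|a| * enorm x) =
      p * (enorm (gradient phi x) * (`|phi x| `^ (p - 1) * `|X x|)).
    rewrite /a /X (normrM (p * _)) (normrM p) (normrM (enorm x)) norm_spowR// (gtr0_norm p0).
    by rewrite (ger0_norm (enorm_ge0 x)); ring.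
  have Y : enorm (gradient phi x) * (`|phi x| `^ (p - 1) * `|X x|) <=
      enorm (gradient phi x) `^ p / p + (`|phi x| `^ (p - 1) * `|X x|) `^ q / q.
    apply: conjugate_powR => //; rewrite ?enorm_ge0 ?mulr_ge0 ?powR_ge0//.
    by rewrite /q; field; rewrite !gt_eqF.
  apply: le_trans (ler_wpM2l (ltW p0) Y) _.
  rewrite powRM ?powR_ge0// -powRrM (_ : (p - 1) * q = p); last by rewrite /q; field; rewrite gt_eqF.
  rewrite -/(f x) le_eqVlt; apply/orP; left; apply/eqP.
  by rewrite /q; field; rewrite !gt_eqF.
have I1 := Cc_integrable (CcZ l Cf).
have I2 := Cc_integrable C1.
have I3 := Cc_integrable Cg.
have : Int (fun x => l * f x) + Int (fun x => (p - 1) * `|X x| `^ q * f x) <=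
    Int (fun x => enorm (gradient phi x) `^ p) + Int (fun x => (p - 1) * `|X x| `^ q * f x).
  rewrite -RintegralD// -RintegralD//.
  rewrite (_ : Int (fun x => l * f x + _) = Int (fun x => f x * - (N%:R * G (sqn x) + 2 * sqn x * G' (sqn x)))); last first.
    by apply: eq_Rintegral => x _; rewrite E.
  rewrite -flux.
  apply: le_Rintegral => //.
  - apply: Cc_integrable; apply: CcMl => //; apply: Cc_sum => i.
    by under eq_fun do rewrite mulrC; apply: CcMl => //; exact: coord_continuous.
  - by apply: Cc_integrable; exact: CcD.
rewrite lerD2r RintegralZl//; exact: Cc_integrable.
Qed.

Lemma Rintegral_test Omega f : measurable Omega -> (forall x, ~ Omega x -> f x = 0) ->
  \int[mu]_(x in Omega) f x = Int f.
Proof.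
move=> mO f0; rewrite Rintegral_mkcond; apply: eq_Rintegral => x _.
by rewrite patchE; case: ifPn => //; rewrite notin_setE => /f0.
Qed.

Lemma EFin_Int_test Omega f : measurable Omega -> Cc f -> (forall x, ~ Omega x -> f x = 0) ->
  (Int f)%:E = (\int[mu]_(x in Omega) (f x)%:E)%E.
Proof.
move=> mO Cf f0; rewrite -(Rintegral_test mO f0) /Rintegral fineK//.
apply: integrable_fin_num => //; apply: (@integrableS _ _ _ mu setT) => //.
exact: Cc_integrable.
Qed.

Lemma measurable_enorm (D : set V) (h : V -> V) :
  (forall i, measurable_fun D (fun x => h x 0 i)) -> measurable_fun D (fun x => enorm (h x)).
Proof.
move=> mh; apply: (measurableT_comp (continuous_measurable_fun (@sqrt_continuous R))).
by apply: measurable_sum => i; exact: measurable_funX.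
Qed.

Lemma integral_norm_powR_eq0 Omega (p : R) f : measurable Omega -> 0 < p -> measurable_fun Omega f ->
  (\int[mu]_(x in Omega) (`|f x| `^ p)%:E)%E = 0%E <-> {ae mu, forall x, Omega x -> f x = 0}.
Proof.
move=> mO p0 mf; have mfp : measurable_fun Omega (fun x => (`|f x| `^ p)%:E).
  apply/measurable_EFinP; apply: (measurableT_comp (measurable_powR p)).
  exact: measurableT_comp.
have := @ae_eq_integral_abs _ _ R mu _ mO _ mfp.
under eq_integral do rewrite /= ger0_norm ?powR_ge0//.
move=> ->; split; apply: filterS => x /= /[apply].
  by case=> /eqP; rewrite powR_eq0 normr_eq0 => /andP[/eqP].
by move=> ->; rewrite normr0 powR0// gt_eqF.
Qed.

(** Extends the inequality from test functions to their closure. The norms of [u] and its gradient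
    are compared with those of an approximant at the price of a factor close to 1 and an error; if
    the inequality failed, [t] would be fixed first to control the factor, then [e] to control the
    error. *)
Lemma eigenvalue_lower_bound (p l : R) Omega : 1 < p -> 0 < l -> measurable Omega ->
  (forall phi, test_function Omega phi ->
    l * Int (fun x => `|phi x| `^ p) <= Int (fun x => enorm (gradient phi x) `^ p)) ->
  (l%:E <= lambda1 p Omega)%E.
Proof.
move=> p1 l0 mO H; apply: le_ereal_inf_tmp => _ [u [g [[[[mu_ Iu] [mg Ig] _] approx] u0 ->]]].
have p0 : 0 < p by lra.
set A := \int[mu]_(x in Omega) _; set B := \int[mu]_(x in Omega) _.
have AE : A%:E = (\int[mu]_(x in Omega) (enorm (g x) `^ p)%:E)%E.
  by rewrite /A /Rintegral fineK// ge0_fin_numE// integral_ge0// => x _; rewrite lee_fin powR_ge0.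
have BE : B%:E = (\int[mu]_(x in Omega) (`|u x| `^ p)%:E)%E.
  by rewrite /B /Rintegral fineK// ge0_fin_numE// integral_ge0// => x _; rewrite lee_fin powR_ge0.
have A0 : 0 <= A by apply: Rintegral_ge0 => x _; exact: powR_ge0.
have B0 : 0 < B.
  rewrite lt_neqAle eq_sym Rintegral_ge0 ?andbT; last by move=> x _; exact: powR_ge0.
  apply/negP => /eqP B0; apply: u0.
  by apply/(integral_norm_powR_eq0 mO p0 mu_); rewrite -BE B0.
rewrite lee_fin ler_pdivlMr//.
have key (t e : R) : 0 < t < 1 -> 0 < e ->
    l * B <= (1 - t) `^ (1 - p) * ((1 - t) `^ (1 - p) * A + t `^ (1 - p) * e) + l * (t `^ (1 - p) * e).
  move=> t01 e0; have [phi tphi] := approx e e0.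
  set E1 := (X in (X + _)%E); set E2 := (X in (_ + X < _)%E) => E12.
  have E10 : (0 <= E1)%E by apply: integral_ge0 => x _; rewrite lee_fin powR_ge0.
  have E20 : (0 <= E2)%E by apply: integral_ge0 => x _; rewrite lee_fin powR_ge0.
  have E1e : (E1 <= e%:E)%E by apply: le_trans (ltW E12); rewrite leeDl.
  have E2e : (E2 <= e%:E)%E by apply: le_trans (ltW E12); rewrite leeDr.
  have [Cphi Cpart dphi] := test_function_derive tphi.
  set A' := Int (fun x => enorm (gradient phi x) `^ p).
  set B' := Int (fun x => `|phi x| `^ p).
  have A'E : A'%:E = (\int[mu]_(x in Omega) (enorm (gradient phi x) `^ p)%:E)%E.
    apply: EFin_Int_test => //.
      apply: Cc_enorm_powR => // i.
      by rewrite (_ : (fun x => _) = partial i phi)//; apply/funext => x; rewrite mxE.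
    move=> x /(test_function_notin tphi)[_ d0].
    rewrite (_ : gradient phi x = 0) ?enorm0 ?powR0 ?gt_eqF//.
    by apply/rowP => i; rewrite !mxE d0.
  have B'E : B'%:E = (\int[mu]_(x in Omega) (`|phi x| `^ p)%:E)%E.
    apply: EFin_Int_test => //.
      exact: Cc_norm_powR.
    by move=> x /(test_function_notin tphi)[-> _]; rewrite normr0 powR0// gt_eqF.
  have mphi : measurable_fun Omega phi by apply: measurable_funTS; apply: continuous_measurable_rV; exact: Cphi.1.
  have tp : 0 < t `^ (1 - p) by rewrite powR_gt0//; case/andP: t01.
  have BB' : B <= (1 - t) `^ (1 - p) * B' + t `^ (1 - p) * e.
    apply: (le_fineD BE B'E E1e tp).
    have mn (h : V -> R) : measurable_fun Omega h -> measurable_fun Omega (fun x => `|h x|).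
      by move=> mh; exact: measurableT_comp.
    apply: (le_integral_powRD _ mO (mn _ mu_) (mn _ mphi) (mn _ (measurable_funB mu_ mphi)) (ltW p1) t01).
    by move=> x _; split => //; rewrite -{1}(subrK (phi x) (u x)) addrC ler_normD.
  have A'A : A' <= (1 - t) `^ (1 - p) * A + t `^ (1 - p) * e.
    apply: (le_fineD A'E AE E2e tp).
    have mg' i : measurable_fun Omega (fun x => g x 0 i).
      exact: (measurableT_comp (measurable_rV_coord i) mg).
    have mp' i : measurable_fun Omega (fun x => gradient phi x 0 i).
      apply: measurable_funTS; apply: continuous_measurable_rV.
      by rewrite (_ : (fun x => _) = partial i phi); [exact: (Cpart i).1|apply/funext => x; rewrite mxE].
    have md i : measurable_fun Omega (fun x => (g x - gradient phi x) 0 i).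
      rewrite (_ : (fun x => _) = (fun x => g x 0 i - gradient phi x 0 i)); first exact: measurable_funB.
      by apply/funext => x; rewrite !mxE.
    apply: (le_integral_powRD _ mO (measurable_enorm mp') (measurable_enorm mg') (measurable_enorm md) (ltW p1) t01).
    move=> x _; split; rewrite ?enorm_ge0//.
    by have := enormB (gradient phi x) (g x); rewrite -(opprB (g x)) enormN; lra.
  have := H phi tphi; rewrite -/A' -/B' => HB.
  have k0 : 0 <= (1 - t) `^ (1 - p) := powR_ge0 _ _.
  have h1 := ler_wpM2l (ltW l0) BB'; have h2 := ler_wpM2l k0 (le_trans HB A'A).
  apply: le_trans h1 _; rewrite mulrDr lerD2r; apply: le_trans h2; rewrite le_eqVlt; apply/orP; left; apply/eqP; ring.
rewrite leNgt; apply/negP => AB.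
have ck : {for 1, continuous (fun s : R => s `^ (1 - p) * (s `^ (1 - p) * A))}.
  apply: cvgM; first exact: powR_continuous_gt0.
  by apply: cvgM; [exact: powR_continuous_gt0|exact: cvg_cst].
have : \forall s \near (1 : R), s `^ (1 - p) * (s `^ (1 - p) * A) < l * B.
  by apply: (@cvgr_lt _ _ (nbhs (1 : R)) _ _ _ ck); rewrite powR1 !mul1r.
move=> /nbhs_ballP[r /= r0 rB].
pose t := Num.min (r / 2) (1 / 2).
have t01 : 0 < t < 1 by rewrite /t lt_min gt_min; apply/andP; split; [apply/andP; split; lra|apply/orP; right; lra].
have tr : t < r by rewrite /t gt_min; apply/orP; left; lra.
have := rB (1 - t); rewrite /ball/= opprB addrC subrK gtr0_norm; last by case/andP: t01.
move=> /(_ tr); set k := (1 - t) `^ (1 - p) => kAB.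
(* [K] collects the coefficients of [e] in [key]; the choice of [e] below makes the total error half
   of the supposed gap. *)
pose K := k * t `^ (1 - p) + l * t `^ (1 - p).
have K0 : 0 < K.
  have h1 : 0 < t `^ (1 - p) by rewrite powR_gt0//; case/andP: t01.
  by rewrite /K addr_gt0 ?mulr_gt0// powR_gt0//; lra.
have := key t ((l * B - k * (k * A)) / (2 * K)) t01.
rewrite divr_gt0 ?subr_gt0 ?mulr_gt0// => /(_ isT); rewrite -/k.
set e := _ / (2 * K) => ke.
have : K * e = (l * B - k * (k * A)) / 2 by rewrite /e; field; rewrite gt_eqF.
by move: ke; rewrite /K; lra.
Qed.

End lower_bound.

(** * Test functions built from two radial profiles *)

Section compactly_supported_approximation.
Context {R : realType}.
Implicit Types (f : R -> R) (t : R).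

Lemma derive_locally_cst f (f' : R -> R) (c t : R) : (forall t : R, is_derive t 1 f (f' t)) ->
  (\forall s \near t, f s = c) -> f' t = 0.
Proof.
move=> df fc; have [_ <-] := df t.
have h : \forall s \near t, (fun=> c) s = f s by apply: filterS fc => s ->.
by rewrite -(near_eq_derive (1 : R) h); have [_ ->] := is_derive_fcst c t (1 : R).
Qed.

(** The approximation is multiplied by a cutoff falling from 1 to 0 on [[S, S + 1]]. Since [f]
    vanishes there, the derivative of the cutoff meets only the error [G - f]. *)
Lemma smooth_C1_approximation_supp f (f' : R -> R) (S e : R) :
  (forall t : R, is_derive t 1 f (f' t)) -> continuous f' -> 0 < S -> 0 < e ->
  (forall t, S <= t -> f t = 0) ->
  exists F F' : R -> R, [/\ forall k, Ck k F, forall t : R, is_derive t 1 F (F' t),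
    forall t, S + 1 < t -> F t = 0 /\ F' t = 0 &
    forall t, 0 <= t -> `|F t - f t| <= e /\ `|F' t - f' t| <= e].
Proof.
move=> df cf' S0 e0 fS.
have [s [Cs s01 sN s1]] := @smooth_step R.
pose x t := 1 - s (t - S).
have Cx k : Ck k x.
  rewrite /x; apply: (@Ck_ext _ _ (fun t => 1 + (-1) * s (1 * t + - S))).
    by move=> t; rewrite mul1r mulN1r.
  apply: CkD; first exact: Ck_cst.
  apply: CkM; first exact: Ck_cst.
  by apply: (@Ck_comp _ k s (fun t => 1 * t + - S)) => //; exact: Ck_affine.
have [x' dx Cx'] := Cx 2%N; have cx' := Ck_continuous Cx'.
have x1 t : t <= S -> x t = 1 by move=> tS; rewrite /x sN ?subr0// subr_le0.
have x0 t : S + 1 <= t -> x t = 0 by move=> tS; rewrite /x s1 ?subrr//; lra.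
have x01 t : `|x t| <= 1 by have := s01 (t - S); rewrite /x ler_norml; lra.
have x'1 t : t < S -> x' t = 0.
  move=> tS; apply: (derive_locally_cst (c := 1) dx); near=> u; apply: x1; apply: ltW.
  by near: u; exact: near_ltr.
have x'0 t : S + 1 < t -> x' t = 0.
  move=> tS; apply: (derive_locally_cst (c := 0) dx); near=> u; apply: x0; apply: ltW.
  by near: u; exact: near_gtr.
have f'0 t : S < t -> f' t = 0.
  move=> tS; apply: (derive_locally_cst (c := 0) df); near=> u; apply: fS; apply: ltW.
  by near: u; exact: near_gtr.
have [C C0 x'C] : exists2 C, 0 <= C & forall t, 0 <= t <= S + 1 -> `|x' t| <= C.
  have cn : continuous (fun t => `|x' t|) := continuous_fcomp cx' (@norm_continuous _ R).
  have S1 : 0 <= S + 1 by lra.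
  have [c _ cM] := EVT_max S1 (continuous_subspaceT cn).
  by exists `|x' c| => // t tS; apply: cM; rewrite in_itv.
(* On [[0, S + 1]] the values err by at most [e' (S + 1)]; in the derivative this is multiplied by
   at most [C], and the error [e'] of [G'] is added. *)
pose e' := e / ((C + 1) * (S + 1) + 1).
have D0 : 0 < (C + 1) * (S + 1) + 1 by nra.
have e'0 : 0 < e' by rewrite divr_gt0.
have e'E : e' * ((C + 1) * (S + 1) + 1) = e by rewrite /e'; field; rewrite gt_eqF.
have S10 : 0 < S + 1 by lra.
have [G [G' [CG dG GP]]] := smooth_C1_approximation df cf' S10 e'0.
exists (fun t => x t * G t), (fun t => x' t * G t + x t * G' t); split.
- by move=> k; exact: CkM.
- by move=> t; exact: is_derive_fM.
- by move=> t tS; rewrite x0 ?x'0 ?mul0r ?add0r//; exact: ltW.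
move=> t t0; have xf : x t * f t = f t.
  have [tS|/ltW tS] := leP t S; first by rewrite x1// mul1r.
  by rewrite fS// mulr0.
have [tS|tS] := leP t (S + 1); last first.
  by rewrite x0 ?x'0 ?fS ?f'0 ?mul0r ?addr0 ?subrr ?normr0 ?(ltW e0)//; lra.
have [h1 h2] := GP t ltac:(lra).
have xf' : x t * f' t = f' t.
  have [tS'|tS'] := leP t S; first by rewrite x1// mul1r.
  by rewrite f'0// mulr0.
have x'f : x' t * f t = 0.
  have [tS'|tS'] := ltP t S; first by rewrite x'1// mul0r.
  by rewrite fS// mulr0.
have h3 : e' * t <= e' * (S + 1) by rewrite ler_pM2l.
have h4 : `|G t - f t| <= e' * (S + 1) by apply: le_trans h1 h3.
have nx := normr_ge0 (x t).
split.
  rewrite (_ : x t * G t - f t = x t * (G t - f t)) ?normrM; last by rewrite mulrBr xf.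
  have : `|x t| * `|G t - f t| <= 1 * (e' * (S + 1)) by apply: ler_pM.
  nra.
have -> : x' t * G t + x t * G' t - f' t = x' t * (G t - f t) + x t * (G' t - f' t).
  by rewrite !mulrBr x'f xf'; ring.
apply: le_trans (ler_normD _ _) _; rewrite !normrM.
have h5 : `|x t| * `|G' t - f' t| <= 1 * e' by apply: ler_pM.
have h6 : `|x' t| * `|G t - f t| <= C * (e' * (S + 1)) by apply: ler_pM => //; apply: x'C; lra.
nra.
Unshelve. all: by end_near. Qed.

Lemma powR_unif_continuous (p L e : R) : 0 < p -> 0 < e -> exists2 d : R, 0 < d &
  forall s t, 0 <= s <= L -> 0 <= t -> `|s - t| < d -> `|s `^ p - t `^ p| <= e.
Proof.
move=> p0 e0; have [d d0 H] := @segment_unif_continuous R _ 0 L e (powR_norm_cont p0) e0.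
exists d => // s t sL t0 st; have := H s t sL st.
by rewrite (ger0_norm (andP sL).1) (ger0_norm t0).
Qed.

End compactly_supported_approximation.

Section competitor.
Context {R : realType} {N : nat}.
Local Notation V := 'rV[R]_N.
Local Notation mu := (lebesgue_rV N).
Implicit Types (f g h phi psi : V -> R) (x a : V) (p r t : R) (Omega : set V).
Local Notation "'Int' f" := (\int[mu]_x f x) (at level 10).

Lemma Cc_Lp Omega p f : 0 < p -> measurable Omega -> Cc f -> Lp Omega p f.
Proof.
move=> p0 mO Cf; split.
  by apply: measurable_funTS; apply: continuous_measurable_rV; exact: Cf.1.
have /integrableP[_] : mu.-integrable Omega (EFin \o (fun x => `|f x| `^ p)).
  apply: (@integrableS _ _ _ mu setT) => //; apply: Cc_integrable; exact: Cc_norm_powR.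
by under eq_integral do rewrite /= ger0_norm ?powR_ge0//.
Qed.

(** The classical gradient is a weak one because the derivatives of [phi * psi] have integral 0, and
    [phi] approximates itself. Positivity of the denominator excludes functions vanishing almost
    everywhere. *)
Lemma lambda1_le_test Omega p phi : 1 < p -> measurable Omega -> test_function Omega phi ->
  0 < Int (fun x => `|phi x| `^ p) ->
  (lambda1 p Omega <= (Int (fun x => enorm (gradient phi x) `^ p) /
                       Int (fun x => `|phi x| `^ p))%:E)%E.
Proof.
move=> p1 mO tphi phi0; have p0 : 0 < p by lra.
have [Cphi Cpart dphi] := test_function_derive tphi.
have gi i : (fun x => gradient phi x 0 i) = partial i phi by apply/funext => x; rewrite mxE.
have Cg : Cc (fun x => enorm (gradient phi x) `^ p).
  by apply: Cc_enorm_powR => // i; rewrite gi.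
have g0 x : ~ Omega x -> enorm (gradient phi x) `^ p = 0.
  move=> /(test_function_notin tphi)[_ d0].
  rewrite (_ : gradient phi x = 0) ?enorm0 ?powR0 ?gt_eqF//.
  by apply/rowP => i; rewrite !mxE d0.
have f0 x : ~ Omega x -> `|phi x| `^ p = 0.
  by move=> /(test_function_notin tphi)[-> _]; rewrite normr0 powR0// gt_eqF.
apply: ereal_inf_lbound; exists phi, (gradient phi); split; last first.
- by rewrite (Rintegral_test mO g0) (Rintegral_test mO f0).
- move=> ae0; move: phi0; rewrite -(Rintegral_test mO f0) /Rintegral.
  have mphi : measurable_fun Omega phi by apply: measurable_funTS; apply: continuous_measurable_rV; exact: Cphi.1.
  by move/(integral_norm_powR_eq0 mO p0 mphi): ae0 => ->; rewrite ltxx.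
split; [split|] => //.
- exact: Cc_Lp.
- split.
    apply: measurable_funTS; apply: measurable_fun_rV => i; rewrite /comp/= /rV_coord gi.
    by apply: continuous_measurable_rV; exact: (Cpart i).1.
  by rewrite -EFin_Int_test// ltry.
- move=> psi tpsi i; have [Cpsi Cpart' dpsi] := test_function_derive tpsi.
  have h1 x : ~ Omega x -> phi x * partial i psi x = 0.
    by move=> /(test_function_notin tphi)[-> _]; rewrite mul0r.
  have h2 x : ~ Omega x -> gradient phi x 0 i * psi x = 0.
    by move=> /(test_function_notin tpsi)[-> _]; rewrite mulr0.
  rewrite (Rintegral_test mO h1) (Rintegral_test mO h2).
  apply/eqP; rewrite -addr_eq0 -RintegralD//; last 2 first.
  + by apply: Cc_integrable; apply: CcMl => //; exact: Cphi.1.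
  + by apply: Cc_integrable; apply: CcMl => //; rewrite gi; exact: (Cpart i).1.
  apply/eqP; apply: (@Int_derivative _ _ (fun x => phi x * psi x) _ i).
  + by apply: CcMl => //; exact: Cphi.1.
  + apply: CcD; first by apply: CcMl => //; exact: Cphi.1.
    by apply: CcMl => //; rewrite gi; exact: (Cpart i).1.
  + move=> x; rewrite mxE addrC; exact: is_derive_fM.
- move=> e e0; exists phi => //.
  rewrite !integral0_eq ?adde0 ?lte_fin//.
  + by move=> x _; rewrite subrr enorm0 powR0// gt_eqF.
  + by move=> x _; rewrite subrr normr0 powR0// gt_eqF.
Qed.

Lemma sqn_C1 (F F' : R -> R) a i x : (forall t : R, is_derive t 1 F (F' t)) ->
  is_derive x (delta_mx 0 i : V) (fun y => F (sqn (y - a))) (2 * F' (sqn (x - a)) * (x - a) 0 i).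
Proof.
move=> dF; apply: is_derive_eq (is_derive_fcomp (dF _) (is_derive_sqn x a i)) _.
by ring.
Qed.

(* The energy density of the radial function x |-> F (|x|^2) is
   (2 |F'(|x|^2)| |x|)^p. *)
Definition radial_energy p (F' : R -> R) x : R := (2 * `|F' (sqn x)| * enorm x) `^ p.

(** Where the norm exceeds 1 it is at most its square, so a bound on the norm serves for the square
    without a root. *)
Lemma lt_sqn (S : R) x : Num.max S 1 < enorm x -> S < sqn x.
Proof.
by rewrite gt_max => /andP[Sx x1]; apply: (lt_le_trans Sx); rewrite -enorm_sqr expr2 ler_peMl ?enorm_ge0// ltW.
Qed.

Lemma Cc_radial_energy p (F' : R -> R) (S : R) : 0 < p -> continuous F' ->
  (forall t, S < t -> F' t = 0) -> Cc (radial_energy p F').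
Proof.
move=> p0 cF' F'0.
have E x : radial_energy p F' x = enorm (\row_i (2 * F' (sqn x) * x 0 i)) `^ p.
  rewrite /radial_energy; congr (_ `^ _).
  rewrite (_ : \row_i _ = (2 * F' (sqn x)) *: x) ?enormZ ?(normrM 2) ?(@ger0_norm _ 2)//.
  by apply/rowP => i; rewrite !mxE.
rewrite (_ : radial_energy p F' = fun x => enorm (\row_i (2 * F' (sqn x) * x 0 i)) `^ p); last exact/funext.
have Cs : Cc (fun x : V => F' (sqn x)).
  split; first exact: (continuous_fcomp (@sqn_continuous0 R N) cF').
  by exists (Num.max S 1) => x /lt_sqn; exact: F'0.
apply: Cc_enorm_powR => // i.
rewrite (_ : (fun x => _) = (fun x : V => x 0 i * (2 * F' (sqn x)))).
  by apply: CcMl; [exact: coord_continuous|exact: CcZ].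
by apply/funext => x; rewrite !mxE mulrC.
Qed.

(** An integrable weight, at least 1 where [sqn x <= S + 1]: it turns pointwise errors on that ball
    into errors of integrals. *)
Definition cutoff (S : R) x : R := Num.max 0 (S + 2 - sqn x).

Lemma Cc_cutoff (S : R) : Cc (cutoff S).
Proof.
split.
  have c1 : continuous (fun x : V => S + 2 - sqn x).
    by apply: continuous_fB; [exact: continuous_fcst|exact: sqn_continuous0].
  move=> x; apply: (@continuous_comp _ _ _ (fun x : V => S + 2 - sqn x) (fun t : R => Num.max 0 t)); first exact: c1.
  by apply: continuous_max; [exact: cst_continuous|exact: cvg_id].
exists (Num.max (S + 2) 1) => x /lt_sqn Sx.
by rewrite /cutoff max_l// subr_le0 ltW.
Qed.

Lemma cutoff_ge0 (S : R) x : 0 <= cutoff S x.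
Proof. by rewrite le_max lexx. Qed.

Lemma cutoff_ge1 (S : R) x : sqn x <= S + 1 -> 1 <= cutoff S x.
Proof. by move=> h; rewrite le_max; apply/orP; right; lra. Qed.

Lemma radial_energy_le (p S e d L eta : R) (F' f' : R -> R) x : 0 < p -> 0 <= S -> 0 <= eta ->
  (forall s t, 0 <= s <= L -> 0 <= t -> `|s - t| < d -> `|s `^ p - t `^ p| <= eta) ->
  2 * `|f' (sqn x)| * enorm x <= L ->
  `|F' (sqn x) - f' (sqn x)| <= e -> 2 * e * Num.sqrt (S + 1) < d ->
  (S + 1 < sqn x -> F' (sqn x) = 0) ->
  radial_energy p F' x <= radial_energy p f' x + eta * cutoff S x.
Proof.
move=> p0 S0 eta0 unif fL Ff ed F0; have ex := enorm_ge0 x.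
have [xS|xS] := leP (sqn x) (S + 1); last first.
  rewrite /radial_energy F0// normr0 mulr0 mul0r powR0 ?gt_eqF//.
  by rewrite addr_ge0 ?powR_ge0// mulr_ge0// cutoff_ge0.
have xe : enorm x <= Num.sqrt (S + 1) by rewrite enormE ler_wsqrtr.
have := unif (2 * `|f' (sqn x)| * enorm x) (2 * `|F' (sqn x)| * enorm x).
rewrite fL !mulr_ge0// => /(_ isT isT).
rewrite -mulrBl -mulrBr !normrM (ger0_norm ex) (@ger0_norm _ 2)//.
have h1 : `| `|f' (sqn x)| - `|F' (sqn x)| | <= e.
  by apply: le_trans (ler_dist_dist _ _) _; rewrite distrC.
have h2 : 2 * `| `|f' (sqn x)| - `|F' (sqn x)| | * enorm x <= 2 * e * Num.sqrt (S + 1).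
  by apply: ler_pM => //; rewrite ?mulr_ge0// ler_pM2l.
move=> /(_ (le_lt_trans h2 ed)); rewrite ler_norml => /andP[h3 _].
have h4 : eta * 1 <= eta * cutoff S x by rewrite ler_wpM2l// cutoff_ge1.
by rewrite /radial_energy; lra.
Qed.

Lemma CkNB k f h : CkN k f -> CkN k h -> CkN k (fun x => f x - h x).
Proof.
move=> Cf Ch; rewrite (_ : (fun x => _) = (fun x => f x + (-1) * h x)).
  by apply: CkND => //; apply: CkNM => //; exact: CkN_cst.
by apply/funext => x; rewrite mulN1r.
Qed.

(** Smooths the minimum of two C^1 radial profiles into a test function. All errors are fitted into
    the strict gap of the hypothesis, which is what makes a C^1 construction sufficient. *)
Lemma shell_function_energy (p alpha beta sg b1 l : R) (A A' B B' : R -> R) a Omega :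
  1 < p -> 0 < l -> 0 < beta -> 0 < sg -> measurable Omega ->
  (forall x, sqn x <= beta -> alpha <= sqn (x - a) -> Omega x) ->
  (forall t : R, is_derive t 1 A (A' t)) -> continuous A' ->
  (forall t : R, is_derive t 1 B (B' t)) -> continuous B' ->
  (forall t, 0 <= A t) -> (forall t, 0 <= B t) ->
  (forall t, beta <= t -> A t = 0) -> (forall t, t <= alpha -> B t = 0) ->
  (forall t, sg <= t -> B t = b1) ->
  Int (radial_energy p A') + Int (radial_energy p B') <
    l * Int (fun x => Num.min (A (sqn x)) (B (sqn (x - a))) `^ p) ->
  (lambda1 p Omega < l%:E)%E.
Proof.
move=> p1 l0 beta0 sg0 mO Os dA cA' dB cB' A0 B0 Abeta Balpha Bsg EAB.
have p0 : 0 < p := lt_trans ltr01 p1.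
pose S := Num.max beta sg.
have S0 : 0 < S by rewrite lt_max beta0.
have betaS : beta <= S by rewrite le_max lexx.
have sgS : sg <= S by rewrite le_max lexx orbT.
have A'0 t : S < t -> A' t = 0.
  move=> tS; apply: (derive_locally_cst (c := 0) dA); near=> u; apply: Abeta.
  by apply: (le_trans betaS); apply: ltW; near: u; exact: near_gtr.
have B'0 t : S < t -> B' t = 0.
  move=> tS; apply: (derive_locally_cst (c := b1) dB); near=> u; apply: Bsg.
  by apply: (le_trans sgS); apply: ltW; near: u; exact: near_gtr.
set v := fun x => Num.min (A (sqn x)) (B (sqn (x - a))) in EAB *.
have v0 x : 0 <= v x by rewrite le_min A0 B0.
have cA : continuous A by move=> t; exact: is_derive_cont (dA t).
have cB : continuous B by move=> t; exact: is_derive_cont (dB t).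
have Cv : Cc v.
  split.
    have c1 := continuous_fcomp (@sqn_continuous0 R N) cA.
    have c2 := continuous_fcomp (@sqn_continuous R N a) cB.
    by move=> x; apply: continuous_min; [exact: c1|exact: c2].
  by exists (Num.max beta 1) => x /lt_sqn bx; rewrite /v Abeta ?min_l// ltW.
have [Lv vL] := Cc_bounded Cv.
have C1A := Cc_radial_energy ltr01 cA' A'0; have [LA AL] := Cc_bounded C1A.
have C1B := Cc_radial_energy ltr01 cB' B'0; have [LB BL] := Cc_bounded C1B.
pose L := Num.max Lv (Num.max LA LB).
have vL' x : v x <= L by rewrite le_max (le_trans (ler_norm _) (vL x)).
have radL (F : R -> R) x : 2 * `|F (sqn x)| * enorm x = radial_energy 1 F x.
  by rewrite /radial_energy powRr1// mulr_ge0 ?enorm_ge0// mulr_ge0.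
have AL' x : 2 * `|A' (sqn x)| * enorm x <= L.
  by rewrite radL !le_max (le_trans (ler_norm _) (AL x)) orbT.
have BL' x : 2 * `|B' (sqn x)| * enorm x <= L.
  by rewrite radL !le_max (le_trans (ler_norm _) (BL x)) !orbT.
set EA := Int (radial_energy p A') in EAB; set EB := Int (radial_energy p B') in EAB.
set Iv := Int (fun x => v x `^ p) in EAB.
pose M := Int (cutoff S).
have M0 : 0 <= M by apply: Rintegral_ge0 => x _; exact: cutoff_ge0.
(* The two energies lose [eta M] each and the mass [eta M], which counts [l] times: together
   [(2 + l) eta M], less than the gap. *)
pose eta := (l * Iv - (EA + EB)) / ((2 + l) * (M + 1)).
have l2 : 0 < 2 + l by rewrite addr_gt0.
have D1 : 0 < (2 + l) * (M + 1) by rewrite mulr_gt0// ltr_wpDl.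
have eta0 : 0 < eta by rewrite divr_gt0// subr_gt0.
have etaE : eta * ((2 + l) * (M + 1)) = l * Iv - (EA + EB) by rewrite /eta mulfVK// gt_eqF.
have [d d0 unif] := powR_unif_continuous L p0 eta0.
(* Small enough for gradients, [2 e sqrt (S + 1) < d], and for values, [4 e < d]. *)
pose e := d / (2 * Num.sqrt (S + 1) + 5).
have sq0 := sqrtr_ge0 (S + 1).
have D2 : 0 < 2 * Num.sqrt (S + 1) + 5 by rewrite ltr_wpDl// mulr_ge0.
have e0 : 0 < e by rewrite divr_gt0.
have eE : e * (2 * Num.sqrt (S + 1) + 5) = d by rewrite /e mulfVK// gt_eqF.
have ed1 : 2 * e * Num.sqrt (S + 1) < d by clear - eE e0; lra.
have ed2 : 4 * e < d by have := mulr_ge0 (ltW e0) sq0; clear - eE e0; lra.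
have AS t : S <= t -> A t = 0 by move=> tS; apply: Abeta; exact: le_trans tS.
have [FA [FA' [CFA dFA FA0 FAe]]] := smooth_C1_approximation_supp dA cA' S0 e0 AS.
(* [B] is the constant [b1] far away; it is [b1 - B] that has bounded support and can be
   approximated. *)
have dB1 (t : R) : is_derive t 1 (fun t => b1 - B t) (- B' t).
  by have := is_derive_fB (is_derive_fcst b1 t (1 : R)) (dB t); rewrite sub0r.
have cB1 : continuous (fun t => - B' t) by move=> t; apply: cvgN; exact: cB'.
have BS t : S <= t -> b1 - B t = 0 by move=> tS; rewrite Bsg ?subrr//; exact: le_trans tS.
have [FB [FB' [CFB dFB FB0 FBe]]] := smooth_C1_approximation_supp dB1 cB1 S0 e0 BS.
have [Y [y [CY dY y01 YN [yN Y0 Yge Yle]]]] := smooth_positive_part e0.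
pose at_ x := FA (sqn (x - 0)); pose bt x := b1 - FB (sqn (x - a)).
(* A smooth minimum: between the minimum of [at_] and [bt] and that minimum plus [e]. *)
pose m x := at_ x - Y (at_ x - bt x).
(* Outside the shell one of [at_], [bt] is at most [e], so the smooth minimum is at most [2 e]; the
   shift makes [phi] vanish there. *)
pose phi x := Y (m x - 2 * e).
have ate x : `|at_ x - A (sqn x)| <= e by rewrite /at_ subr0; have [] := FAe _ (sqn_ge0 x).
have bte x : `|bt x - B (sqn (x - a))| <= e.
  rewrite (_ : bt x - _ = - (FB (sqn (x - a)) - (b1 - B (sqn (x - a))))) ?normrN; last by rewrite /bt; ring.
  by have [] := FBe _ (sqn_ge0 (x - a)).
have phi0 x : 0 <= phi x by exact: Y0.
have phi_supp x : phi x != 0 -> sqn x <= beta /\ alpha <= sqn (x - a).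
  move=> px; have mp : 2 * e < m x.
    by rewrite ltNge; apply: contra px => h; rewrite /phi YN// subr_le0.
  split; rewrite leNgt; apply/negP => h.
    have := ate x; rewrite (Abeta _ (ltW h)) subr0 => /ler_normlP[_].
    have := Y0 (at_ x - bt x); move: mp; rewrite /m; clear - e0; lra.
  have := bte x; rewrite (Balpha _ (ltW h)) subr0 => /ler_normlP[_].
  have := Yge (at_ x - bt x); move: mp; rewrite /m; clear - e0; lra.
have Cat k : CkN k at_ by apply: CkN_comp => //; exact: CkN_sqn.
have Cbt k : CkN k bt.
  apply: (@CkN_comp _ _ k (fun t => b1 - FB t)); last exact: CkN_sqn.
  move=> j; apply: (@Ck_ext _ _ (fun t => b1 + (-1) * FB t)); first by move=> t; rewrite mulN1r.
  by apply: CkD; [exact: Ck_cst|apply: CkM; [exact: Ck_cst|exact: CFB]].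
have Cphi k : CkN k phi.
  apply: CkN_comp => //; apply: CkNB; last exact: CkN_cst.
  by apply: CkNB => //; apply: CkN_comp => //; exact: CkNB.
have tphi : test_function Omega phi.
  pose K := [set x : V | sqn (x - 0) <= beta] `&` [set x : V | alpha <= sqn (x - a)].
  have cK : closed K.
    apply: closedI.
      have := @closed_comp _ _ (fun x : V => sqn (x - 0)) [set t : R | t <= beta].
      by apply; [move=> x _; exact: sqn_continuous|exact: closed_le].
    have := @closed_comp _ _ (fun x : V => sqn (x - a)) [set t : R | alpha <= t].
    by apply; [move=> x _; exact: sqn_continuous|exact: closed_ge].
  have sK : closure [set x | phi x != 0] `<=` K.
    rewrite [X in _ `<=` X](closure_id _).1//; apply: closure_subset => x /= /phi_supp[h1 h2].
    by split => //=; rewrite subr0.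
  split.
  - by apply: smooth_CkN.
  - apply: (@compact_enorm _ _ _ (Num.sqrt beta)); first exact: closed_closure.
    by move=> x /sK[/= h _]; rewrite enormE ler_wsqrtr// -[x]subr0.
  - by move=> x /sK[/= h1 h2]; apply: Os => //; rewrite -[x]subr0.
(* The gradient is a number in [[0, 1]] times a convex combination of the two gradients, so its norm
   is at most the larger of theirs, and its p-th power at most the sum. *)
have grad_le x : enorm (gradient phi x) `^ p <= radial_energy p FA' x + radial_energy p FB' (x - a).
  pose yu := y (at_ x - bt x); pose y1 := y (m x - 2 * e).
  pose ga := (2 * FA' (sqn (x - 0))) *: (x - 0); pose gb := (2 * - FB' (sqn (x - a))) *: (x - a).
  have dat i : is_derive x (delta_mx 0 i : V) at_ (ga 0 i).
    by rewrite [ga 0 i]mxE; exact: sqn_C1.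
  have dbt i : is_derive x (delta_mx 0 i : V) bt (gb 0 i).
    rewrite [gb 0 i]mxE; apply: (@sqn_C1 (fun t => b1 - FB t) (fun t => - FB' t)) => t.
    by have := is_derive_fB (is_derive_fcst b1 t (1 : R)) (dFB t); rewrite sub0r.
  have gE : gradient phi x = y1 *: ((1 - yu) *: ga + yu *: gb).
    apply/rowP => i; rewrite [LHS]mxE.
    have d1 := is_derive_fB (dat i) (dbt i).
    have d2 := is_derive_fB (dat i) (is_derive_fcomp (dY _) d1).
    have d3 := is_derive_fB d2 (is_derive_fcst (2 * e) x (delta_mx 0 i : V)).
    have [_] := is_derive_fcomp (dY _) d3; rewrite /partial => ->.
    rewrite [RHS]mxE [X in _ = _ * X]mxE [X in _ = _ * (X + _)]mxE [X in _ = _ * (_ + X)]mxE.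
    by rewrite -/yu -/(m x) -/y1; ring.
  have nga : enorm ga = 2 * `|FA' (sqn x)| * enorm x by rewrite /ga subr0 enormZ (normrM 2) (@ger0_norm _ 2).
  have ngb : enorm gb = 2 * `|FB' (sqn (x - a))| * enorm (x - a).
    by rewrite /gb enormZ (normrM 2) (@ger0_norm _ 2)// normrN.
  have yu01 := y01 (at_ x - bt x); have y101 := y01 (m x - 2 * e).
  rewrite -/yu in yu01; rewrite -/y1 in y101.
  have le1 : enorm (gradient phi x) <= Num.max (enorm ga) (enorm gb).
    rewrite gE (enormZ y1) (ger0_norm (andP y101).1).
    have h1 : enorm ((1 - yu) *: ga + yu *: gb) <= Num.max (enorm ga) (enorm gb).
      apply: le_trans (enormD _ _) _; rewrite (enormZ (1 - yu)) (enormZ yu) (ger0_norm (andP yu01).1) ger0_norm ?subr_ge0 ?(andP yu01).2//.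
      have h2 : (1 - yu) * enorm ga <= (1 - yu) * Num.max (enorm ga) (enorm gb).
        by rewrite ler_wpM2l ?subr_ge0 ?(andP yu01).2// le_max lexx.
      have h3 : yu * enorm gb <= yu * Num.max (enorm ga) (enorm gb).
        by rewrite ler_wpM2l ?(andP yu01).1// le_max lexx orbT.
      by apply: le_trans (lerD h2 h3) _; rewrite -mulrDl subrK mul1r.
    by apply: le_trans h1; rewrite ler_piMl ?enorm_ge0// (andP y101).2.
  have [h|h] := leP (enorm ga) (enorm gb).
    rewrite (max_r h) in le1; apply: (@le_trans _ _ (radial_energy p FB' (x - a))); last by rewrite lerDr powR_ge0.
    by rewrite /radial_energy -ngb ge0_ler_powR ?nnegrE ?enorm_ge0 ?(ltW p0).
  rewrite (max_l (ltW h)) in le1; apply: (@le_trans _ _ (radial_energy p FA' x)); last by rewrite lerDl powR_ge0.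
  by rewrite /radial_energy -nga ge0_ler_powR ?nnegrE ?enorm_ge0 ?(ltW p0).
have v_le x : v x `^ p <= `|phi x| `^ p + eta * cutoff S x.
  have [xS|xS] := leP (sqn x) (S + 1); last first.
    rewrite /v Abeta ?min_l// ?powR0 ?gt_eqF//; last first.
      by apply: (le_trans betaS); apply: ltW; apply: lt_trans xS; rewrite ltrDl.
    by rewrite addr_ge0 ?powR_ge0// mulr_ge0 ?(ltW eta0)// cutoff_ge0.
  have va : v x <= A (sqn x) by rewrite ge_min lexx.
  have vb : v x <= B (sqn (x - a)) by rewrite ge_min lexx orbT.
  have m_ge : v x - e <= m x.
    have /ler_normlP[h1 _] := ate x; have /ler_normlP[h2 _] := bte x.
    rewrite /m; have [h|/ltW h] := leP (at_ x) (bt x).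
      by rewrite YN ?subr_le0//; clear - h1 va; lra.
    have := Yle (at_ x - bt x); rewrite subr_ge0 => /(_ h); clear - h2 vb; lra.
  have phi_ge : v x - 4 * e <= phi x.
    by have := Yge (m x - 2 * e); rewrite -/(phi x); clear - m_ge; lra.
  pose t := Num.max 0 (v x - 4 * e).
  have t0 : 0 <= t by rewrite le_max lexx.
  have tphi' : t <= phi x by rewrite ge_max phi0.
  have vt : `|v x - t| < d.
    rewrite /t; have [h|h] := leP (v x - 4 * e) 0.
      by rewrite subr0 ger0_norm//; apply: le_lt_trans ed2; rewrite -subr_le0.
    by rewrite opprB addrC subrK ger0_norm// mulr_ge0// ltW.
  have := unif (v x) t; rewrite v0 vL' => /(_ isT t0 vt)/ler_normlP[_ h1].
  have h2 : t `^ p <= `|phi x| `^ p.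
    by rewrite (ger0_norm (phi0 x)) ge0_ler_powR ?nnegrE ?(ltW p0).
  have h3 : eta * 1 <= eta * cutoff S x by rewrite ler_pM2l// cutoff_ge1.
  by clear - h1 h2 h3; lra.
have [Cphi0 Cpart dphi] := test_function_derive tphi.
have Cg : Cc (fun x => enorm (gradient phi x) `^ p).
  apply: Cc_enorm_powR => // i.
  by rewrite (_ : (fun x => _) = partial i phi)//; apply/funext => x; rewrite mxE.
have CcC := Cc_cutoff S.
have CA := Cc_radial_energy p0 cA' A'0; have CB := Cc_radial_energy p0 cB' B'0.
have eAle x : radial_energy p FA' x <= radial_energy p A' x + eta * cutoff S x.
  apply: (radial_energy_le p0 (ltW S0) (ltW eta0) unif (AL' x) _ ed1).
    by have [] := FAe _ (sqn_ge0 x).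
  by move=> h; have [] := FA0 _ h.
have eBle x : radial_energy p FB' x <= radial_energy p B' x + eta * cutoff S x.
  have -> : radial_energy p B' x = radial_energy p (fun t => - B' t) x by rewrite /radial_energy normrN.
  apply: (radial_energy_le p0 (ltW S0) (ltW eta0) unif _ _ ed1); first by rewrite normrN; exact: BL'.
    by have [] := FBe _ (sqn_ge0 x).
  by move=> h; have [] := FB0 _ h.
have G_le : Int (fun x => enorm (gradient phi x) `^ p) <= EA + EB + 2 * (eta * M).
  have C1 := CcD CA (CcZ eta CcC); have C2 := Cc_shift a (CcD CB (CcZ eta CcC)).
  have -> : EA + EB + 2 * (eta * M) =
      Int (fun x => (radial_energy p A' x + eta * cutoff S x) +
        (radial_energy p B' (x - a) + eta * cutoff S (x - a))).
    have i1 := Cc_integrable C1; have i2 := Cc_integrable C2.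
    have i3 := Cc_integrable CA; have i4 := Cc_integrable CB.
    have i5 := Cc_integrable (CcZ eta CcC); have i6 := Cc_integrable CcC.
    rewrite (RintegralD measurableT i1 i2) (Int_shift a (CcD CB (CcZ eta CcC))).
    rewrite (RintegralD measurableT i3 i5) (RintegralD measurableT i4 i5).
    by rewrite (RintegralZl _ measurableT i6) -/EA -/EB -/M; ring.
  apply: le_Rintegral; [exact: measurableT|exact: Cc_integrable|exact/Cc_integrable/CcD|].
  by move=> x _; apply: le_trans (grad_le x) _; apply: lerD; [exact: eAle|exact: eBle].
have F_ge : Iv <= Int (fun x => `|phi x| `^ p) + eta * M.
  have Cp := Cc_norm_powR p0 Cphi0.
  have i5 := Cc_integrable (CcZ eta CcC); have i6 := Cc_integrable CcC.
  rewrite -(RintegralZl _ measurableT i6) -(RintegralD measurableT (Cc_integrable Cp) i5).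
  apply: le_Rintegral; [exact: measurableT| |exact: (Cc_integrable (CcD Cp (CcZ eta CcC)))|by move=> x _; exact: v_le].
  have Cvp := Cc_norm_powR p0 Cv; apply: Cc_integrable.
  by rewrite (_ : (fun x => _) = fun x => `|v x| `^ p)//; apply/funext => x; rewrite (ger0_norm (v0 x)).
set I := Int (fun x => `|phi x| `^ p) in F_ge.
have G0 : 0 <= Int (fun x => enorm (gradient phi x) `^ p).
  by apply: Rintegral_ge0 => x _; exact: powR_ge0.
set Gr := Int (fun x => enorm (gradient phi x) `^ p) in G_le G0.
have lt1 : Gr < l * I.
  have h1 : l * Iv <= l * I + l * (eta * M) by rewrite -mulrDr ler_pM2l.
  have h2 : 0 < eta * (2 + l) by rewrite mulr_gt0.
  clear - G_le h1 h2 etaE; lra.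
have I0 : 0 < I by have := le_lt_trans G0 lt1; rewrite pmulr_rgt0.
apply: le_lt_trans (lambda1_le_test p1 mO tphi I0) _.
by rewrite lte_fin ltr_pdivrMr.
Unshelve. all: by end_near. Qed.

End competitor.

(** * Truncation of the radial eigenfunction *)

Section truncated_profile.
Context {R : realType}.
Implicit Types (f F : R -> R) (t : R).

Lemma continuous_comp_for f F (t : R) : {for t, continuous f} -> {for f t, continuous F} ->
  {for t, continuous (fun s => F (f s))}.
Proof. by move=> cf cF; apply: (@continuous_comp _ _ _ f F). Qed.

Lemma is_derive0_dominated f F (c : R) : is_derive c 1 f 0 ->
  (forall t, `|F t - F c| <= `|f t - f c|) -> is_derive c 1 F 0.
Proof.
move=> [dfc fc0] Ff; move: (dfc); rewrite /derivable => /cvg_ex[/= l fl].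
have l0 : l = 0 by rewrite -fc0; apply/esym/cvg_lim.
have FL : (fun h : R => h^-1 *: (F (h *: (1 : R) + c) - F c)) @ 0^' --> (0 : R).
  rewrite l0 in fl; apply/cvgrPdist_lt => e e0.
  move/cvgrPdist_lt : fl => /(_ e e0); apply: filterS => h; rewrite !sub0r !normrN.
  by apply: le_lt_trans; rewrite !normrM ler_wpM2l.
apply: DeriveDef; first by apply/cvg_ex; exists 0.
exact: cvg_lim FL.
Qed.

(** A C^1 function may be frozen at a critical point and stay C^1; at [c] its increments are
    dominated by those of [f]. This cuts the eigenfunction along its sphere of maxima. *)
Lemma is_derive_max f (f' : R -> R) (c t : R) : (forall t : R, is_derive t 1 f (f' t)) -> f' c = 0 ->
  is_derive t 1 (fun t => f (Num.max t c)) (f' (Num.max t c)).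
Proof.
move=> df f'c; have [tc|ct|->] := ltgtP t c.
- rewrite f'c; apply: (near_eq_is_derive (f := fun=> f c)).
  by near=> s; rewrite max_r// ltW//; near: s; exact: near_ltr.
- apply: (near_eq_is_derive (f := f)).
  by near=> s; rewrite max_l// ltW//; near: s; exact: near_gtr.
rewrite f'c; apply: (is_derive0_dominated (f := f)); first by rewrite -f'c.
by move=> s; rewrite maxxx; case: (leP s c) => // _; rewrite subrr normr0.
Unshelve. all: by end_near. Qed.

Lemma is_derive_min f (f' : R -> R) (c t : R) : (forall t : R, is_derive t 1 f (f' t)) -> f' c = 0 ->
  is_derive t 1 (fun t => f (Num.min t c)) (f' (Num.min t c)).
Proof.
move=> df f'c; have [tc|ct|->] := ltgtP t c.
- apply: (near_eq_is_derive (f := f)).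
  by near=> s; rewrite min_l// ltW//; near: s; exact: near_ltr.
- rewrite f'c; apply: (near_eq_is_derive (f := fun=> f c)).
  by near=> s; rewrite min_r// ltW//; near: s; exact: near_gtr.
rewrite f'c; apply: (is_derive0_dominated (f := f)); first by rewrite -f'c.
by move=> s; rewrite minxx; case: (leP s c) => // _; rewrite subrr normr0.
Unshelve. all: by end_near. Qed.

(** The open sets [(s0, s1)] and the complement of [[a, b]] cover the line, so near every point one
    of the two descriptions holds. *)
Lemma C1_extend0 f F (f' F' : R -> R) (s0 s1 a b : R) : s0 < a -> b < s1 ->
  (forall t, s0 < t < s1 -> [/\ F t = f t, F' t = f' t, is_derive t 1 f (f' t) & {for t, continuous f'}]) ->
  (forall t, (t < a) || (b < t) -> F t = 0 /\ F' t = 0) ->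
  (forall t : R, is_derive t 1 F (F' t)) /\ continuous F'.
Proof.
move=> s0a bs1 FI FO.
have inn t : s0 < t < s1 -> \forall s \near t, s0 < s < s1.
  move=> /andP[h1 h2]; near=> s; apply/andP; split; near: s; [exact: near_gtr|exact: near_ltr].
have out t : ~~ (s0 < t < s1) -> \forall s \near t, (s < a) || (b < s).
  rewrite negb_and -!leNgt => /orP[h|h]; near=> s; apply/orP; [left|right]; near: s.
    by apply: near_ltr; exact: le_lt_trans s0a.
  by apply: near_gtr; exact: lt_le_trans h.
split=> t; have [ti|ti] := boolP (s0 < t < s1).
- have [_ -> df _] := FI t ti; apply: near_eq_is_derive df.
  by apply: filterS (inn t ti) => s /FI[->].
- have [_ ->] := FO t (nbhs_singleton (out t ti)).
  apply: (near_eq_is_derive (f := fun=> 0)).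
  by apply: filterS (out t ti) => s /FO[->].
- have [_ E _ cf'] := FI t ti; rewrite /continuous_at E; apply: cvg_trans cf'.
  by apply: near_eq_cvg; apply: filterS (inn t ti) => s /FI[].
- have [_ E] := FO t (nbhs_singleton (out t ti)); rewrite /continuous_at E.
  by apply: cvg_near_cst; apply: filterS (out t ti) => s /FO[].
Unshelve. all: by end_near. Qed.

Context (n p s0 s1 l sg : R) (g P : R -> R).
Context (p1 : 1 < p) (s00 : 0 < s0) (s01 : s0 < s1) (RS : radial_system n p s0 s1 l g P sg).

(** [radial_system] does not prescribe [P] outside [[s0, s1]]; clamping the argument extends it by
    its end values 0. *)
Definition profile t : R := P (Num.max s0 (Num.min t s1)).

Definition profile_slope t : R :=
  P t * (t `^ (p / (p - 1) / 2) / (2 * t) * spowR (p / (p - 1) - 1) (g t)).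

(** The derivative of [Z] composed with the profile, where [z] is that of [Z]. The indicator
    discards [profile_slope] where it is not a derivative. *)
Definition truncated_slope (z : R -> R) t : R :=
  z (profile t) * profile_slope t * (s0 < t < s1)%R%:R.

Let sgi : s0 < sg < s1. Proof. by case: RS. Qed.
Let Psg : P sg = 1. Proof. by case: RS. Qed.
Let cP : continuous P. Proof. by case: RS => _ _ _ _ []. Qed.
Let dP t : s0 < t < s1 -> is_derive t 1 P (profile_slope t).
Proof. by case: RS => _ _ _ _ [H _ _ _ _] /H[]. Qed.
Let Ppos t : s0 < t < s1 -> 0 < P t.
Proof. by case: RS => _ _ _ _ [H _ _ _ _] /H[]. Qed.
Let dg t : s0 < t < s1 -> {for t, continuous g}.
Proof. by case: RS => _ _ _ H _ /H h; exact: is_derive_cont h. Qed.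

Lemma profileE t : s0 <= t <= s1 -> profile t = P t.
Proof. by move=> /andP[h1 h2]; rewrite /profile min_l// max_r. Qed.

Lemma profile_out t : ~~ (s0 < t < s1) -> profile t = 0.
Proof.
have [P0 P1] : P s0 = 0 /\ P s1 = 0 by case: RS => _ _ _ _ [_ _ _ _].
rewrite negb_and -!leNgt /profile => /orP[h|h].
  by rewrite min_l ?max_l// (le_trans h)// ltW.
by rewrite min_r// max_r// ltW.
Qed.

Lemma profile_continuous : continuous profile.
Proof. exact: (continuous_fcomp (clamp_continuous (ltW s01)) cP). Qed.

Lemma profile_sg : profile sg = 1.
Proof. by case/andP: sgi => h1 h2; rewrite profileE ?Psg// !ltW. Qed.

Lemma profile_slope_gt0 t : s0 < t < sg -> 0 < profile_slope t.
Proof.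
move=> /[dup] tsg /andP[h1 h2]; have t0 : 0 < t := lt_trans s00 h1.
have ti : s0 < t < s1 by rewrite h1 (lt_trans h2)//; case/andP: sgi.
have gt : 0 < g t by case: RS => _ _ _ _ [_ H _ _ _]; exact: H.
rewrite /profile_slope mulr_gt0 ?Ppos// mulr_gt0//.
  by rewrite divr_gt0 ?mulr_gt0// powR_gt0.
by rewrite /spowR gtr0_sg// mul1r powR_gt0// gtr0_norm.
Qed.

Lemma profile_slope_lt0 t : sg < t < s1 -> profile_slope t < 0.
Proof.
move=> /[dup] tsg /andP[h1 h2].
have ti : s0 < t < s1 by rewrite h2 (lt_trans _ h1)//; case/andP: sgi.
have t0 : 0 < t by case/andP: ti => h _; exact: lt_trans h.
have gt : g t < 0 by case: RS => _ _ _ _ [_ _ H _ _]; exact: H.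
rewrite /profile_slope pmulr_rlt0 ?Ppos// pmulr_rlt0//.
  by rewrite /spowR ltr0_sg// mulN1r oppr_lt0 powR_gt0// normr_gt0 lt_eqF.
by rewrite divr_gt0 ?mulr_gt0// powR_gt0.
Qed.

Lemma P_le1 t : s0 < t < s1 -> P t <= 1.
Proof.
move=> /andP[h1 h2]; rewrite -Psg; have [tsg|/ltW tsg] := leP t sg.
  rewrite -lerN2; apply: (@is_derive_le0_nincr R (fun t => - P t) (fun t => - profile_slope t) t sg tsg).
  - move=> x /andP[x1 x2]; apply: is_deriveN; apply: dP.
    by rewrite (lt_trans h1)//= (lt_trans x2)//; case/andP: sgi.
  - by apply: within_continuous => x; apply: cvgN; exact: cP.
  - by move=> x /andP[x1 x2]; rewrite oppr_le0 ltW// profile_slope_gt0// x2 (lt_trans h1).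
apply: (@is_derive_le0_nincr R P profile_slope sg t tsg).
- move=> x /andP[x1 x2]; apply: dP.
  by rewrite (lt_trans _ x1)/= ?(lt_trans x2)//; case/andP: sgi.
- exact: within_continuous.
- by move=> x /andP[x1 x2]; rewrite ltW// profile_slope_lt0// x1 (lt_trans x2).
Qed.

Lemma profile_ge0 t : 0 <= profile t.
Proof.
have [ti|ti] := boolP (s0 < t < s1); last by rewrite profile_out.
by rewrite profileE ?(ltW (Ppos ti))//; case/andP: ti => h1 h2; rewrite !ltW.
Qed.

Lemma profile_le1 t : profile t <= 1.
Proof.
have [ti|ti] := boolP (s0 < t < s1); last by rewrite profile_out.
by rewrite profileE ?P_le1//; case/andP: ti => h1 h2; rewrite !ltW.
Qed.

(** A small move in the direction of [sg] strictly increases [P], and the new value is still at most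
    1. *)
Lemma profile_lt1 t : t != sg -> profile t < 1.
Proof.
move=> tsg; have [ti|ti] := boolP (s0 < t < s1); last by rewrite profile_out.
have tE : profile t = P t by rewrite profileE//; case/andP: ti => h1 h2; rewrite !ltW.
rewrite tE; case/andP: (ti) => h1 h2.
have step y : s0 < y < s1 -> P t < P y -> P t < 1 by move=> yi /lt_le_trans; apply; exact: P_le1.
move: tsg; rewrite neq_lt => /orP[tsg|tsg].
  have dN : is_derive t 1 (fun x => - P x) (- profile_slope t) by apply: is_deriveN; exact: dP.
  have neg : - profile_slope t < 0 by rewrite oppr_lt0 profile_slope_gt0// h1.
  have [e e0 /(_ (Num.min (t + e / 2) ((t + s1) / 2)))[_ H]] := is_derive_quotient_lt dN neg.
  set y := Num.min _ _ in H; have yt : t < y by rewrite lt_min; apply/andP; split; lra.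
  have ye : y < t + e by rewrite gt_min; apply/orP; left; lra.
  have ys : y < s1 by rewrite gt_min; apply/orP; right; lra.
  by apply: (step y); [rewrite ys (lt_trans h1)|move: (H ltac:(by rewrite yt ye)); rewrite ltrN2].
have neg : profile_slope t < 0 by rewrite profile_slope_lt0// tsg.
have [e e0 /(_ (Num.max (t - e / 2) ((t + s0) / 2)))[H _]] := is_derive_quotient_lt (dP ti) neg.
set y := Num.max _ _ in H; have yt : y < t by rewrite gt_max; apply/andP; split; lra.
have ye : t - e < y by rewrite lt_max; apply/orP; left; lra.
have ys : s0 < y by rewrite lt_max; apply/orP; right; lra.
by apply: (step y); [rewrite ys (lt_trans yt)|apply: H; rewrite ye].
Qed.

(** A nonzero slope would produce values above 1 on one side of [sg]. *)
Lemma profile_slope_sg : profile_slope sg = 0.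
Proof.
case/andP: (sgi) => h1 h2; apply/eqP; rewrite eq_le; apply/andP; split; rewrite leNgt; apply/negP => h.
  have dN : is_derive sg 1 (fun x => - P x) (- profile_slope sg) by apply: is_deriveN; exact: dP.
  have neg : - profile_slope sg < 0 by rewrite oppr_lt0.
  have [e e0 /(_ (Num.min (sg + e / 2) ((sg + s1) / 2)))[_ H]] := is_derive_quotient_lt dN neg.
  set y := Num.min _ _ in H; have yt : sg < y by rewrite lt_min; apply/andP; split; lra.
  have ye : y < sg + e by rewrite gt_min; apply/orP; left; lra.
  have ys : y < s1 by rewrite gt_min; apply/orP; right; lra.
  have := H ltac:(by rewrite yt ye); rewrite ltrN2 Psg => /lt_geF.
  by rewrite P_le1// ys (lt_trans h1).
have [e e0 /(_ (Num.max (sg - e / 2) ((sg + s0) / 2)))[H _]] := is_derive_quotient_lt (dP sgi) h.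
set y := Num.max _ _ in H; have yt : y < sg by rewrite gt_max; apply/andP; split; lra.
have ye : sg - e < y by rewrite lt_max; apply/orP; left; lra.
have ys : s0 < y by rewrite lt_max; apply/orP; right; lra.
have := H ltac:(by rewrite yt ye); rewrite Psg => /lt_geF.
by rewrite P_le1// ys (lt_trans yt).
Qed.

Lemma profile_slope_continuous t : s0 < t < s1 -> {for t, continuous profile_slope}.
Proof.
move=> ti; have t0 : 0 < t by case/andP: ti => h _; exact: lt_trans h.
have pm : 0 < p - 1 by have := p1; lra.
have qm : 0 < p / (p - 1) - 1.
  by rewrite (_ : _ - 1 = (p - 1)^-1) ?invr_gt0//; field; rewrite gt_eqF.
apply: cvgM; first exact: cP.
apply: cvgM.
  apply: cvgM; first exact: powR_continuous_gt0.
  by apply: cvgV; [rewrite gt_eqF// mulr_gt0|apply: cvgM; [exact: cvg_cst|exact: cvg_id]].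
exact: (@continuous_comp _ _ _ g (spowR (p / (p - 1) - 1)) t (dg ti) (@spowR_cont R _ qm (g t))).
Qed.

Lemma profile_small (d : R) : 0 < d -> exists a b, [/\ s0 < a, b < s1 &
  forall t, (t < a) || (b < t) -> profile t < d].
Proof.
move=> d0.
have nb c : ~~ (s0 < c < s1) -> \forall t \near c, profile t < d.
  move=> cs; apply: (@cvgr_lt _ _ (nbhs c) _ profile (profile c)).
    exact: profile_continuous.
  by rewrite profile_out.
have /nbhs_ballP[e1 /= e10 H1] : \forall t \near s0, profile t < d by apply: nb; rewrite ltxx.
have /nbhs_ballP[e2 /= e20 H2] : \forall t \near s1, profile t < d.
  by apply: nb; rewrite ltxx andbF.
exists (s0 + e1), (s1 - e2); split; [lra|lra|move=> t /orP[h|h]].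
  have [ts|ts] := leP t s0; first by rewrite profile_out// negb_and -leNgt ts.
  by apply: H1; rewrite /ball/= distrC gtr0_norm ?subr_gt0//; lra.
have [ts|ts] := leP s1 t; first by rewrite profile_out// negb_and -!leNgt ts orbT.
by apply: H2; rewrite /ball/= gtr0_norm ?subr_gt0//; lra.
Qed.

(** Only the truncation is C^1 on the whole line: it vanishes near both ends, where nothing is known
    about the slope of [P]. *)
Lemma truncated_profile (Z z : R -> R) (a b d : R) : s0 < a -> b < s1 ->
  (forall t, (t < a) || (b < t) -> profile t < d) ->
  (forall t : R, is_derive t 1 Z (z t)) -> continuous z -> (forall t, t <= d -> Z t = 0 /\ z t = 0) ->
  let u := truncated_slope z in
  [/\ forall t : R, is_derive t 1 (fun t => Z (profile t)) (u t), continuous u &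
   forall t, (t < a) || (b < t) -> Z (profile t) = 0 /\ u t = 0].
Proof.
move=> s0a bs1 small dZ cz Z0 u.
have O t : (t < a) || (b < t) -> Z (profile t) = 0 /\ u t = 0.
  by move=> /small/ltW/Z0[-> zt]; rewrite /u /truncated_slope zt !mul0r.
suff [h1 h2] : (forall t : R, is_derive t 1 (fun t => Z (profile t)) (u t)) /\ continuous u by split.
apply: (@C1_extend0 (fun t => Z (P t)) _ (fun t => z (P t) * profile_slope t) _ _ _ _ _ s0a bs1 _ O).
move=> t ti; have pE : profile t = P t by rewrite profileE//; case/andP: ti => h1 h2; rewrite !ltW.
split; [by rewrite pE|by rewrite /u /truncated_slope pE ti mulr1| |].
  exact: is_derive_fcomp (dZ _) (dP ti).
apply: cvgM; last exact: profile_slope_continuous.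
have cc := continuous_fcomp cP cz; exact: cc.
Qed.

End truncated_profile.

Section profile_energy.
Context {R : realType} {N : nat}.
Local Notation V := 'rV[R]_N.
Local Notation mu := (lebesgue_rV N).
Local Notation "'Int' f" := (\int[mu]_x f x) (at level 10).
Context (p s0 s1 l sg : R) (g P : R -> R).
Context (p1 : 1 < p) (s00 : 0 < s0) (s01 : s0 < s1) (RS : radial_system N%:R p s0 s1 l g P sg).

(* Test the equation [- div (|grad u|^(p-2) grad u) = l u^(p-1)] with the
   truncation [Z u]; here [z <= 1], so that [|grad (Z u)|^p <= z |grad u|^p]. *)
Lemma truncated_energy (Z z : R -> R) (a b d : R) : s0 < a -> a <= b -> b < s1 ->
  (forall t, (t < a) || (b < t) -> profile s0 s1 P t < d) ->
  (forall t : R, is_derive t 1 Z (z t)) -> continuous z -> (forall t, t <= d -> Z t = 0 /\ z t = 0) ->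
  (forall t, 0 <= z t <= 1) ->
  Int (radial_energy p (truncated_slope p s0 s1 g P z)) <=
  l * Int (fun x => Z (profile s0 s1 P (sqn x)) * profile s0 s1 P (sqn x) `^ (p - 1)).
Proof.
move=> s0a ab bs1 small dZ cz Z0 z01; set u := truncated_slope _ _ _ _ _ _.
have p0 : 0 < p := lt_trans ltr01 p1.
have pm0 : 0 < p - 1 by rewrite subr_gt0.
set q := p / (p - 1); have q0 : 0 < q by rewrite divr_gt0.
have qm0 : 0 < q - 1 by rewrite (_ : q - 1 = (p - 1)^-1) ?invr_gt0//; rewrite /q; field; rewrite gt_eqF.
have [dU cu U0] := truncated_profile p1 s00 RS s0a bs1 small dZ cz Z0; rewrite -/u in dU cu U0.
have [_ _ _ dg [dP _ _ _ _]] := RS.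
have [|G [G' [dG cG' GE]]] := C1_extension s0a ab bs1 dg.
  move=> t ti; have t0 : 0 < t by rewrite (lt_trans s00)//; case/andP: ti.
  exact: riccati_continuous (dg t ti).
(* The field [X] is the flux divided by [u^(p-1)]; multiplying [Z u] by that power allows the flux
   formula for [X] to test the equation of [u]. *)
pose h t := Z (P t) * P t `^ (p - 1).
pose h' t := z (P t) * profile_slope p g P t * P t `^ (p - 1) +
  Z (P t) * ((p - 1) * P t `^ (p - 1 - 1) * profile_slope p g P t).
pose F t := Z (profile s0 s1 P t) * profile s0 s1 P t `^ (p - 1).
pose F' t := h' t * (s0 < t < s1)%R%:R.
have pE t : s0 < t < s1 -> profile s0 s1 P t = P t.
  by move=> /andP[h1 h2]; rewrite profileE// !ltW.
have FO t : (t < a) || (b < t) -> F t = 0 /\ F' t = 0.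
  move=> /small/ltW dt; rewrite /F /F' (Z0 _ dt).1 mul0r; split => //.
  have [ti|_] := boolP (s0 < t < s1); last by rewrite mulr0.
  by move: dt; rewrite pE// => /Z0[Zt zt]; rewrite /h' Zt zt !mul0r addr0 mul0r.
have [dF cF'] : (forall t : R, is_derive t 1 F (F' t)) /\ continuous F'.
  apply: (@C1_extend0 _ h _ h' _ _ _ _ _ s0a bs1 _ FO) => t ti.
  have [Pt dPt] := dP t ti; have cPt := is_derive_cont dPt.
  have cS := profile_slope_continuous p1 s00 RS ti.
  have cr r : {for t, continuous (fun t : R => P t `^ r)}.
    exact: (continuous_comp_for cPt (powR_continuous_gt0 Pt)).
  have cZ : {for t, continuous (fun t : R => Z (P t))}.
    exact: (continuous_comp_for cPt (is_derive_cont (dZ (P t)))).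
  have czt : {for t, continuous (fun t : R => z (P t))}.
    exact: (continuous_comp_for cPt (cz (P t))).
  split; [by rewrite /F /h pE|by rewrite /F' ti mulr1| |].
    have d1 := is_derive_fcomp (dZ (P t)) dPt.
    have d2 := is_derive_fcomp (is_derive1_powR (p - 1) Pt) dPt.
    exact: is_derive_fM d1 d2.
  apply: cvgD; first by apply: cvgM; [apply: cvgM|exact: cr].
  apply: cvgM => //; apply: cvgM => //; apply: cvgM; [exact: cvg_cst|exact: cr].
pose f (x : V) := F (sqn x); pose f' i (x : V) := 2 * F' (sqn x) * x 0 i.
have s1l t : s1 < t -> F t = 0 /\ F' t = 0 by move=> h1; apply: FO; rewrite (lt_trans bs1 h1) orbT.
have cs := @sqn_continuous0 R N.
have Cf : Cc f.
  split; last by exists (Num.max s1 1) => x /lt_sqn/s1l[].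
  have cF : continuous F by move=> t; exact: is_derive_cont (dF t).
  exact: (continuous_fcomp cs cF).
have CF' : Cc (fun x : V => F' (sqn x)).
  split; last by exists (Num.max s1 1) => x /lt_sqn/s1l[].
  exact: (continuous_fcomp cs cF').
have Cf' i : Cc (f' i).
  rewrite /f'; under eq_fun do rewrite mulrC.
  by apply: CcMl; [exact: coord_continuous|exact: CcZ].
have cG : continuous (fun x : V => G (sqn x)).
  have cG0 : continuous G by move=> t; exact: is_derive_cont (dG t).
  exact: (continuous_fcomp cs cG0).
have cG1 : continuous (fun x : V => G' (sqn x)) := continuous_fcomp cs cG'.
have df i x : is_derive x (delta_mx 0 i : V) f (f' i x).
  have := sqn_C1 0 i x dF; rewrite subr0 /f /f'; under eq_fun do rewrite subr0; exact.
have flux := radial_flux dG cG' Cf Cf' df.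
have u0 t : s1 < t -> u t = 0 by move=> h1; apply: (U0 t _).2; rewrite (lt_trans bs1 h1) orbT.
have Cu : Cc (radial_energy p u : V -> R) by exact: Cc_radial_energy cu u0.
have le1 x : radial_energy p u x <= G (sqn x) * \sum_i f' i x * x 0 i -
    f x * - (N%:R * G (sqn x) + 2 * sqn x * G' (sqn x)) + l * f x.
  have -> : \sum_i f' i x * x 0 i = 2 * F' (sqn x) * sqn x.
    by rewrite /sqn mulr_sumr; apply: eq_bigr => i _; rewrite /f'; ring.
  set t := sqn x; have [tO|] := boolP ((t < a) || (b < t)).
    have [Ft F't] := FO t tO; have [_ ut] := U0 t tO.
    rewrite /radial_energy /f -/t ut Ft F't !(normr0, mulr0, mul0r) powR0 ?gt_eqF//.
  rewrite negb_or -!leNgt => /andP[at_ tb].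
  have ti : s0 < t < s1 by rewrite (lt_le_trans s0a)// (le_lt_trans tb).
  have t0 : 0 < t := lt_trans s00 (andP ti).1.
  have [Pt _] := dP t ti.
  have [-> ->] := GE t ltac:(by rewrite at_ tb).
  have zt := z01 (P t).
  rewrite /radial_energy /f -/t /F /F' /u /truncated_slope ti !mulr1 (pE _ ti) /h'.
  set e := enorm x; have e2 : e ^+ 2 = t by exact: enorm_sqr.
  have e0 : 0 < e by rewrite lt_neqAle enorm_ge0 andbT eq_sym -sqrf_eq0 e2 gt_eqF.
  set T := t `^ (q / 2); set W := z (P t); set sp := spowR (q - 1) (g t).
  have eq0 : T = e `^ q.
    by rewrite /T -e2 -powR_mulrn ?(ltW e0)// -powRrM; congr (_ `^ _); field.
  have spg : sp * g t = `|g t| `^ q by rewrite /sp spowR_mul// subrK.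
  have Pp : P t * P t `^ (p - 1) = P t `^ p.
    by rewrite mulrC -{2}(powRr1 (ltW Pt)) -powRD ?subrK// (gt_eqF Pt) implybT.
  have Pp1 : P t * P t `^ (p - 1 - 1) = P t `^ (p - 1).
    by rewrite mulrC -{2}(powRr1 (ltW Pt)) -powRD ?subrK// (gt_eqF Pt) implybT.
  have slopeE : profile_slope p g P t = P t * (T / (2 * t) * sp) by [].
  (* Since the gradient of [u] is [u |X|^(q-2) X], the term from differentiating [u^(p-1)] cancels
     the term [(p - 1) |X|^q] of the Riccati equation, and [z |grad u|^p] remains. *)
  have -> : g t * (2 * (W * profile_slope p g P t * P t `^ (p - 1) +
      Z (P t) * ((p - 1) * P t `^ (p - 1 - 1) * profile_slope p g P t)) * t) -
      Z (P t) * P t `^ (p - 1) * - (N%:R * g t + 2 * t *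
        - (N%:R / (2 * t) * g t + l / (2 * t) + (p - 1) * (T / (2 * t)) * `|g t| `^ q)) +
      l * (Z (P t) * P t `^ (p - 1)) = W * P t `^ p * (T * `|g t| `^ q).
    rewrite slopeE -spg -Pp -Pp1; field; rewrite gt_eqF//.
  have -> : 2 * `|W * profile_slope p g P t| * e = W * P t * (e * `|g t|) `^ (q - 1).
    rewrite slopeE (normrM W) (normrM (P t)) (normrM (T / _)) (normrM T) (ger0_norm (andP zt).1) (gtr0_norm Pt) norm_spowR//.
    rewrite normfV (@ger0_norm _ (2 * t)) ?mulr_ge0 ?(ltW t0)// (@ger0_norm _ T) ?powR_ge0//.
    have Te : T = e ^+ 2 * (e `^ (q - 1) / e).
      rewrite eq0 -{1}(subrK 1 q) powRD ?(gt_eqF e0) ?implybT// powRr1 ?(ltW e0)//.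
      by field; rewrite gt_eqF.
    have wE : T / (2 * t) = e `^ (q - 1) / (2 * e).
      by rewrite Te -[in X in _ / X]e2; field; rewrite gt_eqF.
    by rewrite powRM ?(ltW e0)// wE -/W; field; rewrite gt_eqF.
  rewrite !powRM ?mulr_ge0 ?powR_ge0 ?(ltW Pt) ?(ltW e0) ?(andP zt).1//.
  rewrite -!powRrM (_ : (q - 1) * p = q); last by rewrite /q; field; rewrite gt_eqF.
  rewrite -eq0 ler_wpM2r ?mulr_ge0 ?powR_ge0// ler_wpM2r ?powR_ge0//.
  (* What is left is [z^p <= z] for [z] in [[0, 1]]. *)
  have [->|z0] := eqVneq W 0; first by rewrite powR0// gt_eqF.
  by rewrite -[leRHS]powRr1 ?(andP zt).1// ger_powR ?(ltW p1)// (andP zt).2 andbT lt_neqAle eq_sym z0 (andP zt).1.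
have C1 : Cc (fun x => G (sqn x) * \sum_i f' i x * x 0 i).
  apply: CcMl => //; apply: Cc_sum => i.
  by under eq_fun do rewrite mulrC; apply: CcMl => //; exact: coord_continuous.
have C2 : Cc (fun x => f x * - (N%:R * G (sqn x) + 2 * sqn x * G' (sqn x))).
  under eq_fun do rewrite mulrC; apply: CcMl => //.
  under eq_fun do rewrite -mulN1r.
  apply: continuous_fM; first exact: continuous_fcst.
  apply: continuous_fD; first by apply: continuous_fM => //; exact: continuous_fcst.
  by apply: continuous_fM => //; apply: continuous_fM => //; exact: continuous_fcst.
have i1 := Cc_integrable C1; have i2 := Cc_integrable C2; have i3 := Cc_integrable Cf.
rewrite -(RintegralZl _ measurableT i3).
have -> : Int (fun x => l * f x) = Int (fun x => G (sqn x) * \sum_i f' i x * x 0 i -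
    f x * - (N%:R * G (sqn x) + 2 * sqn x * G' (sqn x)) + l * f x).
  rewrite (RintegralD measurableT (Cc_integrable (CcB C1 C2)) (Cc_integrable (CcZ l Cf))).
  by rewrite (RintegralB measurableT i1 i2) flux subrr add0r.
apply: le_Rintegral; [exact: measurableT|exact: Cc_integrable| |by move=> x _; exact: le1].
by apply: Cc_integrable; apply: CcD; [exact: CcB|exact: CcZ].
Qed.

End profile_energy.

(** * Upper bound for eccentric rings *)

Section eccentric.
Context {R : realType} {N : nat}.
Local Notation V := 'rV[R]_N.
Local Notation mu := (lebesgue_rV N).
Local Notation "'Int' f" := (\int[mu]_x f x) (at level 10).
Context (p s0 s1 l sg : R) (g P : R -> R).
Context (p1 : 1 < p) (s00 : 0 < s0) (s01 : s0 < s1) (RS : radial_system N%:R p s0 s1 l g P sg).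

Local Notation W := (profile s0 s1 P).

Lemma Cc_radial (F : R -> R) (S : R) : continuous F -> (forall t, S < t -> F t = 0) ->
  Cc (fun x : V => F (sqn x)).
Proof.
move=> cF F0; split; last by exists (Num.max S 1) => x /lt_sqn; exact: F0.
exact: (continuous_fcomp (@sqn_continuous0 R N) cF).
Qed.

(** The maximum of the two profiles before truncation, one frozen at 1 inside its critical sphere,
    the other outside. The gain of an eccentric hole is the integral of [1 - overlap^p]. *)
Definition overlap (a x : V) : R :=
  Num.max (W (Num.max (sqn x) sg)) (W (Num.min (sqn (x - a)) sg)).

Lemma overlap_continuous a : continuous (overlap a).
Proof.
have cW : continuous W by exact: (profile_continuous s01 RS).
have c1 : continuous (fun t : R => Num.max t sg).
  by move=> t; apply: continuous_max; [exact: cvg_id|exact: cst_continuous].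
have c2 : continuous (fun t : R => Num.min t sg).
  by move=> t; apply: continuous_min; [exact: cvg_id|exact: cst_continuous].
have d1 := continuous_fcomp (continuous_fcomp (@sqn_continuous0 R N) c1) cW.
have d2 := continuous_fcomp (continuous_fcomp (@sqn_continuous R N a) c2) cW.
suff : continuous (fun x : V => Num.max (W (Num.max (sqn x) sg)) (W (Num.min (sqn (x - a)) sg))) by [].
by move=> x; apply: (@continuous_max _ _ _ _ _ (d1 x) (d2 x)).
Qed.

Lemma overlap01 a x : 0 <= overlap a x <= 1.
Proof.
apply/andP; split; first by rewrite le_max (profile_ge0 s01 RS).
by rewrite ge_max !(profile_le1 s00 s01 RS).
Qed.

Lemma overlap_far a x : sg <= sqn (x - a) -> overlap a x = 1.
Proof.
move=> h; have := overlap01 a x; rewrite /overlap (min_r h) (profile_sg RS) => /andP[_ h1].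
by apply/eqP; rewrite eq_le h1 le_max lexx orbT.
Qed.

(* The two balls of radius sqrt sg centred at 0 and a are distinct. *)
Lemma overlap_lt1 a : a != 0 -> exists x, overlap a x < 1.
Proof.
move=> a0; have [_ /andP[s0sg _] _ _ _] := RS.
have sg0 : 0 < sg := lt_trans s00 s0sg.
set rho := Num.sqrt sg; have rho0 : 0 < rho by rewrite sqrtr_gt0.
have rho2 : rho ^+ 2 = sg by rewrite sqr_sqrtr// ltW.
have ea : 0 < enorm a.
  by rewrite lt_neqAle enorm_ge0 andbT eq_sym; apply: contra a0 => /eqP/enorm_eq0 ->.
(* Chosen so that [t |a| < rho < (t + 1) |a|]: the point [(t + 1) a] is outside the ball about 0 and
   inside the one about [a]. *)
pose t := Num.max ((rho - enorm a / 2) / enorm a) 0.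
have t0 : 0 <= t by rewrite le_max lexx orbT.
have t1 : t * enorm a < rho.
  rewrite -ltr_pdivlMr// gt_max; apply/andP; split; last by rewrite divr_gt0.
  by rewrite ltr_pM2r ?invr_gt0//; lra.
have t2 : rho < (t + 1) * enorm a.
  have : (rho - enorm a / 2) / enorm a * enorm a <= t * enorm a.
    by rewrite ler_pM2r// le_max lexx.
  by rewrite divfK ?gt_eqF// mulrDl mul1r; lra.
exists ((t + 1) *: a); rewrite gt_max.
have -> : (t + 1) *: a - a = t *: a by rewrite scalerDl scale1r addrK.
have h1 : sg < sqn ((t + 1) *: a).
  rewrite -enorm_sqr enormZ ger0_norm ?addr_ge0// -rho2 ltr_sqr ?nnegrE ?(ltW rho0)//.
  by rewrite mulr_ge0 ?addr_ge0// enorm_ge0.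
have h2 : sqn (t *: a) < sg.
  rewrite -enorm_sqr enormZ ger0_norm// -rho2 ltr_sqr ?nnegrE ?(ltW rho0)//.
  by rewrite mulr_ge0// enorm_ge0.
rewrite (max_l (ltW h1)) (min_l (ltW h2)) !(profile_lt1 s00 s01 RS)//.
  by rewrite lt_eqF.
by rewrite gt_eqF.
Qed.

End eccentric.

Section eccentric_bound.
Context {R : realType} {N : nat}.
Local Notation V := 'rV[R]_N.
Local Notation mu := (lebesgue_rV N).
Local Notation "'Int' f" := (\int[mu]_x f x) (at level 10).

(** The gain [gam] is computed for the untruncated eigenfunction and thus fixed before the
    truncation level, which can then be chosen to lose less than [gam]. *)
Lemma eccentric_upper_bound (p s0 s1 l sg : R) (g P : R -> R) (a : V) (Omega : set V) :
  1 < p -> 0 < s0 -> s0 < s1 -> radial_system N%:R p s0 s1 l g P sg ->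
  a != 0 -> measurable Omega ->
  (forall x, sqn x < s1 -> s0 < sqn (x - a) -> Omega x) -> (lambda1 p Omega < l%:E)%E.
Proof.
move=> p1 s00 s01 RS a0 mO Os; set W := profile s0 s1 P; have [l0 /andP[s0sg sgs1] _ _ _] := RS.
have p0 : 0 < p := lt_trans ltr01 p1.
have sg0 : 0 < sg := lt_trans s00 s0sg.
have W0 t : 0 <= W t := profile_ge0 s01 RS t.
have W1 t : W t <= 1 := profile_le1 s00 s01 RS t.
have Wsg : W sg = 1 := profile_sg RS.
have cW : continuous W by exact: (profile_continuous s01 RS).
have Wout t : s1 < t -> W t = 0.
  by move=> h; apply: (profile_out s01 RS); rewrite negb_and -!leNgt (ltW h) orbT.
pose m := overlap s0 s1 sg P a; have m01 : forall x, 0 <= m x <= 1 := overlap01 s00 s01 RS a; have onep : (1 : R) `^ p = 1 by [rewrite powR1]; 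
have mfar x : sg <= sqn (x - a) -> m x = 1 := @overlap_far _ _ _ _ _ _ _ _ _ s00 s01 RS a x.
have cm : continuous m by exact: (overlap_continuous s01 RS).
(* Away from the ball about [a] the overlap is 1, so a function of it that vanishes at 1 has compact
   support. *)
have far_Cc (F : R -> R) : continuous F -> F 1 = 0 -> Cc (fun x => F (m x)).
  move=> cF F1; split; first exact: (continuous_fcomp cm cF).
  exists (Num.max sg 1 + enorm a) => x xM; rewrite mfar// ltW//; apply: lt_sqn.
  by apply: lt_le_trans (enormB x a); rewrite ltrBrDr.
have cnp (F : R -> R) : continuous F -> continuous (fun t => `|F t| `^ p).
  by move=> cF; exact: (continuous_fcomp cF (powR_norm_cont p0)).
have Cgain : Cc (fun x => 1 - `|m x| `^ p).
  apply: (far_Cc (fun t => 1 - `|t| `^ p)); last by rewrite normr1 powR1 subrr.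
  by apply: continuous_fB; [exact: continuous_fcst|exact: powR_norm_cont].
have mp1 x : `|m x| `^ p <= 1.
  have /andP[h1 h2] := m01 x; rewrite ger0_norm// -[leRHS]onep.
  by rewrite ge0_ler_powR ?nnegrE// ltW.
have gain0 : 0 < Int (fun x => 1 - `|m x| `^ p).
  have [x0 mx0] := overlap_lt1 s00 s01 RS a0; apply: (@Int_gt0 _ _ _ x0 Cgain).
    by move=> x; rewrite subr_ge0 mp1.
  have /andP[h1 _] := m01 x0; rewrite subr_gt0 ger0_norm// -[ltRHS]onep.
  by rewrite gt0_ltr_powR ?nnegrE.
set gam := Int (fun x => 1 - `|m x| `^ p) in gain0.
have CWp : Cc (fun x : V => `|W (sqn x)| `^ p) by exact: (Cc_norm_powR p0 (Cc_radial cW Wout)).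
set Ip := Int (fun x : V => `|W (sqn x)| `^ p).
have CcC := Cc_cutoff (N := N) s1; pose M := Int (cutoff s1 : V -> R).
have M0 : 0 <= M by apply: Rintegral_ge0 => x _; exact: cutoff_ge0.
(* Truncation is paid for twice, once in the mass of the eigenfunction and once in the gain:
   [2 eta M < gam]. *)
pose eta := gam / (2 * (M + 1)).
have D0 : 0 < 2 * (M + 1) by rewrite mulr_gt0// ltr_wpDl.
have eta0 : 0 < eta by rewrite divr_gt0.
have etaE : eta * (2 * (M + 1)) = gam by rewrite /eta mulfVK// gt_eqF.
have [d d0 unif] := powR_unif_continuous 1 p0 eta0.
(* The bound 1/4 keeps the maximum 1 well above the truncation level, so the critical radius stays
   inside the truncated shell. *)
pose e := Num.min (d / 4) (1 / 4).
have e0 : 0 < e by rewrite lt_min !divr_gt0.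
have ed : 2 * e < d.
  by have : e <= d / 4 by [rewrite ge_min lexx]; clear - d0; lra.
have e1 : e < 1.
  by have : e <= 1 / 4 by [rewrite ge_min lexx orbT]; lra.
have [Y [y [CY dY y01 YN [yN Y0 Yge Yle]]]] := smooth_positive_part e0.
pose Z (t : R) := Y (t - e); pose z (t : R) := y (t - e).
have dZ (t : R) : is_derive t 1 Z (z t).
  rewrite -[z t]mulr1; apply: (@is_derive_fcomp _ _ Y (fun t => t - e)).
  by apply: is_derive_fDc; exact: is_derive_id.
have cz : continuous z.
  have cy : continuous y.
    have [y' dy' Cy'] := CY 2%N; suff <- : y' = y by exact: (Ck_continuous Cy').
    by apply/funext => t; have [_ <-] := dy' t; have [_ <-] := dY t.
  have ct : continuous (fun t : R => t - e).
    by apply: continuous_fB; [move=> t; exact: cvg_id|exact: continuous_fcst].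
  exact: (continuous_fcomp ct cy).
have z01 t : 0 <= z t <= 1 by exact: y01.
have ZN t : t <= e -> Z t = 0 /\ z t = 0.
  by move=> h; rewrite /Z /z YN ?yN// subr_le0.
have Z0 t : 0 <= Z t by exact: Y0.
have Zge t : t - 2 * e <= Z t by have := Yge (t - e); rewrite /Z; clear; lra.
have Zle t : 0 <= t -> Z t <= t.
  move=> t0; have [h|h] := leP t e; first by rewrite (ZN t h).1.
  by have := Yle (t - e); rewrite subr_ge0 (ltW h) => /(_ isT); rewrite -/(Z t); clear - e0; lra.
have Zmono s t : s <= t -> Z s <= Z t.
  by move=> st; apply: nondecreasing_of_derive st dZ _ => x; case/andP: (z01 x).
have Zunif t : 0 <= t <= 1 -> t `^ p - eta <= Z t `^ p.
  move=> t01; have /andP[t0 _] := t01; have := unif t (Z t) t01 (Z0 t).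
  rewrite ger0_norm ?subr_ge0 ?Zle//.
  have h : t - Z t < d by have := Zge t; clear - ed; lra.
  by move=> /(_ h) /ler_normlP[_]; clear; lra.
have [a' [b' [s0a' b's1 small]]] := profile_small s01 RS e0; rewrite -/W in small.
have a'b' : a' <= b'.
  rewrite leNgt; apply/negP => h; have := small sg; rewrite Wsg => H.
  have : 1 < e by apply: H; case: (leP a' sg) => //= h'; exact: lt_le_trans h h'.
  by clear - e1; lra.
have [dU cu U0] := truncated_profile p1 s00 RS s0a' b's1 small dZ cz ZN; rewrite -/W in dU U0.
set u := truncated_slope _ _ _ _ _ _ in dU cu U0.
pose U t := Z (W t).
have usg : u sg = 0 by rewrite /u /truncated_slope (profile_slope_sg s00 RS) mulr0 mul0r.
pose A t := U (Num.max t sg); pose A' t := u (Num.max t sg).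
pose B t := U (Num.min t sg); pose B' t := u (Num.min t sg).
have dA (t : R) : is_derive t 1 A (A' t) by exact: is_derive_max dU usg.
have dB (t : R) : is_derive t 1 B (B' t) by exact: is_derive_min dU usg.
have cmax : continuous (fun t : R => Num.max t sg).
  by move=> t; apply: continuous_max; [exact: cvg_id|exact: cst_continuous].
have cmin : continuous (fun t : R => Num.min t sg).
  by move=> t; apply: continuous_min; [exact: cvg_id|exact: cst_continuous].
have cA' : continuous A' := continuous_fcomp cmax cu.
have cB' : continuous B' := continuous_fcomp cmin cu.
(* Strictly between the ring's radii and the support of the truncated profile, since the ring is
   open and a closed support must fit inside. *)
pose alpha := (a' + s0) / 2; pose beta := (b' + s1) / 2.
have Abeta t : beta <= t -> A t = 0 /\ A' t = 0.
  move=> h; apply: U0; apply/orP; right; rewrite lt_max; apply/orP; left.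
  by apply: lt_le_trans h; rewrite /beta; clear - b's1; lra.
have Balpha t : t <= alpha -> B t = 0 /\ B' t = 0.
  move=> h; apply: U0; apply/orP; left; rewrite gt_min; apply/orP; left.
  by apply: le_lt_trans h _; rewrite /alpha; clear - s0a'; lra.
pose K := Z 1.
have Bsg t : sg <= t -> B t = K by move=> h; rewrite /B min_r// /U Wsg.
have Asg t : t <= sg -> A t = K by move=> h; rewrite /A max_r// /U Wsg.
have bsg : sg <= beta.
  rewrite leNgt; apply/negP => h; have := (Abeta sg (ltW h)).1.
  rewrite /A maxxx /U Wsg; have := Zge 1.
  have : e <= 1 / 4 by rewrite ge_min lexx orbT.
  by clear; lra.
have B'sg t : sg <= t -> B' t = 0 by move=> h; rewrite /B' min_r.
(* At each point one of [A'], [B'] vanishes and the other is the slope of the truncated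
   eigenfunction, so the two energies add up to its energy. *)
have energy : Int (radial_energy p A' : V -> R) + Int (radial_energy p B' : V -> R) <= l * Ip.
  have C1 : Cc (radial_energy p A' : V -> R).
    by apply: (@Cc_radial_energy _ _ _ _ beta) => // t h; exact: (Abeta t (ltW h)).2.
  have C2 : Cc (radial_energy p B' : V -> R).
    by apply: (@Cc_radial_energy _ _ _ _ sg) => // t h; apply: B'sg; exact: ltW.
  rewrite -(RintegralD measurableT (Cc_integrable C1) (Cc_integrable C2)).
  rewrite [leLHS](_ : _ = Int (radial_energy p u : V -> R)); last first.
    apply: eq_Rintegral => x _; rewrite /radial_energy /A' /B'.
    have [h|/ltW h] := leP (sqn x) sg.
      by rewrite usg normr0 mulr0 mul0r powR0 ?add0r// gt_eqF.
    by rewrite usg normr0 mulr0 mul0r powR0 ?addr0// gt_eqF.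
  apply: le_trans (truncated_energy p1 s00 RS s0a' a'b' b's1 small dZ cz ZN z01) _.
  rewrite ler_pM2l//.
  have Wp t : W t * W t `^ (p - 1) = `|W t| `^ p.
    rewrite (ger0_norm (W0 t)); have [->|Wt] := eqVneq (W t) 0; first by rewrite mul0r powR0// gt_eqF.
    by rewrite -{1}(powRr1 (W0 t)) -powRD ?(addrC 1) ?subrK// Wt implybT.
  apply: le_Rintegral; [exact: measurableT| |exact: (Cc_integrable CWp)|].
    have cU : continuous U by move=> t; exact: is_derive_cont (dU t).
    have pm0 : 0 < p - 1 by rewrite subr_gt0.
    have cWp := continuous_fcomp cW (powR_norm_cont pm0).
    have C : Cc (fun x : V => U (sqn x) * `|W (sqn x)| `^ (p - 1)).
      apply: (@Cc_radial R N (fun t => U t * `|W t| `^ (p - 1)) s1); first exact: continuous_fM.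
      by move=> t h; rewrite /U (Wout _ h) (ZN 0 (ltW e0)).1 mul0r.
    rewrite (_ : (fun x => _) = fun x : V => U (sqn x) * `|W (sqn x)| `^ (p - 1)); first exact: Cc_integrable.
    by apply/funext => x; rewrite (ger0_norm (W0 _)).
  by move=> x _; rewrite -Wp ler_wpM2r ?powR_ge0// Zle.
(* [Z] is monotone and commutes with the maximum. *)
have overlapE x : Num.max (A (sqn x)) (B (sqn (x - a))) = Z (m x).
  rewrite /A /B /U /m /overlap; have [h|/ltW h] := leP (W (Num.max (sqn x) sg)) (W (Num.min (sqn (x - a)) sg)).
    by rewrite max_r// Zmono.
  by rewrite max_l// Zmono.
have vol : Ip - eta * M + (gam - eta * M) <=
    Int (fun x => Num.min (A (sqn x)) (B (sqn (x - a))) `^ p).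
  have cA : continuous A by move=> t; exact: is_derive_cont (dA t).
  have cB : continuous B by move=> t; exact: is_derive_cont (dB t).
  have cZ : continuous Z by move=> t; exact: is_derive_cont (dZ t).
  have CA : Cc (fun x : V => `|A (sqn x)| `^ p).
    apply: (Cc_norm_powR p0); apply: (@Cc_radial R N _ beta) => // t h.
    exact: (Abeta t (ltW h)).1.
  have CB : Cc (fun x : V => K `^ p - `|B (sqn x)| `^ p).
    apply: (@Cc_radial R N (fun t => K `^ p - `|B t| `^ p) sg).
      by apply: continuous_fB; [exact: continuous_fcst|exact: cnp].
    by move=> t h; rewrite Bsg ?(ltW h)// (ger0_norm (Z0 1)) subrr.
  have CG : Cc (fun x => K `^ p - `|Z (m x)| `^ p).
    apply: (far_Cc (fun t => K `^ p - `|Z t| `^ p)); last by rewrite (ger0_norm (Z0 1)) subrr.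
    by apply: continuous_fB; [exact: continuous_fcst|exact: cnp].
  have iA := Cc_integrable CA; have iB := Cc_integrable CB; have iG := Cc_integrable CG.
  have i5 := Cc_integrable CcC; have i6 := Cc_integrable (CcZ eta CcC).
  (* The identity for [min^p + max^p], arranged so that every integral converges: [B] and the
     maximum equal [K] far away, so their powers appear subtracted from [K^p]. *)
  have -> : Int (fun x => Num.min (A (sqn x)) (B (sqn (x - a))) `^ p) =
      Int (fun x => `|A (sqn x)| `^ p) - Int (fun x => K `^ p - `|B (sqn x)| `^ p) +
      Int (fun x => K `^ p - `|Z (m x)| `^ p).
    rewrite -(Int_shift a CB) -(RintegralB measurableT iA (Cc_integrable (Cc_shift a CB))).
    rewrite -(RintegralD measurableT (Cc_integrable (CcB CA (Cc_shift a CB))) iG).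
    apply: eq_Rintegral => x _; rewrite -overlapE.
    rewrite (ger0_norm (Z0 (W (Num.max (sqn x) sg)))) (ger0_norm (Z0 (W (Num.min (sqn (x - a)) sg)))).
    rewrite -/(A (sqn x)) -/(B (sqn (x - a))) ger0_norm; last by rewrite le_max Z0.
    by have [h|h] := leP (A (sqn x)) (B (sqn (x - a))); ring.
  rewrite -(RintegralB measurableT iA iB); apply: lerD.
    rewrite -(RintegralZl _ measurableT i5) -(RintegralB measurableT (Cc_integrable CWp) i6).
    apply: le_Rintegral; [exact: measurableT|exact: (Cc_integrable (CcB CWp (CcZ eta CcC)))|exact: (Cc_integrable (CcB CA CB))|].
    move=> x _; set t := sqn x.
    have -> : `|A t| `^ p - (K `^ p - `|B t| `^ p) = U t `^ p.
      have [h|/ltW h] := leP t sg.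
        rewrite Asg// /B min_l// (ger0_norm (Z0 1)) -/(U t) (ger0_norm (Z0 (W t))).
        by rewrite opprB addrC subrK.
      by rewrite Bsg// /A max_l// (ger0_norm (Z0 1)) (ger0_norm (Z0 (W t))) subrr subr0.
    rewrite (ger0_norm (W0 t)); have [ts|ts] := leP t (s1 + 1); last first.
      rewrite Wout ?(lt_trans _ ts) ?ltrDl// powR0 ?gt_eqF// sub0r.
      by apply: (@le_trans _ _ 0); [rewrite oppr_le0 mulr_ge0 ?cutoff_ge0 ?(ltW eta0)|exact: powR_ge0].
    have h3 : eta * 1 <= eta * cutoff s1 x by rewrite ler_pM2l// cutoff_ge1.
    apply: le_trans (Zunif (W t) _); last by rewrite W0 W1.
    by clear - h3; lra.
  rewrite -(RintegralZl _ measurableT i5) -(Int_shift a (CcZ eta CcC)).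
  have C2 := Cc_shift a (CcZ eta CcC).
  rewrite -(RintegralB measurableT (Cc_integrable Cgain) (Cc_integrable C2)).
  apply: le_Rintegral; [exact: measurableT|exact: (Cc_integrable (CcB Cgain C2))|exact: iG|].
  move=> x _; have eC : 0 <= eta * cutoff s1 (x - a) by rewrite mulr_ge0 ?cutoff_ge0 ?(ltW eta0).
  have [h|h] := leP sg (sqn (x - a)).
    by rewrite (mfar _ h) normr1 powR1 subrr (ger0_norm (Z0 1)) subrr sub0r oppr_le0.
  have h3 : eta * 1 <= eta * cutoff s1 (x - a).
    by rewrite ler_pM2l// cutoff_ge1// (le_trans (ltW h))// (le_trans (ltW sgs1))// lerDl.
  have /andP[m0 m1] := m01 x.
  have h4 := Zunif 1; rewrite powR1 ler01 lexx in h4; have {}h4 := h4 isT.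
  have h5 : `|Z (m x)| `^ p <= `|m x| `^ p.
    by rewrite (ger0_norm (Z0 _)) (ger0_norm m0) ge0_ler_powR ?nnegrE ?(ltW p0)//; exact: Zle.
  by rewrite -/K in h4; clear - h3 h4 h5; lra.
apply: (@shell_function_energy _ _ p alpha beta sg K l A A' B B' a Omega p1 l0 _ sg0 mO _
  dA cA' dB cB' _ _ _ _ Bsg).
- exact: lt_le_trans bsg.
- move=> x h1 h2; apply: Os.
    by apply: le_lt_trans h1 _; rewrite /beta; clear - b's1; lra.
  by apply: lt_le_trans h2; rewrite /alpha; clear - s0a'; lra.
- by move=> t; exact: Z0.
- by move=> t; exact: Z0.
- by move=> t /Abeta[].
- by move=> t /Balpha[].
apply: le_lt_trans energy _; rewrite ltr_pM2l//; apply: lt_le_trans vol.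
by clear - etaE eta0; lra.
Qed.

End eccentric_bound.

Section ring_domains.
Context {R : realType} {N : nat}.
Local Notation V := 'rV[R]_N.
Implicit Types (x a : V) (r : R).

Lemma measurable_ring_domain (r0 r1 : R) a : measurable (ring_domain r0 r1 a).
Proof.
apply: measurableD.
  apply: open_measurable_rV.
  have := @open_comp _ _ (fun x : V => enorm (x - 0)) [set t : R | t < r1].
  by apply; [move=> x _; exact: enorm_continuous|exact: open_lt].
rewrite -[closure _]setCK; apply: measurableC; apply: open_measurable_rV.
by apply: closed_openC; exact: closed_closure.
Qed.

Lemma ring_domain_sqn (r0 r1 : R) x : 0 < r0 -> 0 < r1 -> ring_domain r0 r1 0 x -> r0 ^+ 2 < sqn x < r1 ^+ 2.
Proof.
move=> r00 r10 [x1 x0]; move: x1; rewrite /eball/= subr0 enorm_lt ?(ltW r10)// => ->; rewrite andbT ltNge.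
apply/negP => h; apply: x0; apply: sub_closure_eball => //=.
by rewrite subr0 enorm_le ?(ltW r00).
Qed.

Lemma sqn_ring_domain (r0 r1 : R) a x : 0 < r0 -> 0 < r1 ->
  sqn x < r1 ^+ 2 -> r0 ^+ 2 < sqn (x - a) -> ring_domain r0 r1 a x.
Proof.
move=> r00 r10 x1 x0; split; first by rewrite /eball/= subr0 enorm_lt// ltW.
by move=> /closure_eball_sub/=; rewrite enorm_le ?(ltW r00)// leNgt x0.
Qed.

End ring_domains.

Theorem theorem6p2 (R : realType) (N : nat) (p r0 r1 : R)
    (hN : (1 <= N)%N) (hp : 1 < p) (hr0 : 0 < r0) (hr1 : r0 < r1) :
  let Omega0 : set 'rV[R]_N := ring_domain r0 r1 0 in
  ring_family r0 r1 Omega0 /\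
  forall Omega : set 'rV[R]_N, ring_family r0 r1 Omega ->
    (lambda1 p Omega <= lambda1 p Omega0)%E /\
    (lambda1 p Omega = lambda1 p Omega0 -> Omega = Omega0).
Proof.
move=> Omega0; have r10 : 0 < r1 := lt_trans hr0 hr1.
split.
  exists 0 => // x /closure_eball_sub/= h; exact: le_lt_trans h hr1.
move=> _ [a _ ->]; have [->|a0] := eqVneq a 0; first by split.
have s00 : 0 < r0 ^+ 2 by rewrite exprn_gt0.
have s01 : r0 ^+ 2 < r1 ^+ 2 by rewrite ltr_sqr ?nnegrE ?ltW.
have [l [g [P [sg RS]]]] := radial_system_exists (ler0n R N) hp s00 s01.
have [l0 _ _ _ _] := RS.
(* For [a != 0] the two bounds are strictly separated by [l]; this proves the inequality and rules
   out equality at once. *)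
have lower : (l%:E <= lambda1 p Omega0)%E.
  apply: (eigenvalue_lower_bound hp l0 (measurable_ring_domain _ _ _)) => phi.
  apply: (test_function_lower_bound hp s00 s01 RS) => x.
  exact: ring_domain_sqn.
have upper : (lambda1 p (ring_domain r0 r1 a) < l%:E)%E.
  apply: (eccentric_upper_bound hp s00 s01 RS a0 (measurable_ring_domain _ _ _)) => x.
  exact: sqn_ring_domain.
have lt := lt_le_trans upper lower.
by split; [exact: ltW|move=> E; move: lt; rewrite E ltxx].
Qed.
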